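(* Let $[\boldsymbol D,\boldsymbol o]$ be a unimodular discrete space. Then, for all equivariant weight functions $\boldsymbol w$ such that $0<\mathbb E[\boldsymbol w(\boldsymbol o)]<\infty$, one has $$\operatorname{ess\,inf}\big(\underline{\mathrm{growth}}(\boldsymbol w(N_r(\boldsymbol o)))\big)\le\mathrm{udim}_H(\boldsymbol D)\le\operatorname{ess\,inf}\big(\overline{\mathrm{growth}}(\boldsymbol w(N_r(\boldsymbol o)))\big)\le\overline{\mathrm{growth}}\big(\mathbb E[\boldsymbol w(N_r(\boldsymbol o))]\big).$$
   Context: Growth rates. For a nonnegative function $f$, $\overline{\mathrm{growth}}(f):=\limsup_{r\to\infty}\frac{\log f(r)}{\log r}$ and $\underline{\mathrm{growth}}(f):=\liminf_{r\to\infty}\frac{\log f(r)}{\log r}$. Discrete spaces. A discrete space is a metric space $(D,d)$ in which every ball of finite radius is finite. A pointed discrete space $(D,o)$ has a distinguished point $o$ (the origin); doubly-pointed ones have two. A marked discrete space carries a function $m:D\times D\to\Xi$ with $\Xi$ a complete separable metric space; $m(x):=m(x,x)$. Isomorphisms are isometries preserving origins and marks. $\mathcal D_*,\mathcal D_{**}$ (resp. $\mathcal D'_*,\mathcal D'_{**}$) are the sets of isomorphism classes of pointed and doubly-pointed discrete spaces (resp. marked ones), with classes in brackets, and the Borel $\sigma$-field of the following metric: $1\wedge$ the infimum of $\epsilon>0$ such that, in both directions, there is an injection from the closed ball of radius $1/\epsilon$ around the origin of one space into the other, preserving origins and changing distances and marks by at most $\epsilon$. A unimodular discrete space is a random element $[\boldsymbol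 D,\boldsymbol o]$ of $\mathcal D_*$ such that $\mathbb E[\sum_{v\in\boldsymbol D}g[\boldsymbol D,\boldsymbol o,v]]=\mathbb E[\sum_{v\in\boldsymbol D}g[\boldsymbol D,v,\boldsymbol o]]$ for all measurable $g:\mathcal D_{**}\to[0,\infty)$. Equivariant processes. An equivariant process with values in $\Xi$ assigns to every deterministic discrete space $D$ a random element $\boldsymbol Z_D$ of $\Xi^{D\times D}$ (extra randomness allowed) such that (i) for every isometry $\rho:D_1\to D_2$, $\boldsymbol Z_{D_1}\circ\rho^{-1}$ has the same distribution as $\boldsymbol Z_{D_2}$; (ii) for every measurable $A\subseteq\mathcal D'_*$, $[D,o]\mapsto\mathbb P[[D,o;\boldsymbol Z_D]\in A]$ is measurable. It suffices that it be defined for almost all realizations of $\boldsymbol D$; $[\boldsymbol D,\boldsymbol o;\boldsymbol Z_{\boldsymbol D}]$ is obtained by sampling $[\boldsymbol D,\boldsymbol o]$ and then the marking. An equivariant weight function $\boldsymbol w$ is an equivariant process with values in $[0,\infty)$ (marks on points); $\boldsymbol w(S):=\sum_{v\in S}\boldsymbol w(v)$ for $S\subseteq\boldsymbol D$. Hausdorff dimension. $N_r(v)=\{u:d(u,v)\le r\}$ for $r\ge1$ and $N_0(v):=\emptyset$. An equivariant covering is an equivariant process $\boldsymbol R$ with values in $\{0\}\cup[1,\infty)$ on points such that the balls $N_{\boldsymbol R(v)}(v)$, $v\in\boldsymbol D$, cover $\boldsymbol D$ a.s. $\mathcal H^\alpha_1(\boldsymbol D):=\inf_{\boldsymbol R}\mathbb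 E[\boldsymbol R(\boldsymbol o)^\alpha]$ over all equivariant coverings ($0^0:=0$), and $\mathrm{udim}_H(\boldsymbol D):=\sup\{\alpha\ge0:\mathcal H^\alpha_1(\boldsymbol D)=0\}$, $\sup\emptyset:=0$.
   Formalization: The inequality udim_H(D) ≤ ess inf of the upper growth of w(N_r(o)) is stated only when a.s. w is not identically 0 on D (false otherwise: D = Z, w ≡ 0 or w ≡ 1 with probability 1/2 each); udim_H(D) ≤ upper growth of E[w(N_r(o))] is stated separately for all w. *)

(* Defs.v *)
From HB Require Import structures.
From mathcomp Require Import all_boot all_order all_algebra generic_quotient.
From mathcomp Require Import all_classical all_reals all_analysis.
From mathcomp Require Import measurable_realfun ess_sup_inf.

Set Implicit Arguments.
Unset Strict Implicit.
Unset Printing Implicit Defensive.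

Import Order.TTheory GRing.Theory Num.Theory.
Import numFieldNormedType.Exports.

Local Open Scope classical_set_scope.
Local Open Scope ring_scope.

HB.mixin Record isSeparable T & Topological T := {
  separable : exists2 S : set T, countable S & dense S }.

#[short(type="polishType")]
HB.structure Definition Polish (R : realType) :=
  {T of Metric R T & CompletePseudoMetric R T & isSeparable T}.

Section UnitPolish.
Context {R : realType}.

(* The one-point mark space; the argument keys the metric structure. *)
Definition no_mark (_ : realType) := unit.
Local Notation T := (no_mark R).

HB.instance Definition _ := Choice.on T.
HB.instance Definition _ := isPointed.Build T tt.

Let d (x y : T) : R := 0.
Let dxx x : d x x = 0. Proof. by []. Qed.
Let d_eq0 x y : d x y = 0 -> x = y. Proof. by case: x; case: y. Qed.
Let d_sym x y : d x y = d y x. Proof. by []. Qed.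
Let d_tri y x z : d x z <= d x y + d y z. Proof. by rewrite /d addr0. Qed.

HB.instance Definition _ := isMetric.Build R T dxx d_eq0 d_sym d_tri.

Let cauchy_cvgT (F : set_system T) : ProperFilter F -> cauchy F -> cvg F.
Proof.
move=> FF _; apply/cvg_ex; exists tt => A /nbhs_singleton At.
by rewrite /= (_ : A = setT) ?seteqP; [exact: filterT | split=> -[]].
Qed.

HB.instance Definition _ := Uniform_isComplete.Build T cauchy_cvgT.

Let separableT : exists2 S : set T, countable S & dense S.
Proof.
exists setT; last by move=> O O0 _; rewrite setIT.
exact: countableP.
Qed.

HB.instance Definition _ := isSeparable.Build T separableT.

End UnitPolish.

Section ClosedSubspace.
Context {R : realType} (P : {pred R}) (clP : closed [set x | P x])
  (x0 : R) (Px0 : P x0).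

Definition closed_subspace of closed [set x | P x] & P x0 := {x : R | P x}.

Local Notation T := (closed_subspace clP Px0).

HB.instance Definition _ := Choice.on T.
HB.instance Definition _ := isPointed.Build T (exist _ x0 Px0).

Let d (x y : T) : R := `|sval x - sval y|.
Let dxx x : d x x = 0. Proof. by rewrite /d subrr normr0. Qed.
Let d_eq0 x y : d x y = 0 -> x = y.
Proof. by move/eqP; rewrite normr_eq0 subr_eq0 => /eqP /val_inj. Qed.
Let d_sym x y : d x y = d y x. Proof. exact: distrC. Qed.
Let d_tri y x z : d x z <= d x y + d y z. Proof. exact: ler_distD. Qed.

HB.instance Definition _ := isMetric.Build R T dxx d_eq0 d_sym d_tri.

Let ballT (x : T) e : ball x e = [set y : T | `|sval x - sval y| < e].
Proof. by rewrite ballEmdist. Qed.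

Let cauchy_cvgT (F : set_system T) : ProperFilter F -> cauchy F -> cvg F.
Proof.
move=> FF /cauchy_ballP cF.
have cG : cauchy (sval @ F).
  apply/cauchy_ballP => e e0; have := cF e e0.
  move=> [[A B] /= [FA FB] AB]; exists ([set sval x | x in A], [set sval x | x in B]).
    by split; [apply: filterS FA | apply: filterS FB] => x ?; exists x.
  move=> [_ _] /= [[x Ax <-] [y By <-]]; have /= := AB (x, y) (conj Ax By).
  by rewrite ballT.
have /cvg_ex [l Gl] : cvg (sval @ F) by exact: cauchy_cvg.
have Pl : P l.
  have PF : \forall x \near F, [set x | P x] (sval x) by apply: nearW => -[].
  exact: (@closed_cvg _ _ F FF sval _ clP PF l Gl).
apply/cvg_ex; exists (exist _ l Pl : T).
apply/cvg_ballP => e e0; rewrite ballT.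
by move/cvgrPdist_lt: Gl => /(_ e e0).
Qed.

HB.instance Definition _ := Uniform_isComplete.Build T cauchy_cvgT.

Let pick_near (p : rat * nat) : T :=
  get [set x : T | `|ratr p.1 - sval x| < p.2.+1%:R^-1].

Let separableT : exists2 S : set T, countable S & dense S.
Proof.
exists (range pick_near).
  apply: (sub_countable (card_image_le _ _)); exact: countableP.
move=> O [x Ox] oO.
have /nbhs_ballP[e /= e0 xeO] : nbhs x O by exact: open_nbhs_nbhs.
have [n ne] : exists n : nat, n.+1%:R^-1 < e / 2.
  have /ltr_add_invr[n] : 0 < e / 2 by rewrite divr_gt0.
  by rewrite add0r; exists n.
have n0 : 0 < n.+1%:R^-1 :> R by rewrite invr_gt0.
have /rat_in_itvoo[q] : sval x - n.+1%:R^-1 < sval x + n.+1%:R^-1.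
  by rewrite ltrD2l gtrN.
rewrite in_itv/= => qx.
have xq : `|ratr q - sval x| < n.+1%:R^-1 by rewrite ltr_distl.
exists (pick_near (q, n)); split; last by exists (q, n).
apply: xeO; rewrite ballT /=.
have qp : `|ratr q - sval (pick_near (q, n))| < n.+1%:R^-1 .
  by apply: (@getPex _ [set y : T | `|ratr q - sval y| < n.+1%:R^-1]); exists x.
rewrite (le_lt_trans (ler_distD (ratr q) _ _))// (splitr e) ltrD//.
  by rewrite distrC (lt_trans xq).
exact: lt_trans qp ne.
Qed.

HB.instance Definition _ := isSeparable.Build T separableT.

End ClosedSubspace.

Section DiscreteSpaces.
Context {R : realType}.

(* The carrier is not a metricType: a metricType carries a choiceType structure,
   and the universes of the library forbid a choiceType on a type of such
   structures, which the set of isomorphism classes below needs. Nonnegativity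
   of dist follows from the other axioms. *)
Record discrete_space := DiscreteSpace {
  points :> Type;
  dist : points -> points -> R;
  dist_eq0 : forall x y, dist x y = 0 <-> x = y;
  dist_sym : forall x y, dist x y = dist y x;
  dist_triangle : forall y x z, dist x z <= dist x y + dist y z;
  finite_balls : forall x r, finite_set [set y | dist x y <= r] }.

HB.instance Definition _ (D : discrete_space) := gen_eqMixin (points D).
HB.instance Definition _ (D : discrete_space) := gen_choiceMixin (points D).

Definition is_isometry (D1 D2 : discrete_space) (f : D1 -> D2) :=
  bijective f /\ forall x y, dist (f x) (f y) = dist x y.

(* k.+1 distinguished points, of which pt ord0 is the origin: k = 0 for pointed
   and k = 1 for doubly-pointed spaces. Unmarked spaces have marks in no_mark. *)
Record marked_space (Xi : polishType R) (k : nat) := MarkedSpace {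
  base :> discrete_space;
  pt : 'I_k.+1 -> base;
  mark : base -> base -> Xi }.

Definition isomorphic (Xi : polishType R) (k : nat) (X Y : marked_space Xi k) :=
  exists f : X -> Y, [/\ is_isometry f,
    forall i, f (pt X i) = pt Y i &
    forall x y, mark (f x) (f y) = mark x y].

Section OnePoint.

Let d (x y : unit) : R := 0.
Let d_eq0 x y : d x y = 0 <-> x = y. Proof. by case: x; case: y. Qed.
Let d_sym x y : d x y = d y x. Proof. by []. Qed.
Let d_tri y x z : d x z <= d x y + d y z. Proof. by rewrite /d addr0. Qed.
Let d_fin x r : finite_set [set y | d x y <= r].
Proof. exact: finite_finset. Qed.

Definition one_point_space := DiscreteSpace d_eq0 d_sym d_tri d_fin.

End OnePoint.

Section Classes.
Variables (Xi : polishType R) (k : nat).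
Implicit Types X Y Z : marked_space Xi k.

HB.instance Definition _ := gen_eqMixin (marked_space Xi k).
HB.instance Definition _ := gen_choiceMixin (marked_space Xi k).

Lemma isomorphic_refl X : isomorphic X X.
Proof. by exists id; split=> //; split=> //; exists id. Qed.

Lemma isomorphic_sym X Y : isomorphic X Y -> isomorphic Y X.
Proof.
move=> [f [[[g fK gK] fd] fo fm]]; exists g; split.
- by split=> [|x y]; [exists f | rewrite -fd !gK].
- by move=> i; rewrite -fo fK.
- by move=> x y; rewrite -fm !gK.
Qed.

Lemma isomorphic_trans X Y Z :
  isomorphic X Y -> isomorphic Y Z -> isomorphic X Z.
Proof.
move=> [f [[fb fd] fo fm]] [g [[gb gd] go gm]]; exists (g \o f); split.
- by split=> [|x y /=]; [exact: bij_comp | rewrite gd fd].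
- by move=> i /=; rewrite fo go.
- by move=> x y /=; rewrite gm fm.
Qed.

Definition isomorphic_rel : rel (marked_space Xi k) :=
  fun X Y => `[< isomorphic X Y >].

Let isomorphic_rel_refl : reflexive isomorphic_rel.
Proof. by move=> X; apply/asboolP; exact: isomorphic_refl. Qed.
Let isomorphic_rel_sym : symmetric isomorphic_rel.
Proof. by move=> X Y; apply/asboolP/asboolP => /isomorphic_sym. Qed.
Let isomorphic_rel_trans : transitive isomorphic_rel.
Proof.
by move=> Y X Z /asboolP XY /asboolP YZ; apply/asboolP/(isomorphic_trans XY YZ).
Qed.

Canonical isomorphic_equiv :=
  EquivRel isomorphic_rel isomorphic_rel_refl isomorphic_rel_sym
    isomorphic_rel_trans.

Definition iso_class := {eq_quot isomorphic_rel}%qT.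

HB.instance Definition _ := Choice.on iso_class.
HB.instance Definition _ := EqQuotient.on iso_class.

Definition class_of X : iso_class := (\pi_iso_class X)%qT.

Lemma class_ofP X Y : class_of X = class_of Y <-> isomorphic X Y.
Proof.
split; first by move/eqP; rewrite piE => /asboolP.
by move=> XY; apply/eqP; rewrite piE; apply/asboolP.
Qed.

Lemma class_ofK (c : iso_class) : class_of (repr c) = c.
Proof. exact: reprK. Qed.

Lemma repr_class_of X : isomorphic X (repr (class_of X)).
Proof. by apply/class_ofP; rewrite class_ofK. Qed.

HB.instance Definition _ := isPointed.Build iso_class
  (class_of (@MarkedSpace Xi k one_point_space (fun=> tt) (fun _ _ => point))).

(* Only the restriction of f to B matters. *)
Definition near_embedding (e : R) X Y :=
  exists f : X -> Y, let B := [set x | dist (pt X ord0) x <= e^-1] in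
  [/\ {in B &, injective f},
    forall i, B (pt X i) -> f (pt X i) = pt Y i &
    forall x y, B x -> B y ->
      `|dist (f x) (f y) - dist x y| <= e /\
      mdist (mark (f x) (f y)) (mark x y) <= e].

(* Adjoining 1 takes the minimum with 1, also when no e qualifies, which happens
   for [D, o, o] and [D', o', v'] with v' <> o'. *)
Definition kappa (c c' : iso_class) : R :=
  inf ([set 1] `|` [set e | [/\ 0 < e, near_embedding e (repr c) (repr c') &
                                     near_embedding e (repr c') (repr c)]]).

(* The open sets of the metric kappa; they generate the Borel sigma-field. *)
Definition kappa_open : set (set iso_class) := [set U |
  forall c, U c -> exists2 e, 0 < e & [set c' | kappa c c' < e] `<=` U].

Definition space_of_classes := g_sigma_algebraType kappa_open.

HB.instance Definition _ := Measurable.on space_of_classes.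

End Classes.

Definition Dstar := space_of_classes (no_mark R) 0.
Definition Dstarstar := space_of_classes (no_mark R) 1.
Definition marked_Dstar Xi := space_of_classes Xi 0.

Definition bipointed (D : discrete_space) (o v : D) :
    marked_space (no_mark R) 1 :=
  @MarkedSpace (no_mark R) 1 D (fun i => if i == ord0 then o else v)
    (fun _ _ => tt).

Definition origin {Xi} (X : marked_space Xi 0) : X := pt X ord0.

(* mu is the law of the random element [D, o]. The sums do not depend on the
   representative of the class. *)
Definition unimodular (mu : probability Dstar R) :=
  forall g : Dstarstar -> R, measurable_fun setT g -> (forall c, 0 <= g c) ->
  (\int[mu]_c (\esum_(v in [set: repr c])
      (g (class_of (bipointed (origin (repr c)) v)))%:E) =
   \int[mu]_c (\esum_(v in [set: repr c])
      (g (class_of (bipointed v (origin (repr c)))))%:E))%E.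

Section Processes.
Variable Xi : polishType R.

Definition marking (D : discrete_space) := D -> D -> Xi.

HB.instance Definition _ D := Pointed.on (marking D).

Definition cylinders (D : discrete_space) : set (set (marking D)) :=
  [set C | exists x y (B : set Xi), open B /\ C = [set m | B (m x y)]].

Definition markings (D : discrete_space) := g_sigma_algebraType (@cylinders D).

HB.instance Definition _ D := Measurable.on (markings D).

Definition transport (D1 D2 : discrete_space) (f : D2 -> D1)
  (m : markings D1) : markings D2 := fun x y => m (f x) (f y).

Definition marked (D : discrete_space) (o : D) (m : markings D) :
  marked_Dstar Xi := class_of (@MarkedSpace Xi 0 D (fun=> o) m).

(* law D is the distribution of the random element Z_D of Xi^(D x D), with the
   product sigma-field. By law_isometry, the choice of the representative
   repr c in law_measurable is irrelevant. *)
Record equivariant_process := EquivariantProcess {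
  law :> forall D : discrete_space, probability (markings D) R;
  law_isometry : forall (D1 D2 : discrete_space) (rho : D1 -> D2) (rho' : D2 -> D1),
    is_isometry rho -> cancel rho rho' -> cancel rho' rho ->
    forall A : set (markings D2), measurable A ->
    law D1 (transport rho' @^-1` A) = law D2 A;
  law_measurable : forall A : set (marked_Dstar Xi), measurable A ->
    measurable_fun [set: Dstar]
      (fun c : Dstar =>
        law (repr c) (marked (origin (repr c)) @^-1` A) : \bar R) }.

Lemma near_embedding_iso k e (X X' Y Y' : marked_space Xi k) :
  isomorphic X X' -> isomorphic Y Y' ->
  near_embedding e X Y -> near_embedding e X' Y'.
Proof.
move=> [f [[[f' fK f'K] fd] fo fm]] [g [[[g' gK g'K] gd] go gm]] [h [hi ho hd]].
have f'o i : f' (pt X' i) = pt X i by rewrite -fo fK.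
have fB x : dist (pt X' ord0) x <= e^-1 -> dist (pt X ord0) (f' x) <= e^-1.
  by rewrite -fd fo f'K.
exists (g \o h \o f') => B; split.
- move=> x y; rewrite !inE => /fB Bx /fB By /= /(can_inj gK).
  by move/hi => /(_ _ _)/(can_inj f'K); apply; rewrite inE.
- move=> i /fB; rewrite f'o => Bi.
  by rewrite /= f'o ho ?go.
- move=> x y /fB Bx /fB By; rewrite /= gd gm.
  by have := hd _ _ Bx By; rewrite -fd -fm !f'K.
Qed.

Lemma kappa_marked (D : discrete_space) (o : D) (m m' : markings D) (e : R) :
  0 < e ->
  (forall x y, dist o x <= e^-1 -> dist o y <= e^-1 ->
    mdist (m x y) (m' x y) <= e) ->
  kappa (marked o m) (marked o m') <= e.
Proof.
move=> e0 mm'.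
rewrite /kappa; apply: ge_inf; first by exists 0 => ? [->//|[/ltW]].
right; split=> //; apply: near_embedding_iso (repr_class_of _) (repr_class_of _) _.
  exists id; split=> //= x y Bx By.
  by rewrite subrr normr0 (ltW e0) metric_sym; split=> //; exact: mm'.
exists id; split=> //= x y Bx By.
by rewrite subrr normr0 (ltW e0); split=> //; exact: mm'.
Qed.


Lemma measurable_cylinder (D : discrete_space) (x y : D) (B : set Xi) :
  open B -> measurable ([set m | B (m x y)] : set (markings D)).
Proof. by move=> oB; apply: sub_sigma_algebra; exists x, y, B. Qed.

Lemma measurable_marked (D : discrete_space) (o : D) :
  measurable_fun [set: markings D] (marked o).
Proof.
have mG := @measurability _ _ (markings D) (marked_Dstar Xi) setT (marked o)
  (@kappa_open Xi 0); apply: mG => [//|_ [U oU <-]].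
rewrite setTI.
have [S cS dS] : exists2 S : set Xi, countable S & dense S by exact: separable.
have /countable_injP[f finj] := cS.
pose q n := get [set x | S x /\ f x = n].
have qK x : S x -> q (f x) = x.
  move=> Sx; have [Sq fq] : [set y | S y /\ f y = f x] (q (f x)).
    by apply: getPex; exists x.
  by apply: finj => //; rewrite inE.
have balls n : exists s : seq D, [set y | dist o y <= n.+1%:R] = [set` s].
  by apply/finite_seqP; exact: finite_balls.
pose s n := projT1 (cid (balls n)).
have sE n : [set y | dist o y <= n.+1%:R] = [set` s n] := projT2 (cid (balls n)).
pose p n i := nth (o, o) [seq (x, y) | x <- s n, y <- s n] i.
pose N n := size [seq (x, y) | x <- s n, y <- s n].
pose e n : R := n.+1%:R^-1.
have e0 n : 0 < e n by rewrite invr_gt0.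
pose C (u : nat * seq nat) : set (markings D) := [set m | forall i,
  (i < N u.1)%N -> ball (q (nth 0%N u.2 i)) (e u.1 / 2) (m (p u.1 i).1 (p u.1 i).2)].
have mC u : measurable (C u).
  rewrite (_ : C u = \bigcap_i (if (i < N u.1)%N then
      [set m | ball (q (nth 0%N u.2 i)) (e u.1 / 2) (m (p u.1 i).1 (p u.1 i).2)]
      else setT)); last first.
    apply/seteqP; split=> m Cm i; first by move=> _; case: ifP => // /Cm.
    by move=> iN; have := Cm i I; rewrite iN.
  apply: bigcapT_measurable => i; case: ifP => // _.
  apply: measurable_cylinder.
  rewrite ballEmdist openE => z /= qz.
  apply/nbhs_ballP; exists (e u.1 / 2 - mdist (q (nth 0%N u.2 i)) z) => /=.
    by rewrite subr_gt0.
  move=> z'; rewrite ballEmdist /= ltrBrDl => zz'.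
  exact: le_lt_trans (metric_triangle _ z _) zz'.
rewrite (_ : _ @^-1` _ = \bigcup_u
    (if `[< C u `<=` marked o @^-1` U >] then C u else set0)); last first.
  apply/seteqP; split=> m; last first.
    by move=> [u _]; case: ifP => // /asboolP sub /sub.
  move=> /= /oU[d d0 dU].
  have /ltr_add_invr[n] : 0 < d by [].
  rewrite add0r => nd.
  have [t tP] : exists t : seq nat, C (n, t) m.
    have q_near i : exists k, ball (q k) (e n / 2) (m (p n i).1 (p n i).2).
      have [] := dS (ball (m (p n i).1 (p n i).2) (e n / 2))^°.
      - exists (m (p n i).1 (p n i).2); apply: nbhsx_ballx.
        by rewrite divr_gt0.
      - exact: open_interior.
      - move=> x [/interior_subset xb Sx]; exists (f x).
        by rewrite qK//; exact: ball_sym.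
    exists (mkseq (fun i => projT1 (cid (q_near i))) (N n)) => i /= iN.
    by rewrite nth_mkseq//; exact: projT2 (cid (q_near i)).
  exists (n, t) => //; case: ifPn => // /asboolP[] m' m'P.
  apply: dU => /=; apply: le_lt_trans nd.
  apply: kappa_marked => // x y; rewrite invrK => xn yn.
  have xys : (x, y) \in [seq (x, y) | x <- s n, y <- s n].
    apply: allpairs_f.
      by have : [set` s n] x by rewrite -sE.
    by have : [set` s n] y by rewrite -sE.
  have iN := xys; rewrite -index_mem in iN.
  have := m'P _ iN; have := tP _ iN; rewrite /p /= nth_index//= => tm tm'.
  rewrite (splitr n.+1%:R^-1) ltW//.
  have := ball_triangle (ball_sym tm) tm'.
  by rewrite ballEmdist.
apply: countable_bigcupT_measurable => [|u]; first exact: countableP.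
by case: ifP.
Qed.

Section MarkedLaw.
Variables (mu : probability Dstar R) (Z : equivariant_process).

Definition sampled (A : set (marked_Dstar Xi)) : \bar R :=
  (\int[mu]_c Z (repr c) (marked (origin (repr c)) @^-1` A))%E.

Let sampled0 : sampled set0 = 0%E.
Proof.
rewrite /sampled; under eq_integral do rewrite preimage_set0 measure0.
exact: integral0.
Qed.

Let sampled_ge0 A : (0 <= sampled A)%E.
Proof. exact: integral_ge0. Qed.

Let sampled_sigma_additive : semi_sigma_additive sampled.
Proof.
move=> F mF tF mUF; rewrite [X in _ --> X](_ : _ =
  (\int[mu]_c \sum_(n <oo) Z (repr c) (marked (origin (repr c)) @^-1` F n))%E);
  last first.
  apply: eq_integral => c _; rewrite preimage_bigcup.
  have mP A : measurable A -> measurable (marked (origin (repr c)) @^-1` A).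
    by move=> mA; rewrite -[X in measurable X]setTI; exact: measurable_marked.
  rewrite measure_semi_bigcup//.
  - by move=> n; exact: mP.
  - move=> i j _ _ [m [Fi Fj]].
    by apply: (tF i j I I); exists (marked (origin (repr c)) m).
  - by rewrite -preimage_bigcup; exact: mP.
apply/cvg_closeP; split.
  by apply: is_cvg_nneseries => n _ _; exact: integral_ge0.
rewrite closeE// integral_nneseries// => n.
exact: law_measurable.
Qed.

HB.instance Definition _ := isMeasure.Build _ _ R sampled
  sampled0 sampled_ge0 sampled_sigma_additive.

Let sampled_setT : sampled setT = 1%E.
Proof.
rewrite /sampled; under eq_integral do rewrite preimage_setT probability_setT.
by rewrite integral_cst// mul1e; exact: probability_setT.
Qed.

HB.instance Definition _ := Measure_isProbability.Build _ _ R sampled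
  sampled_setT.

(* The law of [D, o; Z_D]. *)
Definition marked_law : probability (marked_Dstar Xi) R := sampled.

End MarkedLaw.

End Processes.

End DiscreteSpaces.

Lemma closed_nonneg (R : realType) : closed [set x : R | (fun x => 0 <= x) x].
Proof. exact: closed_ge. Qed.

Lemma closed_radii (R : realType) :
  closed [set x : R | (fun x => (x == 0) || (1 <= x)) x].
Proof.
rewrite (_ : [set x | _] = [set 0] `|` [set x | 1 <= x]); last first.
  by apply/seteqP; split=> x /= => [/orP[/eqP|]|[->|->]];
    [left|right|rewrite eqxx|rewrite orbT].
by apply: closedU; [exact: closed_eq|exact: closed_ge].
Qed.

Lemma radii0 (R : realType) : ((0 : R) == 0) || ((1 : R) <= 0).
Proof. by rewrite eqxx. Qed.

(* The mark spaces [0, +oo[ and {0} U [1, +oo[. *)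
Definition nonneg_reals (R : realType) : polishType R :=
  closed_subspace (@closed_nonneg R) (lexx 0).

Definition radii (R : realType) : polishType R :=
  closed_subspace (@closed_radii R) (@radii0 R).

Section Dimension.
Context {R : realType}.

Definition point_mark (P : {pred R}) (clP : closed [set x | P x]) x0
    (Px0 : P x0) (X : marked_space (closed_subspace clP Px0) 0) (v : X) : R :=
  sval (mark v v).

(* Radii in ]0, 1[ never occur; the condition 1 <= r makes the ball of radius 0
   empty. *)
Definition nball (D : discrete_space) (r : R) (v : D) : set D :=
  [set u | 1 <= r /\ dist v u <= r].

Definition origin_weight (x : marked_Dstar (nonneg_reals R)) : R :=
  point_mark (origin (repr x)).

Definition ball_weight (r : R) (x : marked_Dstar (nonneg_reals R)) : R :=
  \sum_(v \in nball r (origin (repr x))) point_mark v.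

(* lne 0 = -oo, hence so are both growth rates of a function which vanishes near
   +oo. *)
Definition upper_growth (f : R -> \bar R) : \bar R :=
  limf_esup (fun r => lne (f r) * ((ln r)^-1)%:E)%E (pinfty_nbhs R).

Definition lower_growth (f : R -> \bar R) : \bar R :=
  limf_einf (fun r => lne (f r) * ((ln r)^-1)%:E)%E (pinfty_nbhs R).

(* Where it fails, the growth rates of the ball weights are -oo. *)
Definition nonzero_weight (x : marked_Dstar (nonneg_reals R)) : Prop :=
  exists v : repr x, 0 < point_mark v.

Definition origin_radius (x : marked_Dstar (radii R)) : R :=
  point_mark (origin (repr x)).

Definition covers (x : marked_Dstar (radii R)) : Prop :=
  \bigcup_(v : repr x) nball (point_mark v) v = [set: repr x].

Definition equivariant_covering (mu : probability (@Dstar R) R)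
    (Z : equivariant_process (radii R)) :=
  \forall x \ae marked_law mu Z, covers x.

(* 0 `^ 0 = 1 in the library. *)
Definition radius_pow (r a : R) : R := if r == 0 then 0 else r `^ a.

Definition hausdorff_content (a : R) (mu : probability (@Dstar R) R) : \bar R :=
  ereal_inf [set 'E_(marked_law mu Z)[fun x => radius_pow (origin_radius x) a]%E
    | Z in [set Z | equivariant_covering mu Z]].

(* The maximum with 0 only matters for the empty set. *)
Definition udim_H (mu : probability (@Dstar R) R) : \bar R :=
  maxe 0%:E (ereal_sup
    [set a%:E | a in [set a : R | 0 <= a /\ hausdorff_content a mu = 0%E]]).

End Dimension.

(* Main.v *)
(** Upper bounds: keep the weight of a point only if all its balls N_n, n >= 1,
    weigh at most M n^a, and let f be the conditional mean, given the unmarked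
    space, of this truncated weight. Then f(N_r(u)) <= M 3^a r^a for every u, so
    transporting the mass f(v) to each u whose ball in a covering R contains v
    gives E f(o) <= M 3^a E R(o)^a, and H^a_1 > 0 as soon as the truncated weight
    does not vanish. If E w(N_r(o)) <= r^b for large r and b < a, then by
    Borel-Cantelli almost every point qualifies for some M.

    Lower bound: for a < b < ess inf of the lower growth, declare the points
    independently to be heads, v with probability min(1, n r^-b E w(v)), where
    the mean is taken given the unmarked space. Balls of radius r around the
    heads, and balls of radius 1 around the points which these leave uncovered,
    form a covering with
    E R(o)^a <= n r^(a-b) E w(o) + P(w(N_r(o)) < r^b) + 1/(n+1);
    let r, then n, tend to infinity.

    Measurability: the number of decorations (points, or finite sets of points)
    of a class which fall in an open set is lower semicontinuous, hence all
    sums over decorations are measurable. The law of the covering is reached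
    from the finitely many patterns of heads in a large ball, whose
    probabilities are explicit. *)

From HB Require Import structures.
Require Import Defs.
From mathcomp Require Import all_boot all_order all_algebra finmap.
From mathcomp Require Import all_classical all_reals all_analysis.
From mathcomp Require Import measurable_realfun ess_sup_inf.
From mathcomp Require Import ring lra.

Import Order.TTheory GRing.Theory Num.Theory.
Import numFieldNormedType.Exports.

Set Implicit Arguments.
Unset Strict Implicit.
Unset Printing Implicit Defensive.

Local Open Scope classical_set_scope.
Local Open Scope ring_scope.

(** * The metric on classes *)

(** Unimodularity is available only for functions of unmarked doubly-pointed classes, whereas the
    weight and the covering are separate equivariant processes without a joint law.

    The factor 3^a is the price of recentring. A ball of radius r lies in the ball of radius 2r
    around each of its points, and rounding 2r up to an integer costs at most r, because r >= 1.

    For the heads, r^-b is the scale at which the expected number of heads in N_r(o) is at least n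
    times the conditional probability of w(N_r(o)) >= r^b, unless some point is a head for sure. The
    error 1/(n+1) then comes from bounding a product of factors 1 - p by 1/(1 + sum of p).

    The obstacle to measurability is that functions of a class are evaluated on the arbitrary
    representative [repr c]. They are therefore studied as functions of spaces, along maps between
    spaces that are close for [kappa], which also yields their invariance under isomorphism. *)

Section NearIsometries.
Context {R : realType}.

Lemma distxx (D : discrete_space) (x : D) : dist x x = 0 :> R.
Proof. exact/dist_eq0. Qed.

Lemma dist_ge0 (D : discrete_space) (x y : D) : 0 <= dist x y :> R.
Proof.
have := dist_triangle y x x; rewrite distxx (dist_sym y x) => h.
lra.
Qed.

Variables (Xi : polishType R) (k : nat).
Implicit Types X Y Z : marked_space Xi k.

Definition cball X (rho : R) : set X := [set x | dist (pt X ord0) x <= rho].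
Arguments cball : clear implicits.

(** Symmetric substitute for a pair of [near_embedding]s: a bijection between balls of one radius
    has an inverse of the same kind ([near_iso_inv]), so a single map carries finite configurations
    from one space to the other. *)
Definition near_iso X Y (e : R) (f : X -> Y) (rho : R) :=
  [/\ {in cball X rho &, injective f}, f @` cball X rho = cball Y rho,
    forall i, cball X rho (pt X i) /\ f (pt X i) = pt Y i &
    forall x y, cball X rho x -> cball X rho y ->
      `|dist (f x) (f y) - dist x y| <= e /\
      mdist (mark (f x) (f y)) (mark x y) <= e].

Arguments near_iso : clear implicits.

Lemma near_iso_le e e' X Y f rho : e <= e' ->
  near_iso X Y e f rho -> near_iso X Y e' f rho.
Proof.
move=> ee' [? ? ? h]; split=> // x y xB yB.
by have [h1 h2] := h _ _ xB yB; split; [apply: le_trans h1 _|apply: le_trans h2 _].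
Qed.

Lemma finite_set_min (s : seq R) (a : R) :
  exists2 t, a < t & forall x, x \in s -> x <= a \/ t <= x.
Proof.
elim: s => [|b s [t at_ ts]]; first by exists (a + 1) => //; rewrite ltrDl.
have [ba|ab] := leP b a.
  by exists t => // x; rewrite inE => /orP[/eqP->|/ts//]; left.
exists (Num.min t b); first by rewrite lt_min at_ ab.
move=> x; rewrite inE => /orP[/eqP->|/ts[|tx]]; [|by left|].
  by right; rewrite ge_min lexx orbT.
by right; rewrite ge_min tx.
Qed.

Lemma ball_gap (D : discrete_space) (o : D) (a : R) :
  exists2 t, a < t & forall x, dist o x <= a \/ t <= dist o x.
Proof.
have /finite_seqP[s sE] := finite_balls o (a + 1).
have [t at_ ts] := finite_set_min [seq dist o x | x <- s] a.
exists (Num.min t (a + 1)); first by rewrite lt_min at_ ltrDl ltr01.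
move=> x; have [xa|xa] := leP (dist o x) (a + 1); last first.
  by right; rewrite ge_min (ltW xa) orbT.
have : dist o x \in [seq dist o x | x <- s].
  by apply: map_f; have : [set` s] x by rewrite -sE.
by move/ts => [|tx]; [left|right; rewrite ge_min tx].
Qed.

Lemma injections_surj (T U : choiceType) (A : set T) (B : set U) f g :
  finite_set A -> finite_set B ->
  {in A &, injective f} -> f @` A `<=` B ->
  {in B &, injective g} -> g @` B `<=` A -> f @` A = B.
Proof.
move=> fA fB fi fAB gi gBA.
have ffA : finite_set (f @` A) by exact: finite_image.
have cardfA : #|` fset_set (f @` A)| = #|` fset_set A|.
  rewrite fset_set_image// card_in_imfset// => x y.
  by rewrite !in_fset_set//; exact: fi.
have cardB : (#|` fset_set B| <= #|` fset_set A|)%N.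
  have -> : #|` fset_set B| = #|` fset_set (g @` B)|.
    rewrite fset_set_image// card_in_imfset// => x y.
    by rewrite !in_fset_set//; exact: gi.
  by apply: fsubset_leq_card; rewrite -fset_set_sub//; exact: finite_image.
apply: (fset_set_inj ffA fB); apply/eqP.
by rewrite eqEfcard cardfA cardB andbT -fset_set_sub.
Qed.

Lemma kappa_lt_near_embedding X Y d : d <= 1 ->
  kappa (class_of X) (class_of Y) < d ->
  exists e, [/\ 0 < e, e < d, near_embedding e X Y & near_embedding e Y X].
Proof.
move=> d1; rewrite /kappa => /(inf_lt _)[].
  by exists 1; left.
(* The bound [d <= 1] excludes the adjoined value 1 of the infimum. *)
move=> e [->|[e0 h1 h2]] ed; first by rewrite ltNge d1 in ed.
have rX := isomorphic_sym (repr_class_of X).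
have rY := isomorphic_sym (repr_class_of Y).
exists e; split=> //; exact: near_embedding_iso h1 || exact: near_embedding_iso h2.
Qed.

Lemma near_embedding_kappa X Y e : 0 < e ->
  near_embedding e X Y -> near_embedding e Y X ->
  kappa (class_of X) (class_of Y) <= e.
Proof.
move=> e0 h1 h2; apply: ge_inf; first by exists 0 => ? [->//|[/ltW]].
right; split=> //.
  exact: near_embedding_iso (repr_class_of _) (repr_class_of _) h1.
exact: near_embedding_iso (repr_class_of _) (repr_class_of _) h2.
Qed.

Lemma finite_upper_bound (I : finType) (f : I -> R) (a : R) :
  exists2 b, a <= b & forall i, f i <= b.
Proof.
exists (Num.max a (\big[Num.max/a]_i f i)); first by rewrite le_max lexx.
by move=> i; rewrite le_max (le_bigmax _ f i) orbT.
Qed.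

(* The radius is chosen in a gap of the distances to the origin, so that neither
   embedding can cross the boundary of the ball; two injections between finite
   sets are then bijections. *)
Lemma kappa_near_iso X (e : R) : 0 < e -> exists2 d, 0 < d &
  forall Y, kappa (class_of X) (class_of Y) < d ->
  exists f : X -> Y, exists2 rho, e^-1 <= rho & near_iso X Y e f rho.
Proof.
move=> e0.
have [a ea aX] := finite_upper_bound (fun i => dist (pt X ord0) (pt X i)) e^-1.
have [t at_ tX] := ball_gap (pt X ord0) a.
have a0 : 0 < a by apply: lt_le_trans ea; rewrite invr_gt0.
pose rho := (a + t) / 2.
have rho0 : 0 < rho by rewrite /rho; lra.
(* The four bounds: 1 because of the value adjoined in [kappa]; [e] for the distortion; half of the
   gap between [a] and [t], so that no point crosses the sphere of radius [rho]; [(rho + 1)^-1], so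
   that both embeddings are controlled on the balls of radius [rho]. *)
pose d := Num.min (Num.min 1 e) (Num.min ((t - a) / 2) (rho + 1)^-1).
have d0 : 0 < d.
  rewrite /d !lt_min ltr01 e0 /= invr_gt0; apply/andP; split; lra.
exists d => // Y; move=> /kappa_lt_near_embedding[].
  by rewrite /d !ge_min lexx.
move=> d' [d'0]; rewrite /d !lt_min => /andP[/andP[d'1 d'e] /andP[d't d'rho]].
have {}d'rho : rho + 1 < d'^-1.
  by rewrite -[ltLHS]invrK ltf_pV2 ?posrE ?invr_gt0//; lra.
move=> [f [fi fo fd]] [g [gi go gd]].
have ctr Z : dist (pt Z ord0) (pt Z ord0) <= d'^-1.
  by rewrite distxx invr_ge0 ltW.
have f0 : f (pt X ord0) = pt Y ord0 by apply: fo; exact: ctr.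
have g0 : g (pt Y ord0) = pt X ord0 by apply: go; exact: ctr.
have small Z x : cball Z rho x -> dist (pt Z ord0) x <= d'^-1.
  by rewrite /cball /= => h; lra.
have fB : f @` cball X rho `<=` cball Y rho.
  move=> _ [x xB <-]; have [+ _] := fd _ _ (ctr X) (small _ _ xB).
  rewrite f0 ler_norml => /andP[_].
  move: xB; rewrite /cball /= => xB; have [xa|xt] := tX x; rewrite /rho in xB *; lra.
have gB : g @` cball Y rho `<=` cball X rho.
  move=> _ [x xB <-]; have [+ _] := gd _ _ (ctr Y) (small _ _ xB).
  rewrite g0 ler_norml => /andP[_].
  move: xB; rewrite /cball /= => xB; have [xa|xt] := tX (g x); rewrite /rho in xB *; lra.
have fi' : {in cball X rho &, injective f}.
  by move=> x y; rewrite !inE => xB yB; apply: fi; rewrite inE; exact: small.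
have gi' : {in cball Y rho &, injective g}.
  by move=> x y; rewrite !inE => xB yB; apply: gi; rewrite inE; exact: small.
exists f, rho; first by rewrite /rho; lra.
split=> //.
- apply: (injections_surj _ _ fi' fB gi' gB); exact: finite_balls.
- move=> i; have iB : cball X rho (pt X i).
    by rewrite /cball /=; apply: le_trans (aX i) _; rewrite /rho; lra.
  by split=> //; apply: fo; exact: small.
- move=> x y xB yB; have [h1 h2] := fd _ _ (small _ _ xB) (small _ _ yB).
  by split; [apply: le_trans h1 (ltW d'e)|apply: le_trans h2 (ltW d'e)].
Qed.

Lemma near_iso_inv X Y (e : R) (f : X -> Y) rho : near_iso X Y e f rho ->
  exists g : Y -> X, [/\ near_iso Y X e g rho,
    forall x, cball X rho x -> g (f x) = x &
    forall y, cball Y rho y -> f (g y) = y].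
Proof.
move=> [fi fB fo fd].
have pY y : cball Y rho y -> exists x, cball X rho x /\ f x = y.
  by rewrite -fB => -[x xB <-]; exists x.
pose g y := xget (pt X ord0) [set x | cball X rho x /\ f x = y].
have gP y : cball Y rho y -> cball X rho (g y) /\ f (g y) = y.
  by move=> /pY h; exact: (@xgetPex _ _ [set x | cball X rho x /\ f x = y]).
have fY x : cball X rho x -> cball Y rho (f x) by move=> h; rewrite -fB; exists x.
have gK x : cball X rho x -> g (f x) = x.
  move=> xB; have [gx fgx] := gP _ (fY _ xB).
  by apply: fi; rewrite ?inE.
exists g; split=> //; last by move=> y /gP[].
split.
- move=> x y; rewrite !inE => xB yB gxy.
  by rewrite -(gP _ xB).2 gxy (gP _ yB).2.
- apply/seteqP; split=> [_ [y /gP[yB _] <-]//|x xB].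
  by exists (f x); [exact: fY|exact: gK].
- by move=> i; have [iB <-] := fo i; split; [exact: fY|exact: gK].
- move=> x y /gP[gx fgx] /gP[gy fgy].
  have [h1 h2] := fd _ _ gx gy; rewrite fgx fgy in h1 h2.
  by rewrite distrC metric_sym.
Qed.

Lemma near_iso_near_embedding X Y (e : R) (f : X -> Y) rho :
  e^-1 <= rho -> near_iso X Y e f rho -> near_embedding e X Y.
Proof.
move=> erho [fi fB fo fd].
have sub x : dist (pt X ord0) x <= e^-1 -> cball X rho x.
  by move=> h; apply: le_trans h erho.
exists f; split=> //.
- by move=> x y; rewrite !inE => /sub xB /sub yB; apply: fi; rewrite inE.
- by move=> i _; have [] := fo i.
- by move=> x y /sub xB /sub yB; exact: fd.
Qed.

Lemma near_iso_kappa X Y (e : R) (f : X -> Y) rho :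
  0 < e -> e^-1 <= rho -> near_iso X Y e f rho ->
  kappa (class_of X) (class_of Y) <= e.
Proof.
move=> e0 erho fXY; have [g [gYX _ _]] := near_iso_inv fXY.
apply: near_embedding_kappa => //.
  exact: near_iso_near_embedding erho fXY.
exact: near_iso_near_embedding erho gYX.
Qed.

Lemma kappa_openP (U : set (iso_class Xi k)) : kappa_open U <->
  forall X, U (class_of X) -> exists2 e, 0 < e & forall Y (f : X -> Y) rho,
    e^-1 <= rho -> near_iso X Y e f rho -> U (class_of Y).
Proof.
split=> [oU X /oU[e e0 eU]|oU c].
  exists (e / 2); first by rewrite divr_gt0.
  move=> Y f rho erho fXY; apply: eU => /=.
  have e20 : 0 < e / 2 by rewrite divr_gt0.
  by have := near_iso_kappa e20 erho fXY; lra.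
rewrite -(class_ofK c) => /oU[e e0 eU].
have [d d0 dU] := kappa_near_iso (repr c) e0.
exists d => // c' /=; rewrite -{1}(class_ofK c') => /dU[f [rho erho fr]].
by rewrite -(class_ofK c'); exact: eU fr.
Qed.

Lemma kappa_openI (U V : set (iso_class Xi k)) :
  kappa_open U -> kappa_open V -> kappa_open (U `&` V).
Proof.
move=> oU oV c [/oU[e e0 eU] /oV[d d0 dV]].
exists (Num.min e d); first by rewrite lt_min e0.
by move=> c'; rewrite /= lt_min => /andP[ce cd]; split; [exact: eU|exact: dV].
Qed.

Lemma kappa_openT : kappa_open [set: iso_class Xi k].
Proof. by move=> c _; exists 1. Qed.

Lemma kappa_ge0 (c c' : iso_class Xi k) : 0 <= kappa c c'.
Proof.
apply: lb_le_inf; first by exists 1; left.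
by move=> e [->//|[/ltW]].
Qed.

Lemma kappa_le1 (c c' : iso_class Xi k) : kappa c c' <= 1.
Proof. by apply: ge_inf; [exists 0 => ? [->//|[/ltW]]|left]. Qed.

Lemma kappaC (c c' : iso_class Xi k) : kappa c c' = kappa c' c.
Proof.
rewrite /kappa; congr (inf (_ `|` _)).
by apply/seteqP; split=> e [].
Qed.

Lemma near_embedding_refl X (e : R) : 0 < e -> near_embedding e X X.
Proof.
move=> e0; exists id; split=> // x y _ _.
by rewrite subrr normr0 mdistxx; split; exact: ltW.
Qed.

Lemma kappaxx (c : iso_class Xi k) : kappa c c = 0.
Proof.
apply/eqP; rewrite eq_le kappa_ge0 andbT; apply/ler_addgt0Pr => e e0; rewrite add0r.
rewrite -(class_ofK c).
by apply: near_embedding_kappa => //; exact: near_embedding_refl.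
Qed.

(** The ball of radius [(d + e)^-1] must be sent by the first map into the ball where the second is
    controlled, that is, [(d + e)^-1 + d <= e^-1]. The difference of the two inverses is
    [d / (e * (d + e))], which is at least [d] because [e] and [d + e] are at most 1. *)
Lemma near_embedding_comp X Y Z (d e : R) :
  0 < d -> 0 < e -> d + e <= 1 -> near_embedding d X Y -> near_embedding e Y Z ->
  near_embedding (d + e) X Z.
Proof.
move=> d0 e0 de [f [fi fo fd]] [g [gi go gd]].
have sub : (d + e)^-1 + d <= e^-1.
  have de0 : 0 < d + e by lra.
  have u1 : 1 <= e^-1 by rewrite invf_ge1//; lra.
  have v1 : 1 <= (d + e)^-1 by rewrite invf_ge1.
  have -> : e^-1 = (d + e)^-1 + d * (e^-1 * (d + e)^-1).
    by field; rewrite !gt_eqF.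
  by rewrite lerD2l; apply: ler_peMr; [exact: ltW|exact: mulr_ege1].
have subd x : dist (pt X ord0) x <= (d + e)^-1 -> dist (pt X ord0) x <= d^-1.
  move=> h; apply: le_trans h _; rewrite lef_pV2 ?posrE; lra.
have ctr : dist (pt X ord0) (pt X ord0) <= d^-1 by rewrite distxx invr_ge0 ltW.
have fB x : dist (pt X ord0) x <= (d + e)^-1 -> dist (pt Y ord0) (f x) <= e^-1.
  move=> h; have [+ _] := fd _ _ ctr (subd _ h).
  rewrite fo// ler_norml => /andP[_]; lra.
exists (g \o f); split=> /=.
- move=> x y; rewrite !inE => xB yB /gi gfi.
  apply: fi; rewrite ?inE /=; [exact: subd|exact: subd|].
  by apply: gfi; rewrite inE /=; exact: fB.
- move=> i iB; rewrite fo; last exact: subd.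
  by apply: go; rewrite /= -(fo i); [exact: fB|exact: subd].
- move=> x y xB yB.
  have [h1 h2] := fd _ _ (subd _ xB) (subd _ yB).
  have [h3 h4] := gd _ _ (fB _ xB) (fB _ yB).
  split; last first.
    by apply: le_trans (metric_triangle _ (mark (f x) (f y)) _) _; lra.
  by rewrite -(subrKA (dist (f x) (f y))); apply: le_trans (ler_normD _ _) _; lra.
Qed.

Lemma kappa_triangle (c c' c'' : iso_class Xi k) :
  kappa c c'' <= kappa c c' + kappa c' c''.
Proof.
rewrite -(class_ofK c) -(class_ofK c') -(class_ofK c'').
apply/ler_addgt0Pr => eps eps0.
set a := kappa _ (class_of (repr c')); set b := kappa (class_of (repr c')) _.
have a0 : 0 <= a by exact: kappa_ge0.
have b0 : 0 <= b by exact: kappa_ge0.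
(* Above 1 the bound [kappa_le1] suffices; below 1 the embeddings can be composed. *)
have [ab1|ab1] := leP 1 (a + b + eps).
  by apply: le_trans ab1; exact: kappa_le1.
have da : a < a + eps / 2 by lra.
have a1 : a + eps / 2 <= 1 by lra.
have b1 : b + eps / 2 <= 1 by lra.
have eb : b < b + eps / 2 by lra.
have [d [d0 dlt dXY dYX]] := kappa_lt_near_embedding a1 da.
have [e [e0 elt eYZ eZY]] := kappa_lt_near_embedding b1 eb.
apply: (@le_trans _ _ (d + e)); last lra.
apply: near_embedding_kappa; [lra|by apply: near_embedding_comp eYZ => //; lra|].
by rewrite addrC; apply: near_embedding_comp dYX => //; lra.
Qed.

End NearIsometries.
Arguments cball {R Xi k} X rho _.
Arguments near_iso {R Xi k} X Y e f rho.

(** * Measurability by semicontinuity *)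

Section MeasurableKernels.
Context {R : realType}.

Definition dirac_sum d (T : measurableType d) (s : seq T) :
    {measure set T -> \bar R} :=
  msum (fun i => \d_(nth point s i)) (size s).

Lemma dirac_sumE d (T : measurableType d) (s : seq T) A :
  dirac_sum s A = (\sum_(x <- s) \d_x A)%E.
Proof. by rewrite /dirac_sum /msum/= (big_nth point) big_mkord. Qed.

Lemma dirac_sum_fin_num d (T : measurableType d) (s : seq T) A :
  dirac_sum s A \is a fin_num.
Proof. by rewrite dirac_sumE; apply/sum_fin_numP => x _ _; rewrite diracE. Qed.

Lemma integral_dirac_sum d (T : measurableType d) (s : seq T) (f : T -> \bar R) :
  measurable_fun setT f -> (forall x, 0 <= f x)%E ->
  (\int[dirac_sum s]_x f x = \sum_(x <- s) f x)%E.
Proof.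
move=> mf f0; rewrite ge0_integral_measure_sum// (big_nth point) big_mkord.
by apply: eq_bigr => i _; rewrite integral_dirac// diracT mul1e.
Qed.

(** Dynkin's theorem: the sets on which the family is measurable form a Dynkin system, closed under
    complements because the masses are finite. It reduces the measurability of a kernel on classes
    to its values on open sets. *)
Lemma measurable_measure_family d (C : measurableType d) (T : pointedType)
    (G : set (set T))
    (nu : C -> {measure set (g_sigma_algebraType G) -> \bar R}) :
  setI_closed G -> G setT -> (forall c A, measurable A -> nu c A \is a fin_num) ->
  (forall A, G A -> measurable_fun setT (nu ^~ A)) ->
  forall A, measurable A -> measurable_fun setT (nu ^~ A).
Proof.
move=> GI GT nuf nuG A mA.
apply: (@dynkin_induction _ (g_sigma_algebraType G) G
  (fun A => measurable_fun setT (nu ^~ A))) => //.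
- exact: nuG.
- move=> S mS nuS.
  rewrite (_ : (fun c => _) = (fun c => nu c setT - nu c S)%E).
    by apply: emeasurable_funB => //; exact: nuG.
  apply/funext => c; rewrite -setTD measureD// ?setTI//.
  by rewrite ltey_eq nuf.
- move=> F mF tF nuF.
  rewrite (_ : (fun c => _) = (fun c => \sum_(i <oo) nu c (F i))%E).
    by apply: ge0_emeasurable_sum => //.
  apply/funext => c; rewrite measure_bigcup//.
    by apply: eq_eseriesl => n; rewrite in_setT.
Qed.

End MeasurableKernels.

Section LocallyNear.
Context {R : realType} (Xi : polishType R) (k : nat).
Implicit Types (X Y : marked_space Xi k) (P Q : marked_space Xi k -> Prop).

(** Holds for all sufficiently accurate near isometries out of [X]. It behaves like a filter:
    [near_atI] and [near_at_all] combine finitely many conditions on one and the same map. *)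
Definition near_at X (P : forall Y, (X -> Y) -> R -> Prop) :=
  exists2 e, 0 < e & forall Y (f : X -> Y) rho,
    e^-1 <= rho -> near_iso X Y e f rho -> P Y f rho.

Lemma near_at_iso X e a : 0 < e ->
  near_at (fun Y f rho => a <= rho /\ near_iso X Y e f rho).
Proof.
move=> e0; exists (Num.min e (Num.max 1 a)^-1).
  by rewrite lt_min e0 invr_gt0 lt_max ltr01.
move=> Y f rho; rewrite /near_at => h1 h2; split.
  apply: le_trans h1; rewrite -[leLHS]invrK.
  have a1 : 0 < Num.max 1 a by rewrite lt_max ltr01.
  have [a0|a0] := leP a 0.
    apply: (@le_trans _ _ 0); first by rewrite invrK.
    by rewrite invr_ge0 le_min (ltW e0) invr_ge0 ltW.
  rewrite lef_pV2 ?posrE ?invr_gt0 ?lt_min ?e0 ?invr_gt0//.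
  by rewrite ge_min; apply/orP; right; rewrite lef_pV2 ?posrE// le_max lexx orbT.
by apply: near_iso_le h2; rewrite ge_min lexx.
Qed.

Lemma near_atW X (P Q : forall Y, (X -> Y) -> R -> Prop) :
  (forall Y (f : X -> Y) rho, P Y f rho -> Q Y f rho) ->
  near_at P -> near_at Q.
Proof. by move=> PQ [e e0 eP]; exists e => // Y f rho /eP h /h/PQ. Qed.

Lemma near_atI X (P Q : forall Y, (X -> Y) -> R -> Prop) : near_at P -> near_at Q ->
  near_at (fun Y (f : X -> Y) rho => P Y f rho /\ Q Y f rho).
Proof.
move=> [e e0 eP] [d d0 dQ].
exists (Num.min e d); first by rewrite lt_min e0 d0.
move=> Y f rho h1 h2.
have m0 : 0 < Num.min e d by rewrite lt_min e0 d0.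
split; [apply: eP|apply: dQ].
- by apply: le_trans h1; rewrite lef_pV2 ?posrE// ge_min lexx.
- by apply: near_iso_le h2; rewrite ge_min lexx.
- by apply: le_trans h1; rewrite lef_pV2 ?posrE// ge_min lexx orbT.
- by apply: near_iso_le h2; rewrite ge_min lexx orbT.
Qed.

Lemma near_at_all X (T : choiceType) (A : set T)
    (P : T -> forall Y, (X -> Y) -> R -> Prop) :
  finite_set A -> (forall z, A z -> near_at (P z)) ->
  near_at (fun Y (f : X -> Y) rho => forall z, A z -> P z Y f rho).
Proof.
move=> /finite_seqP[s ->] /=; elim: s => [|z s IH] sP; first by exists 1.
have /near_atI := sP z (mem_head _ _).
have /IH/[swap]/[apply] : forall z, z \in s -> near_at (P z).
  by move=> y ys; apply: sP; rewrite inE ys orbT.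
apply: near_atW => Y f rho [Pz Ps] y; rewrite inE => /orP[/eqP->//|]; exact: Ps.
Qed.

Definition locally_near X P := near_at (fun Y (_ : X -> Y) _ => P Y).

Lemma locally_near_ball X P : locally_near X P ->
  exists2 d, 0 < d & forall Y, kappa (class_of X) (class_of Y) < d -> P Y.
Proof.
move=> [e e0 eP]; have [d d0 dP] := kappa_near_iso X e0.
by exists d => // Y /dP[f [rho erho fXY]]; exact: eP fXY.
Qed.

Lemma locally_near_class X P : locally_near X P ->
  exists2 d, 0 < d & forall c, kappa (class_of X) c < d -> P (repr c).
Proof.
move=> /locally_near_ball[d d0 dP]; exists d => // c.
by rewrite -{1}(class_ofK c) => /dP.
Qed.

Lemma locally_near_iso X Y P : isomorphic X Y -> locally_near X P -> P Y.
Proof.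
move=> /class_ofP XY /locally_near_ball[d d0 dP]; apply: dP.
by rewrite XY kappaxx.
Qed.

Lemma measurable_kappa_open (U : set (iso_class Xi k)) :
  kappa_open U -> measurable (U : set (space_of_classes Xi k)).
Proof. exact: sub_sigma_algebra. Qed.

(** Superlevel sets are [kappa_open]. The hypothesis ranges over all spaces, so nothing has to be
    known about the choice of [repr]. *)
Lemma lsc_measurable (phi : marked_space Xi k -> \bar R) :
  (forall X a, (a%:E < phi X)%E -> locally_near X (fun Y => (a%:E < phi Y)%E)) ->
  measurable_fun setT (fun c : space_of_classes Xi k => phi (repr c)).
Proof.
move=> phi_lsc.
apply: (measurability _ (ErealGenOInfty.measurableE R)) => _ [_ [a ->] <-].
rewrite setTI; apply: measurable_kappa_open => c /=.
rewrite in_itv/= andbT => /phi_lsc/locally_near_class[d d0 dP].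
by exists d => // c' /=; rewrite in_itv/= andbT -{1}(class_ofK c) => /dP.
Qed.

Lemma lsc_measurable_real (phi : marked_space Xi k -> R) :
  (forall X a, a < phi X -> locally_near X (fun Y => a < phi Y)) ->
  measurable_fun setT (fun c : space_of_classes Xi k => phi (repr c)).
Proof.
move=> phi_lsc; apply/measurable_EFinP.
apply: (@lsc_measurable (EFin \o phi)) => X a; rewrite lte_fin => /phi_lsc.
by move=> [e e0 eP]; exists e => // Y f rho erho fXY; rewrite /= lte_fin; exact: eP fXY.
Qed.

(** Semicontinuity already forces invariance under isomorphism: isomorphic spaces are at
    [kappa]-distance 0, so each value bounds the other. *)
Lemma lsc_class_of (phi : marked_space Xi k -> R) X :
  (forall X a, a < phi X -> locally_near X (fun Y => a < phi Y)) ->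
  phi (repr (class_of X)) = phi X.
Proof.
move=> phi_lsc.
have le X1 X2 : isomorphic X1 X2 -> phi X1 <= phi X2.
  by move=> X12; rewrite leNgt; apply/negP => /phi_lsc/(locally_near_iso X12); rewrite ltxx.
apply/eqP; rewrite eq_le !le//; first exact: repr_class_of.
exact/isomorphic_sym/repr_class_of.
Qed.

End LocallyNear.

Section ClassMaps.
Context {R : realType}.

Lemma measurable_class_map (Xi Xi' : polishType R) k k'
    (F : marked_space Xi k -> marked_space Xi' k') :
  (forall X e, 0 < e -> locally_near X (fun Y =>
     near_embedding e (F X) (F Y) /\ near_embedding e (F Y) (F X))) ->
  measurable_fun setT
    (fun c : space_of_classes Xi k => class_of (F (repr c)) : space_of_classes Xi' k').
Proof.
move=> F_cont.
have mG := @measurability _ _ (space_of_classes Xi k) (space_of_classes Xi' k')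
  setT (fun c => class_of (F (repr c))) (@kappa_open R Xi' k').
apply: mG => [//|_ [U oU <-]]; rewrite setTI.
apply: measurable_kappa_open => c /= /oU[e e0 eU].
have e20 : 0 < e / 2 by rewrite divr_gt0.
have [d d0 dP] := locally_near_class (F_cont (repr c) _ e20).
exists d => // c'; rewrite /= -{1}(class_ofK c) => /dP[h1 h2]; apply: eU => /=.
by have := near_embedding_kappa e20 h1 h2; lra.
Qed.

Variables (Xi Xi' : polishType R) (k k' : nat) (j : 'I_k'.+1 -> 'I_k.+1)
  (h : Xi -> Xi') (h_lip : forall a b, mdist (h a) (h b) <= mdist a b).

(** One operation for forgetting, swapping or selecting distinguished points and for changing marks:
    [first_point], [second_point], [swap_points] and [forget] are all instances, with one
    measurability proof. *)
Definition restructure (X : marked_space Xi k) : marked_space Xi' k' :=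
  MarkedSpace (fun i => pt X (j i)) (fun x y => h (mark x y)).

Lemma restructure_iso (X Y : marked_space Xi k) :
  isomorphic X Y -> isomorphic (restructure X) (restructure Y).
Proof.
by move=> [f [fi fo fm]]; exists f; split=> [//|i|x y]; rewrite /= ?fo ?fm.
Qed.

Lemma near_embedding_restructure (X Y : marked_space Xi k) (e : R) (f : X -> Y) rho :
  0 < e ->
  e^-1 + dist (pt X ord0) (pt X (j ord0)) <= rho ->
  near_iso X Y e f rho -> near_embedding e (restructure X) (restructure Y).
Proof.
move=> e0 erho [fi fB fo fd].
have sub x : dist (pt X (j ord0)) x <= e^-1 -> cball X rho x.
  move=> xe; rewrite /cball/=.
  by apply: le_trans (dist_triangle (pt X (j ord0)) _ _) _; lra.
exists f; split=> /=.
- by move=> x y; rewrite !inE => /sub xB /sub yB; apply: fi; rewrite inE.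
- by move=> i _; have [] := fo (j i).
- move=> x y /sub xB /sub yB; have [h1 h2] := fd _ _ xB yB.
  by split=> //; apply: le_trans h2.
Qed.

Lemma measurable_restructure : measurable_fun setT
  (fun c : space_of_classes Xi k =>
     class_of (restructure (repr c)) : space_of_classes Xi' k').
Proof.
apply: measurable_class_map => X e e0.
(* The new origin is [pt X (j ord0)], so the radius must grow by its distance to the old one. In [Y]
   this distance may be larger by [e], whence the last summand. *)
apply: near_atW (near_at_iso X (e^-1 + dist (pt X ord0) (pt X (j ord0)) + e) e0).
move=> Y f rho [erho fXY]; split.
  by apply: near_embedding_restructure fXY => //; lra.
have [g [gYX _ _]] := near_iso_inv fXY.
apply: near_embedding_restructure gYX => //.
case: fXY => _ _ fo fd; have [B0 f0] := fo ord0; have [B1 f1] := fo (j ord0).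
have [+ _] := fd _ _ B0 B1; rewrite f0 f1 ler_norml => /andP[_]; lra.
Qed.

End ClassMaps.

Section BasicMeasurable.
Context {R : realType}.

Lemma measurable_pt_dist (Xi : polishType R) k (i j : 'I_k.+1) :
  measurable_fun setT (fun c : space_of_classes Xi k =>
    dist (pt (repr c) i) (pt (repr c) j)).
Proof.
apply: (lsc_measurable_real (phi := fun X => dist (pt X i) (pt X j))) => X a aX.
have e0 : 0 < (dist (pt X i) (pt X j) - a) / 2 by lra.
apply: near_atW (near_at_iso X 0 e0) => Y f rho [_ [_ _ fo fd]].
have [B0 f0] := fo i; have [B1 f1] := fo j.
have [+ _] := fd _ _ B0 B1; rewrite f0 f1 ler_norml => /andP[+ _]; lra.
Qed.

Lemma origin_mark_lsc (P : {pred R}) (clP : closed [set x | P x]) x0 (Px0 : P x0)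
  (X : marked_space (closed_subspace clP Px0) 0) a :
  a < point_mark (origin X) -> locally_near X (fun Y => a < point_mark (origin Y)).
Proof.
move=> aX.
have e0 : 0 < (point_mark (origin X) - a) / 2 by lra.
apply: near_atW (near_at_iso X 0 e0) => Y f rho [_ [_ _ fo fd]].
have [B0 f0] := fo ord0.
have [_] := fd _ _ B0 B0; rewrite f0 /mdist/= => h.
have : `|point_mark (origin Y) - point_mark (origin X)| <= (point_mark (origin X) - a) / 2 by exact: h.
rewrite ler_norml => /andP[+ _]; lra.
Qed.

Lemma measurable_origin_mark (P : {pred R}) (clP : closed [set x | P x]) x0 (Px0 : P x0) :
  measurable_fun setT (fun c : space_of_classes (closed_subspace clP Px0) 0 =>
     point_mark (origin (repr c))).
Proof.
apply: (lsc_measurable_real (phi := fun X => point_mark (origin X))).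
exact: origin_mark_lsc.
Qed.

Lemma origin_mark_class_of (P : {pred R}) (clP : closed [set x | P x]) x0 (Px0 : P x0)
  (X : marked_space (closed_subspace clP Px0) 0) :
  point_mark (origin (repr (class_of X))) = point_mark (origin X).
Proof.
apply: (lsc_class_of (phi := fun X => point_mark (origin X))).
exact: origin_mark_lsc.
Qed.

End BasicMeasurable.

Lemma dirac_sum_count {R : realType} d (T : measurableType d) (s : seq T) (A : set T) :
  dirac_sum s A = (count (fun x => x \in A) s)%:R%:E :> \bar R.
Proof.
rewrite dirac_sumE; elim: s => [|x s IH]; first by rewrite big_nil.
by rewrite big_cons IH diracE -EFinD /= natrD.
Qed.

(** * Sums over the finite decorations of a class *)

Section Decorations.
Context {R : realType}.
Variables (Xi Xi' : polishType R) (k k' : nat).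
Variables (Dec : marked_space Xi k -> choiceType) (V : forall X, set (Dec X))
  (cl : forall X, Dec X -> space_of_classes Xi' k').
Arguments V : clear implicits.
Hypothesis finV : forall X, finite_set (V X).
Hypothesis push : forall X (U : set (iso_class Xi' k')), kappa_open U ->
  near_at (X := X) (fun Y (f : X -> Y) rho => exists phi : Dec X -> Dec Y,
    {in V X &, injective phi} /\
    forall z, V X z -> U (cl z) -> V Y (phi z) /\ U (cl (phi z))).

(** Counts the classes of the decorated spaces with multiplicity, so that a sum over decorations
    becomes an integral. By [push], decorations with class in an open set are carried injectively to
    such decorations of nearby spaces, so their number cannot drop. *)
Definition decoration_measure X : {measure set (space_of_classes Xi' k') -> \bar R} :=
  dirac_sum [seq cl z | z <- fset_set (V X)].

(* On open sets the number of decorations is lower semicontinuous. *)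
Lemma measurable_decoration_measure (A : set (space_of_classes Xi' k')) :
  measurable A ->
  measurable_fun setT
    (fun c : space_of_classes Xi k => decoration_measure (repr c) A).
Proof.
move: A; apply: (measurable_measure_family (G := @kappa_open R Xi' k')
  (nu := fun c : space_of_classes Xi k => decoration_measure (repr c))).
- by move=> A B; exact: kappa_openI.
- exact: kappa_openT.
- by move=> c A _; exact: dirac_sum_fin_num.
move=> U oU.
apply: (@lsc_measurable _ _ _ (fun X => decoration_measure X U)) => X a aX.
apply: near_atW (push X oU) => Y f rho [phi [phi_inj phiP]].
apply: lt_le_trans aX _.
rewrite /decoration_measure !dirac_sum_count lee_fin ler_nat !count_map.
rewrite -!size_filter -(size_map phi); apply: uniq_leq_size.
  rewrite map_inj_in_uniq ?filter_uniq// => x y.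
  rewrite !mem_filter !in_fset_set// => /andP[_ xV] /andP[_ yV].
  exact: phi_inj.
move=> _ /mapP[z + ->]; rewrite !mem_filter /= !in_fset_set// => /andP[/set_mem Uz /set_mem Vz].
have [Vp Up] := phiP z Vz Uz.
by apply/andP; split; exact/mem_set.
Qed.

Lemma measurable_decoration_sum (g : space_of_classes Xi' k' -> \bar R) :
  measurable_fun setT g -> (forall x, 0 <= g x)%E ->
  measurable_fun setT (fun c : space_of_classes Xi k =>
    (\sum_(z <- fset_set (V (repr c))) g (cl z))%E).
Proof.
move=> mg g0.
rewrite (_ : (fun c => _) = (fun c : space_of_classes Xi k =>
    (\int[decoration_measure (repr c)]_x g x)%E)).
  apply: measurable_fun_integral_kernel => //.
  exact: measurable_decoration_measure.
by apply/funext => c; rewrite integral_dirac_sum// big_map.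
Qed.

End Decorations.

Lemma le_esum_subset {R : realType} (T : choiceType) (A B : set T) (a : T -> \bar R) :
  A `<=` B -> (\esum_(i in A) a i <= \esum_(i in B) a i)%E.
Proof.
move=> AB; apply: ge_ereal_sup => /= _ [X [finX XA] <-].
by apply: esum_ge; exists X => //; split=> //; exact: subset_trans AB.
Qed.

Section AddPoint.
Context {R : realType} (Xi : polishType R).
Implicit Types X Y : marked_space Xi 0.

Definition add_point X (v : X) : marked_space Xi 1 :=
  @MarkedSpace R Xi 1 X (fun i => if i == ord0 then origin X else v) (@mark R Xi 0 X).

Definition move_origin X (v : X) : marked_space Xi 0 :=
  @MarkedSpace R Xi 0 X (fun=> v) (@mark R Xi 0 X).

Lemma near_iso_add_point X Y e (f : X -> Y) rho v :
  near_iso X Y e f rho -> cball X rho v ->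
  near_iso (add_point v) (add_point (f v)) e f rho.
Proof.
move=> [fi fB fo fd] vB; split=> // i.
rewrite /add_point /=; case: ifP => // _.
by have := fo ord0.
Qed.

Lemma add_point_iso X Y (f : X -> Y) (v : X) : is_isometry f ->
  f (origin X) = origin Y -> (forall x y, mark (f x) (f y) = mark x y) ->
  class_of (add_point v) = class_of (add_point (f v)).
Proof.
move=> fi fo fm; apply/class_ofP; exists f; split=> // i.
by rewrite /add_point /=; case: ifP.
Qed.

(** The ball is open because a strict inequality survives a small distortion of the distances
    ([oball_near_at]); membership in a closed ball would not. *)
Definition oball X (r : R) : set X := [set v | dist (origin X) v < r].
Arguments oball : clear implicits.

Lemma finite_oball X r : finite_set (oball X r).
Proof.
by apply: sub_finite_set (finite_balls (origin X) r) => v /= /ltW.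
Qed.

Lemma oball_near_at X v r : oball X r v ->
  near_at (X := X) (fun Y (f : X -> Y) _ => oball Y r (f v)).
Proof.
move=> vr; have e0 : 0 < (r - dist (origin X) v) / 2 by move: vr; rewrite /oball/=; lra.
apply: near_atW (near_at_iso X r e0) => Y f rho [rrho [_ _ fo fd]].
have [B0 f0] := fo ord0.
have vB : cball X rho v by move: vr; rewrite /oball /cball/= /origin; lra.
have [+ _] := fd _ _ B0 vB; rewrite f0 ler_norml => /andP[_].
by move: vr; rewrite /oball /= /origin; lra.
Qed.

Lemma measurable_oball_sum (r : R) (g : space_of_classes Xi 1 -> \bar R) :
  measurable_fun setT g -> (forall x, 0 <= g x)%E ->
  measurable_fun setT (fun c : space_of_classes Xi 0 =>
    (\sum_(v <- fset_set (oball (repr c) r)) g (class_of (add_point v)))%E).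
Proof.
move=> mg g0.
apply: (measurable_decoration_sum (Dec := fun X => X : choiceType)
  (V := fun X => oball X r) (cl := fun X v => class_of (add_point v))) => //.
  by move=> X; exact: finite_oball.
move=> X U oU.
have /near_at_all : forall v, (oball X r `&` [set v | U (class_of (add_point v))]) v ->
    near_at (X := X) (fun Y (f : X -> Y) rho => oball Y r (f v) /\ U (class_of (add_point (f v)))).
  move=> v [vr Uv]; apply: near_atI; first exact: oball_near_at.
  have [e e0 eU] := (kappa_openP U).1 oU _ Uv.
  have := near_at_iso X (Num.max r e^-1) e0; apply: near_atW => Y f rho.
  rewrite ge_max => -[/andP[rrho erho] fXY].
  apply: (eU _ (f : add_point v -> add_point (f v)) rho) => //.
  by apply: near_iso_add_point => //; move: vr; rewrite /oball /cball/= /origin; lra.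
move=> /(_ (sub_finite_set (@subIsetl _ _ _) (finite_oball X r))).
move=> /near_atI/(_ (near_at_iso X r ltr01)).
apply: near_atW => Y f rho [fP [rrho [fi _ _ _]]]; exists f; split.
  have sub v : oball X r v -> cball X rho v.
    by rewrite /oball /cball/= /origin; lra.
  by move=> v v'; rewrite !inE => /sub vB /sub vB'; apply: fi; rewrite inE.
by move=> v vr Uv; apply: fP.
Qed.

Lemma fsbig_oball_esum X r (g : X -> \bar R) : (forall v, 0 <= g v)%E ->
  (\sum_(v <- fset_set (oball X r)) g v = \esum_(v in oball X r) g v)%E.
Proof.
by move=> g0; rewrite esum_fset ?fsbig_finite//; exact: finite_oball.
Qed.

Lemma esum_oball_cvg X (g : X -> \bar R) : (forall v, 0 <= g v)%E ->
  ((\sum_(v <- fset_set (oball X n%:R)) g v)%E @[n --> \oo] -->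
    \esum_(v in [set: X]) g v)%E.
Proof.
move=> g0.
rewrite (_ : (fun n => _) = (fun n : nat => \esum_(v in oball X n%:R) g v)%E); last first.
  by apply/funext => n; rewrite fsbig_oball_esum.
have nd : nondecreasing_seq (fun n : nat => \esum_(v in oball X n%:R) g v)%E.
  move=> m n mn; apply: le_esum_subset => v; rewrite /oball /= => vm.
  by apply: lt_le_trans vm _; rewrite ler_nat.
rewrite (_ : (\esum_(v in _) _)%E = ereal_sup (range (fun n : nat => \esum_(v in oball X n%:R) g v)%E)).
  exact: ereal_nondecreasing_cvgn.
apply/eqP; rewrite eq_le; apply/andP; split; last first.
  by apply: ge_ereal_sup => _ /= [n _ <-]; exact: le_esum_subset.
apply: ge_ereal_sup => _ /= [F [finF _] <-].
have [n Fn] : exists n, F `<=` oball X n%:R.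
  have /finite_seqP[s sE] := finF; rewrite sE.
  elim: s {finF sE} => [|v s [n sn]]; first by exists 0%N.
  exists (maxn n (Num.truncn (dist (origin X) v)).+1) => u /=.
  rewrite inE /oball /= natr_max lt_max => /orP[/eqP->|/sn]; last by rewrite /oball/= => ->.
  by rewrite truncnS_gt orbT.
apply: (@le_trans _ _ (\esum_(v in oball X n%:R) g v)%E).
  by apply: esum_ge; exists F.
by apply: ereal_sup_ubound; exists n.
Qed.

Lemma measurable_esum_add_point (g : space_of_classes Xi 1 -> \bar R) :
  measurable_fun setT g -> (forall x, 0 <= g x)%E ->
  measurable_fun setT (fun c : space_of_classes Xi 0 =>
    (\esum_(v in [set: repr c]) g (class_of (add_point v)))%E).
Proof.
move=> mg g0.
apply: (emeasurable_fun_cvg (fun (n : nat) (c : space_of_classes Xi 0) =>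
  \sum_(v <- fset_set (oball (repr c) n%:R)) g (class_of (add_point v)))%E).
  by move=> n; exact: measurable_oball_sum.
by move=> c _; exact: esum_oball_cvg.
Qed.

Lemma esum_add_point_class_of (g : space_of_classes Xi 1 -> \bar R) X :
  (\esum_(v in [set: repr (class_of X)]) g (class_of (add_point v)) =
   \esum_(v in [set: X]) g (class_of (add_point v)))%E.
Proof.
have [f [fi fo fm]] := repr_class_of X.
rewrite (reindex_esum [set: X] _ f); last first.
  have [[h fK hK] _] := fi; split=> //.
    by move=> x y _ _ /(can_inj fK).
  by move=> y _; exists (h y).
by apply: eq_esum => v _; congr (g _); apply/esym/add_point_iso => //; exact: fo.
Qed.

End AddPoint.
Arguments oball {R Xi} X r _.

Section TwoMarks.
Context {R : realType} (Xi : polishType R) (a b z : Xi).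

(** Meant for coverings seen in a large ball: the first set holds the heads, the second the points
    that they leave uncovered, and [z] is the mark of all other pairs. Finite sets make such a
    pattern a decoration of the unmarked space. *)
Definition two_marks (D : discrete_space) (TW : {fset D} * {fset D}) :
    markings Xi D :=
  fun x y => if (x == y) && (x \in TW.1) then a
             else if (x == y) && (x \in TW.2) then b else z.

Definition disjoint_fsets (X : marked_space (no_mark R) 0) (r : R) :
    set ({fset X} * {fset X}) :=
  [set TW : {fset X} * {fset X} | [/\ forall v, v \in TW.1 -> oball X r v,
    forall v, v \in TW.2 -> oball X r v &
    forall v, v \in TW.1 -> v \notin TW.2]].

Arguments disjoint_fsets : clear implicits.

Lemma finite_disjoint_fsets X r : finite_set (disjoint_fsets X r).
Proof.
pose B := fset_set (oball X r).
apply: (@sub_finite_set _ _ ([set` fpowerset B] `*` [set` fpowerset B])).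
  move=> TW [T1 W1 _]; split=> /=; rewrite fpowersetE; apply/fsubsetP => v.
    by move/T1 => ?; rewrite in_fset_set ?inE//; exact: finite_oball.
  by move/W1 => ?; rewrite in_fset_set ?inE//; exact: finite_oball.
by apply: finite_setX; exact: finite_fset.
Qed.

Lemma near_iso_two_marks (X Y : marked_space (no_mark R) 0) e (f : X -> Y) rho
    (T W : {fset X}) : 0 < e -> near_iso X Y e f rho ->
  (forall v, v \in T -> cball X rho v) -> (forall v, v \in W -> cball X rho v) ->
  near_iso (@MarkedSpace R Xi 0 X (fun=> origin X) (two_marks (T, W)))
    (@MarkedSpace R Xi 0 Y (fun=> origin Y) (two_marks ((f @` T)%fset, (f @` W)%fset)))
    e f rho.
Proof.
move=> e0 [fi fB fo fd] TB WB; split=> //.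
  by move=> i; have := fo ord0.
move=> x y xB yB; split; first by have [] := fd _ _ xB yB.
have fE : (f x == f y) = (x == y).
  by apply/eqP/eqP => [|->//]; apply: fi; rewrite inE.
have memE (S : {fset X}) : (forall v, v \in S -> cball X rho v) ->
    (f x \in (f @` S)%fset) = (x \in S).
  move=> SB; apply/imfsetP/idP => /= [[v vS fxv]|xS]; last by exists x.
  by rewrite (fi x v) ?inE//; exact: SB.
by rewrite /= /two_marks /= fE !memE// mdistxx ltW.
Qed.

Lemma measurable_two_marks_sum r (g : marked_Dstar Xi -> \bar R) :
  measurable_fun setT g -> (forall x, 0 <= g x)%E ->
  measurable_fun setT (fun c : Dstar =>
    (\sum_(TW <- fset_set (disjoint_fsets (repr c) r))
       g (marked (origin (repr c)) (two_marks TW)))%E).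
Proof.
move=> mg g0.
apply: (measurable_decoration_sum
  (Dec := fun X : marked_space (no_mark R) 0 => ({fset X} * {fset X})%type : choiceType)
  (V := fun X => disjoint_fsets X r)
  (cl := fun X TW => marked (origin X) (two_marks TW))) => //.
  by move=> X; exact: finite_disjoint_fsets.
move=> X U oU.
have /near_at_all : forall TW, (disjoint_fsets X r `&`
    [set TW | U (marked (origin X) (two_marks TW))]) TW ->
    near_at (X := X) (fun Y (f : X -> Y) rho =>
      disjoint_fsets Y r ((f @` TW.1)%fset, (f @` TW.2)%fset) /\
      U (marked (origin Y) (two_marks ((f @` TW.1)%fset, (f @` TW.2)%fset)))).
  move=> [T W] [[/= Tr Wr TW] UTW].
  have [e e0 eU] := (kappa_openP U).1 oU _ UTW.
  have allT (S : {fset X}) : (forall v, v \in S -> oball X r v) ->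
      near_at (X := X) (fun Y f _ => forall v, v \in S -> oball Y r (f v)).
    move=> Sr; apply: near_at_all; first exact: finite_fset.
    by move=> v /Sr; exact: oball_near_at.
  have /near_atI/(_ (near_atI (allT _ Tr) (allT _ Wr))) := near_at_iso X (Num.max r e^-1) e0.
  apply: near_atW => Y f rho.
  rewrite ge_max => -[[/andP[rrho erho] fXY]] [fT fW].
  have sub v : oball X r v -> cball X rho v.
    by rewrite /oball /cball/= /origin; lra.
  split; last first.
    apply: (eU (@MarkedSpace R Xi 0 Y (fun=> origin Y)
      (two_marks ((f @` T)%fset, (f @` W)%fset))) f rho) => //.
    apply: near_iso_two_marks => //; first by move=> v /Tr/sub.
    by move=> v /Wr/sub.
  split=> /=.
  - by move=> _ /imfsetP[v /= vT ->]; exact: fT.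
  - by move=> _ /imfsetP[v /= vT ->]; exact: fW.
  - move=> _ /imfsetP[v /= vT ->]; apply/negP => /imfsetP[w /= wW].
    case: fXY => fi _ _ _.
    move=> /(fi _ _ (mem_set (sub _ (Tr _ vT))) (mem_set (sub _ (Wr _ wW)))) vw.
    by have := TW _ vT; rewrite vw wW.
move=> /(_ (sub_finite_set (@subIsetl _ _ _) (finite_disjoint_fsets X r))).
move=> /near_atI/(_ (near_at_iso X r ltr01)).
apply: near_atW => Y f rho [fP [rrho [fi _ _ _]]].
exists (fun TW => ((f @` TW.1)%fset, (f @` TW.2)%fset)); split; last first.
  by move=> TW VTW UTW; apply: fP.
have sub v : oball X r v -> cball X rho v.
  by rewrite /oball /cball/= /origin; lra.
have inj (S S' : {fset X}) : (forall v, v \in S -> oball X r v) ->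
    (forall v, v \in S' -> oball X r v) -> (f @` S)%fset = (f @` S')%fset ->
    {subset S <= S'}.
  move=> Sr S'r SS' v vS.
  have : f v \in (f @` S')%fset by rewrite -SS'; apply/imfsetP; exists v.
  move=> /imfsetP[w /= wS'].
  by move=> /(fi _ _ (mem_set (sub _ (Sr _ vS))) (mem_set (sub _ (S'r _ wS')))) ->.
move=> [T W] [T' W']; rewrite !inE => -[/= Tr Wr _] [/= Tr' Wr' _] [TT' WW'].
by congr pair; apply/fsetP => v; apply/idP/idP; exact: inj.
Qed.

End TwoMarks.
Arguments disjoint_fsets {R} X r _.

Section Mixture.
Context {R : realType} d d' (Y : measurableType d) (Z : measurableType d').
Variables (mu : probability Y R) (k : Y -> probability Z R).
Hypothesis mk : forall U, measurable U -> measurable_fun setT (fun y => k y U).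

Let l (_ : unit) : {measure set Y -> \bar R} := mu.

Let measurable_l U : measurable U -> measurable_fun setT (l ^~ U).
Proof. by move=> _; exact: measurable_cst. Qed.

HB.instance Definition _ := isKernel.Build _ _ _ _ R l measurable_l.

Let l_prob x : l x setT = 1%E.
Proof. exact: probability_setT. Qed.

HB.instance Definition _ := Kernel_isProbability.Build _ _ _ _ R l l_prob.

Let k' (xy : unit * Y) : {measure set Z -> \bar R} := k xy.2.

Let measurable_k' U : measurable U -> measurable_fun setT (k' ^~ U).
Proof. by move=> mU; exact: measurableT_comp (mk mU) measurable_snd. Qed.

HB.instance Definition _ := isKernel.Build _ _ _ _ R k' measurable_k'.

Let k'_prob x : k' x setT = 1%E.
Proof. exact: probability_setT. Qed.

HB.instance Definition _ := Kernel_isProbability.Build _ _ _ _ R k' k'_prob.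

(** The measure [mu] is regarded as a kernel from [unit]; [nu] is then a composition of kernels,
    whose integral is iterated. *)
Lemma integral_mixture (nu : {measure set Z -> \bar R}) (f : Z -> \bar R) :
  (forall A, measurable A -> nu A = \int[mu]_y k y A)%E ->
  measurable_fun setT f -> (forall z, 0 <= f z)%E ->
  (\int[nu]_z f z = \int[mu]_y \int[k y]_z f z)%E.
Proof.
move=> nuE mf f0.
have := @integral_kcomp _ _ _ unit Y Z R l k' tt f f0 mf.
move=> <-; apply: eq_measure_integral => A mA _.
by rewrite nuE.
Qed.

End Mixture.

Section Classes.
Context {R : realType}.

Definition unmarked (D : discrete_space) (v : D) : marked_space (no_mark R) 0 :=
  @MarkedSpace R (no_mark R) 0 D (fun=> v) (fun _ _ => tt).

Definition pointed_class (D : discrete_space) (v : D) : Dstar :=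
  class_of (unmarked v).

Lemma unmarked_iso (X : marked_space (no_mark R) 0) :
  isomorphic X (unmarked (origin X)).
Proof.
exists id; split=> //; first by split=> //; exists id.
  by move=> i; rewrite (ord1 i).
by move=> x y; case: (mark _ _); case: (mark _ _).
Qed.

Lemma pointed_class_repr (c : Dstar) : pointed_class (origin (repr c)) = c.
Proof.
by rewrite -[RHS]class_ofK; apply/class_ofP/isomorphic_sym/unmarked_iso.
Qed.

Lemma pointed_class_iso (D D' : discrete_space) (f : D -> D') v :
  is_isometry f -> pointed_class (f v) = pointed_class v.
Proof. by move=> fi; apply/class_ofP/isomorphic_sym; exists f. Qed.

Section Restructure.
Variables (Xi Xi' : polishType R) (k k' : nat) (j : 'I_k'.+1 -> 'I_k.+1) (h : Xi -> Xi').

Lemma restructure_class_of (X : marked_space Xi k) :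
  class_of (restructure j h (repr (class_of X))) = class_of (restructure j h X).
Proof.
apply/class_ofP/restructure_iso/isomorphic_sym; exact: repr_class_of.
Qed.

End Restructure.

Section Points.
Variable Xi : polishType R.

Definition first_point (c : space_of_classes Xi 1) : space_of_classes Xi 0 :=
  class_of (restructure (fun=> ord0) id (repr c)).

Definition second_point (c : space_of_classes Xi 1) : space_of_classes Xi 0 :=
  class_of (restructure (fun=> ord_max) id (repr c)).

Definition points_dist (c : space_of_classes Xi 1) : R :=
  dist (pt (repr c) ord0) (pt (repr c) ord_max).

Lemma measurable_first_point : measurable_fun setT first_point.
Proof. exact: measurable_restructure. Qed.

Lemma measurable_second_point : measurable_fun setT second_point.
Proof. exact: measurable_restructure. Qed.

Lemma measurable_points_dist : measurable_fun setT points_dist.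
Proof. exact: measurable_pt_dist. Qed.

Lemma second_point_add (X : marked_space Xi 0) (v : X) :
  second_point (class_of (add_point v)) = class_of (move_origin v).
Proof. by rewrite /second_point restructure_class_of. Qed.

Lemma points_dist_class_of (X : marked_space Xi 1) :
  points_dist (class_of X) = dist (pt X ord0) (pt X ord_max).
Proof.
have [f [[_ fd] fo _]] := repr_class_of X.
by rewrite /points_dist -!fo fd.
Qed.

End Points.

Definition forget (Xi : polishType R) (c : marked_Dstar Xi) : Dstar :=
  class_of (restructure id (fun _ : Xi => tt : no_mark R) (repr c)).

Lemma measurable_forget Xi : measurable_fun setT (@forget Xi).
Proof.
apply: measurable_restructure => a b; rewrite mdistxx.
have [->|ab] := eqVneq a b; first by rewrite mdistxx.
by apply: ltW; rewrite mdist_gt0.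
Qed.

Lemma forget_class_of (Xi : polishType R) (X : marked_space Xi 0) :
  forget (class_of X) = pointed_class (origin X).
Proof.
rewrite /forget restructure_class_of; apply/class_ofP.
by exists id; split=> // [|i]; [split=> //; exists id|rewrite (ord1 i)].
Qed.

Lemma first_point_bipointed (D : discrete_space) (u v : D) :
  first_point (class_of (bipointed u v)) = pointed_class u.
Proof. by rewrite /first_point restructure_class_of. Qed.

Lemma second_point_bipointed (D : discrete_space) (u v : D) :
  second_point (class_of (bipointed u v)) = pointed_class v.
Proof. by rewrite /second_point restructure_class_of. Qed.

Lemma points_dist_bipointed (D : discrete_space) (u v : D) :
  points_dist (class_of (bipointed u v)) = dist u v.
Proof. by rewrite points_dist_class_of. Qed.

Lemma add_point_unmarked (X : marked_space (no_mark R) 0) (v : X) :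
  class_of (add_point v) = class_of (bipointed (origin X) v).
Proof.
apply/class_ofP; exists id; split=> //; first by split=> //; exists id.
by move=> x y; case: (mark _ _); case: (mark _ _).
Qed.

End Classes.

(** * Conditional laws given the unmarked space *)

Section ProcessKernel.
Context {R : realType} (Xi : polishType R) (Z : @equivariant_process R Xi).

HB.instance Definition _ (D : discrete_space) (o : D) :=
  isMeasurableFun.Build _ _ _ _ (@marked R Xi D o) (@measurable_marked R Xi D o).

(** A regular conditional law of the marked class given the unmarked one. *)
Definition process_kernel (c : @Dstar R) : probability (marked_Dstar Xi) R :=
  distribution (Z (repr c)) (marked (origin (repr c))).

Lemma measurable_process_kernel A : measurable A ->
  measurable_fun setT (fun c => process_kernel c A).
Proof. exact: law_measurable. Qed.

Lemma integral_marked_law (mu : probability (@Dstar R) R) (f : marked_Dstar Xi -> \bar R) :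
  measurable_fun setT f -> (forall x, 0 <= f x)%E ->
  (\int[marked_law mu Z]_x f x = \int[mu]_c \int[process_kernel c]_x f x)%E.
Proof.
by move=> mf f0; apply: integral_mixture => //; exact: measurable_process_kernel.
Qed.

Lemma measurable_integral_process_kernel (f : marked_Dstar Xi -> \bar R) :
  measurable_fun setT f -> (forall x, 0 <= f x)%E ->
  measurable_fun setT (fun c => \int[process_kernel c]_x f x)%E.
Proof.
move=> mf f0; apply: measurable_fun_integral_kernel => //.
exact: measurable_process_kernel.
Qed.

(** Frees the conditional law from the representative: by [law_isometry], one random marking of [D],
    seen from any of its points, has the conditional law at that point. This lets different roots of
    the same marking be compared. *)
Lemma process_kernelE (D : discrete_space) (v : D) A : measurable A ->
  process_kernel (pointed_class v) A = Z D (marked v @^-1` A).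
Proof.
move=> mA; have [f [[[g fK gK] fd] fo _]] := repr_class_of (unmarked v).
have mB : measurable (marked (origin (repr (pointed_class v))) @^-1` A
    : set (markings Xi (repr (pointed_class v)))).
  by rewrite -[X in measurable X]setTI; exact: measurable_marked.
rewrite /process_kernel /distribution /pushforward.
have isof : @is_isometry R D (repr (pointed_class v)) f by split=> //; exists g.
rewrite -[LHS](law_isometry Z isof fK gK mB); congr (Z D _).
apply/seteqP; split=> m /=.
all: suff -> : marked (origin (repr (pointed_class v))) (transport g m) = marked v m by [].
all: apply/class_ofP/isomorphic_sym; exists f; split=> // [i|x y].
all: rewrite /= ?/transport ?fK//.
all: exact: (fo ord0).
Qed.

Lemma integral_process_kernel (D : discrete_space) (v : D) (f : marked_Dstar Xi -> \bar R) :
  measurable_fun setT f -> (forall x, 0 <= f x)%E ->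
  (\int[process_kernel (pointed_class v)]_x f x = \int[Z D]_m f (marked v m))%E.
Proof.
move=> mf f0; rewrite -[RHS](ge0_integral_distribution (marked v : {RV (Z D) >-> _}) mf f0).
by apply: eq_measure_integral => A mA _; exact: process_kernelE.
Qed.

End ProcessKernel.

Section SublevelSets.
Context {R : realType} d (T : measurableType d) (f : T -> R).
Hypothesis mf : measurable_fun setT f.

Lemma measurable_sublevel b : measurable [set x | f x <= b].
Proof.
rewrite (_ : [set x | _] = setT `&` f @^-1` `]-oo, b]); first exact: mf.
by apply/seteqP; split=> x /=; rewrite in_itv/= ?andbT //; case.
Qed.

Lemma measurable_superlevel b : measurable [set x | b <= f x].
Proof.
rewrite (_ : [set x | _] = setT `&` f @^-1` `[b, +oo[); first exact: mf.
by apply/seteqP; split=> x /=; rewrite in_itv/= ?andbT //; case.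
Qed.

Lemma measurable_strict_superlevel b : measurable [set x | b < f x].
Proof.
rewrite (_ : [set x | _] = setT `&` f @^-1` `]b, +oo[); first exact: mf.
by apply/seteqP; split=> x /=; rewrite in_itv/= ?andbT //; case.
Qed.

End SublevelSets.

(** * Ball weights *)

Section BallWeight.
Context {R : realType}.
Local Notation marks := (nonneg_reals R).

Lemma finite_nball (D : discrete_space) (r : R) (v : D) : finite_set (nball r v).
Proof. by apply: sub_finite_set (finite_balls v r) => u []. Qed.

Lemma point_mark_ge0 (X : marked_space marks 0) (v : X) : 0 <= point_mark v.
Proof. exact: (valP (mark v v)). Qed.

(** Summed over the added point it gives [ball_weight], which thereby falls under
    [measurable_esum_add_point]. *)
Definition two_point_weight (r : R) (e : space_of_classes marks 1) : R :=
  if (1 <= r) && (points_dist e <= r) then origin_weight (second_point e) else 0.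

Lemma measurable_origin_weight : measurable_fun setT (@origin_weight R).
Proof. exact: measurable_origin_mark. Qed.

Lemma measurable_two_point_weight r : measurable_fun setT (two_point_weight r).
Proof.
rewrite /two_point_weight; case: (1 <= r) => /=; last exact: measurable_cst.
apply: measurable_fun_ifT => //.
  by apply: measurable_fun_ler; [exact: measurable_points_dist|exact: measurable_cst].
exact: measurableT_comp measurable_origin_weight (@measurable_second_point _ _).
Qed.

Lemma two_point_weight_add r (X : marked_space marks 0) (v : X) :
  two_point_weight r (class_of (add_point v)) =
  if `[< nball r (origin X) v >] then point_mark v else 0.
Proof.
rewrite /two_point_weight points_dist_class_of second_point_add.
rewrite /origin_weight origin_mark_class_of /=.
congr (if _ then _ else _); apply/andP/asboolP; first by move=> [].
by move=> [].
Qed.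

Lemma esum_two_point_weight r (X : marked_space marks 0) :
  (\esum_(v in [set: X]) (two_point_weight r (class_of (add_point v)))%:E =
   (\sum_(v \in nball r (origin X)) point_mark v)%:E)%E.
Proof.
under eq_esum do rewrite two_point_weight_add.
rewrite -fsumEFin; last exact: finite_nball.
rewrite -esum_fset; first last.
- by move=> v _; rewrite lee_fin point_mark_ge0.
- exact: finite_nball.
rewrite [RHS]esum_mkcond; apply: eq_esum => v _.
have [vr|vr] := pselect (nball r (origin X) v).
  by rewrite asboolT// mem_set.
by rewrite asboolF// memNset.
Qed.

Lemma two_point_weight_ge0 r e : 0 <= two_point_weight r e.
Proof. by rewrite /two_point_weight; case: ifP => // _; exact: point_mark_ge0. Qed.

Lemma ball_weight_class_of r (X : marked_space marks 0) :
  ball_weight r (class_of X) = \sum_(v \in nball r (origin X)) point_mark v.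
Proof.
apply: EFin_inj; rewrite -esum_two_point_weight /ball_weight -esum_two_point_weight.
by rewrite (esum_add_point_class_of (fun e => (two_point_weight r e)%:E)).
Qed.

Lemma measurable_ball_weight r : measurable_fun setT (@ball_weight R r).
Proof.
apply/measurable_EFinP.
rewrite (_ : _ \o _ = fun x : marked_Dstar marks => \esum_(v in [set: repr x])
    (two_point_weight r (class_of (add_point v)))%:E)%E.
  apply: (measurable_esum_add_point (g := fun e => (two_point_weight r e)%:E)).
    by apply/measurable_EFinP; exact: measurable_two_point_weight.
  by move=> e; rewrite lee_fin two_point_weight_ge0.
by apply/funext => x; rewrite esum_two_point_weight.
Qed.

Lemma ball_weight_ge0 r (x : marked_Dstar marks) : 0 <= ball_weight r x.
Proof. by apply: fsumr_ge0 => v _; exact: point_mark_ge0. Qed.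

Lemma fsumr_subset (T : choiceType) (A B : set T) (f : T -> R) :
  finite_set B -> A `<=` B -> (forall x, 0 <= f x) ->
  \sum_(x \in A) f x <= \sum_(x \in B) f x.
Proof.
move=> fB AB f0; have fA : finite_set A := sub_finite_set AB fB.
rewrite -lee_fin -!fsumEFin//; apply: lee_fsum_nneg_subset => //.
  exact/subsetP.
by move=> x _; rewrite lee_fin.
Qed.

Lemma ball_weight_marked r (D : discrete_space) (v : D) (m : markings marks D) :
  ball_weight r (marked v m) = \sum_(u \in nball r v) sval (m u u).
Proof. exact: ball_weight_class_of. Qed.

Lemma origin_weight_marked (D : discrete_space) (v : D) (m : markings marks D) :
  origin_weight (marked v m) = sval (m v v).
Proof. exact: origin_mark_class_of. Qed.

Lemma nball_sub (D : discrete_space) (r s : R) (u v : D) :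
  dist u v + r <= s -> nball r v `<=` nball s u.
Proof.
move=> rs w [r1 vw]; have := dist_ge0 u v; have := dist_triangle v u w.
by split; lra.
Qed.

Lemma le_ball_weight r s (x : marked_Dstar marks) :
  r <= s -> ball_weight r x <= ball_weight s x.
Proof.
move=> rs; apply: fsumr_subset; [exact: finite_nball| |exact: point_mark_ge0].
by apply: nball_sub; rewrite distxx add0r.
Qed.

Lemma origin_weight_le_ball r (x : marked_Dstar marks) :
  1 <= r -> origin_weight x <= ball_weight r x.
Proof.
move=> r1.
rewrite (_ : origin_weight x = \sum_(v \in [set origin (repr x)]) point_mark v); last first.
  by rewrite fsbig_set1.
apply: fsumr_subset; [exact: finite_nball| |exact: point_mark_ge0].
by move=> _ ->; split=> //; rewrite distxx; lra.
Qed.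

(* Points of polynomial growth; integer radii make the set a countable
   intersection. *)
Definition poly_growth (a M : R) : set (marked_Dstar marks) :=
  [set x | forall n : nat, (0 < n)%N -> ball_weight n%:R x <= M * n%:R `^ a].

Lemma measurable_poly_growth a M : measurable (poly_growth a M).
Proof.
rewrite (_ : poly_growth a M =
  \bigcap_n (if (0 < n)%N then [set x | ball_weight n%:R x <= M * n%:R `^ a] else setT)).
  apply: bigcapT_measurable => n; case: ifP => // _.
  exact: (measurable_sublevel (@measurable_ball_weight n%:R)).
apply/seteqP; split=> x; first by move=> xP n _; case: ifP => // /xP.
by move=> xP n n0; have := xP n I; rewrite n0.
Qed.

End BallWeight.

(** * The mass distribution principle *)

Section MassTransport.
Context {R : realType}.

Definition swap_points (e : @Dstarstar R) : @Dstarstar R :=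
  class_of (restructure (@rev_ord 2) id (repr e)).

Lemma measurable_swap_points : measurable_fun setT swap_points.
Proof. exact: measurable_restructure. Qed.

Lemma swap_points_bipointed (D : discrete_space) (u v : D) :
  swap_points (class_of (bipointed u v)) = class_of (bipointed v u).
Proof.
rewrite /swap_points restructure_class_of; apply/class_ofP; exists id; split=> //.
  by split=> //; exists id.
by case=> -[|[|//]].
Qed.

Lemma measurable_transport_out (g : @Dstarstar R -> R) :
  measurable_fun setT g -> (forall e, 0 <= g e) ->
  measurable_fun setT (fun c : Dstar => (\esum_(v in [set: repr c])
    (g (class_of (bipointed (origin (repr c)) v)))%:E)%E).
Proof.
move=> mg g0; under eq_fun do under eq_esum do rewrite -add_point_unmarked.
apply: (measurable_esum_add_point (g := EFin \o g)); first exact/measurable_EFinP.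
by move=> e; rewrite lee_fin.
Qed.

Lemma measurable_transport_in (g : @Dstarstar R -> R) :
  measurable_fun setT g -> (forall e, 0 <= g e) ->
  measurable_fun setT (fun c : Dstar => (\esum_(v in [set: repr c])
    (g (class_of (bipointed v (origin (repr c)))))%:E)%E).
Proof.
move=> mg g0; under eq_fun do under eq_esum do rewrite -swap_points_bipointed.
apply: (@measurable_transport_out (g \o swap_points)) => [|e]; last exact: g0.
by apply: measurableT_comp => //; exact: measurable_swap_points.
Qed.

End MassTransport.

Section ReachProbability.
Context {R : realType} (Z : @equivariant_process R (radii R)).

Let K (ct : @Dstar R * R) : {measure set (marked_Dstar (radii R)) -> \bar R} :=
  process_kernel Z ct.1.

Let measurable_K U : measurable U -> measurable_fun setT (K ^~ U).
Proof.
move=> mU; exact: measurableT_comp (measurable_process_kernel Z mU) measurable_fst.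
Qed.

HB.instance Definition _ := isKernel.Build _ _ _ _ R K measurable_K.

Let K_prob x : K x setT = 1%E.
Proof. exact: probability_setT. Qed.

HB.instance Definition _ := Kernel_isProbability.Build _ _ _ _ R K K_prob.

Lemma measurable_origin_radius : measurable_fun setT (@origin_radius R).
Proof. exact: measurable_origin_mark. Qed.

Definition reaches (t : R) : set (marked_Dstar (radii R)) :=
  [set x | 1 <= origin_radius x /\ t <= origin_radius x].

Lemma measurable_reaches t : measurable (reaches t).
Proof.
apply: (@measurableI _ _ [set x | 1 <= origin_radius x] [set x | t <= origin_radius x]).
  exact: (measurable_superlevel measurable_origin_radius).
exact: (measurable_superlevel measurable_origin_radius).
Qed.

(** The conditional probability that the ball around the first point contains the second, as a
    function of the unmarked class, so that it may enter the mass transport formula. *)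
Definition reach_prob (e : @Dstarstar R) : R :=
  fine (process_kernel Z (first_point e) (reaches (points_dist e))).

(** The event moves with the distance of the two points. Carrying this distance as an extra
    coordinate of the kernel's parameter turns the moving event into a section of one fixed product
    set. *)
Lemma measurable_reach_prob : measurable_fun setT reach_prob.
Proof.
apply: measurableT_comp; first exact: fine_measurable.
pose A := [set y : (@Dstar R * R) * marked_Dstar (radii R) | 1 <= origin_radius y.2] `&`
          [set y | 0 <= origin_radius y.2 - y.1.2].
have mr : measurable_fun setT (fun y : (@Dstar R * R) * marked_Dstar (radii R) => origin_radius y.2).
  exact: measurableT_comp measurable_origin_radius measurable_snd.
have mA : measurable A.
  apply: measurableI; first exact: (measurable_superlevel mr).
  apply: (@measurable_superlevel _ _ _ 
    (fun y : (@Dstar R * R) * marked_Dstar (radii R) => origin_radius y.2 - y.1.2)).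
  apply: measurable_funB => //; exact: measurableT_comp measurable_snd measurable_fst.
have := @measurable_fun_xsection_finite_kernel _ _ _ _ R K A (mem_set mA).
move=> mKA.
rewrite (_ : (fun e => _) = (fun ct => K ct (xsection A ct)) \o
    (fun e : @Dstarstar R => (first_point e, points_dist e))).
  apply: measurableT_comp mKA _; apply/measurable_fun_pair.
    exact: measurable_first_point.
  exact: measurable_points_dist.
apply/funext => e; rewrite /= /K /=; congr (process_kernel _ _ _).
apply/seteqP; split=> x; rewrite /xsection /A /= inE /= subr_ge0 //.
Qed.

Lemma reach_prob_ge0 e : 0 <= reach_prob e.
Proof. exact/fine_ge0/measure_ge0. Qed.

Lemma reach_probE (D : discrete_space) (u v : D) :
  (reach_prob (class_of (bipointed u v)))%:E =
  Z D [set m | nball (sval (m u u)) u v].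
Proof.
rewrite /reach_prob fineK ?fin_num_measure//; last exact: measurable_reaches.
rewrite first_point_bipointed points_dist_bipointed process_kernelE; last exact: measurable_reaches.
congr (Z D _); apply/seteqP; split=> m;
  by rewrite /reaches /= /origin_radius origin_mark_class_of.
Qed.

Lemma measurable_nball_event (D : discrete_space) (u v : D) :
  measurable ([set m | nball (sval (m u u)) u v] : set (markings (radii R) D)).
Proof.
rewrite (_ : [set m | _] = marked u @^-1` (reaches (dist u v))).
  rewrite -[X in measurable X]setTI.
  by apply: measurable_marked => //; exact: measurable_reaches.
by apply/seteqP; split=> m;
  rewrite /reaches /= /origin_radius origin_mark_class_of.
Qed.

End ReachProbability.

Section Covers.
Context {R : realType}.

Lemma covers_marked (D : discrete_space) (o : D) (m : markings (radii R) D) :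
  covers (marked o m) <-> forall u, exists v, nball (sval (m v v)) v u.
Proof.
have [f [[[g fK gK] fd] _ fm]] :=
  repr_class_of (@MarkedSpace R (radii R) 0 D (fun=> o) m).
have nballE u v : nball (point_mark (f v)) (f v) (f u) <-> nball (sval (m v v)) v u.
  by rewrite /nball/= fd /point_mark fm.
rewrite /covers; split=> [cov u|cov].
  have : [set: repr (marked o m)] (f u) by [].
  rewrite -cov => -[v _]; rewrite -(gK v) => /nballE; by exists (g v).
apply/seteqP; split=> // u _; have [v] := cov (g u).
by move=> /nballE; rewrite gK => ?; exists (f v).
Qed.

Lemma radius_pow_ge0 (r a : R) : 0 <= radius_pow r a.
Proof. by rewrite /radius_pow; case: ifP => // _; exact: powR_ge0. Qed.

Lemma measurable_radius_pow (a : R) :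
  measurable_fun setT (fun x : marked_Dstar (radii R) => radius_pow (origin_radius x) a).
Proof.
apply: measurable_fun_ifT.
- apply: measurable_fun_eqr; [exact: measurable_origin_radius|exact: measurable_cst].
- exact: measurable_cst.
- exact: (measurableT_comp (measurable_powR a) (@measurable_origin_radius R)).
Qed.

Lemma origin_radius_marked (D : discrete_space) (v : D) (m : markings (radii R) D) :
  origin_radius (marked v m) = sval (m v v).
Proof. exact: origin_mark_class_of. Qed.

End Covers.

Section MassDistribution.
Context {R : realType} (mu : probability (@Dstar R) R).
Variables (w : equivariant_process (nonneg_reals R)) (a M : R).
Hypotheses (a0 : 0 <= a) (M0 : 0 <= M).

Definition truncated_weight (x : marked_Dstar (nonneg_reals R)) : R :=
  origin_weight x * \1_(poly_growth a M) x.

Lemma truncated_weight_ge0 x : 0 <= truncated_weight x.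
Proof. by apply: mulr_ge0 => //; exact: point_mark_ge0. Qed.

(** The case [n = 1] of [poly_growth], since the origin belongs to its ball of radius 1. Conditional
    means of the truncated weight are thus finite, and [fine] loses nothing in [mean_weight]. *)
Lemma truncated_weight_le x : truncated_weight x <= M.
Proof.
rewrite /truncated_weight indicE.
have [/set_mem xA|_] := boolP (x \in _); last by rewrite mulr0.
rewrite mulr1; apply: le_trans (origin_weight_le_ball x (lexx 1)) _.
by have := xA 1%N isT; rewrite powR1 mulr1.
Qed.

Lemma measurable_truncated_weight : measurable_fun setT truncated_weight.
Proof.
apply: measurable_funM; first exact: measurable_origin_weight.
by apply: measurable_indic; exact: measurable_poly_growth.
Qed.

Definition mean_weight (c : @Dstar R) : R :=
  fine (\int[process_kernel w c]_x (truncated_weight x)%:E)%E.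

Let mF : measurable_fun setT (EFin \o truncated_weight).
Proof. by apply/measurable_EFinP; exact: measurable_truncated_weight. Qed.

Lemma mean_weightE c :
  (mean_weight c)%:E = (\int[process_kernel w c]_x (truncated_weight x)%:E)%E.
Proof.
rewrite /mean_weight fineK// ge0_fin_numE; last first.
  by apply: integral_ge0 => x _; rewrite lee_fin truncated_weight_ge0.
apply: (@le_lt_trans _ _ (\int[process_kernel w c]_x (cst M%:E) x)%E).
  apply: ge0_le_integral => //; first by move=> x _; rewrite lee_fin truncated_weight_ge0.
  by move=> x _; rewrite lee_fin truncated_weight_le.
by rewrite integral_cst// [X in (_ * X)%E]probability_setT mule1 ltry.
Qed.

Lemma mean_weight_ge0 c : 0 <= mean_weight c.
Proof.
rewrite -lee_fin mean_weightE; apply: integral_ge0 => x _.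
by rewrite lee_fin truncated_weight_ge0.
Qed.

Lemma measurable_mean_weight : measurable_fun setT mean_weight.
Proof.
apply: measurableT_comp; first exact: fine_measurable.
apply: measurable_integral_process_kernel => // x.
by rewrite lee_fin truncated_weight_ge0.
Qed.

Lemma mean_weight_pointed (D : discrete_space) (v : D) :
  (mean_weight (pointed_class v))%:E = (\int[w D]_m (truncated_weight (marked v m))%:E)%E.
Proof.
rewrite mean_weightE integral_process_kernel// => x.
by rewrite lee_fin truncated_weight_ge0.
Qed.

(* A ball which contains a point of poly_growth is contained in a ball around it
   of comparable radius. *)
Lemma truncated_weight_ball (D : discrete_space) (u : D) (r : R)
    (m : markings (nonneg_reals R) D) : 1 <= r ->
  \sum_(v \in nball r u) truncated_weight (marked v m) <= M * 3 `^ a * r `^ a.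
Proof.
move=> r1.
have [[v [uv vA]]|noA] := pselect (exists v, nball r u v /\ poly_growth a M (marked v m)); last first.
  rewrite fsbig1.
    by rewrite !mulr_ge0// powR_ge0.
  move=> v uv; rewrite /truncated_weight indicE memNset ?mulr0// => vA.
  by apply: noA; exists v.
(* The ball of radius [r] around [u] lies in the ball of radius [2 * r] around [v]; the next integer
   is at most [2 * r + 1 <= 3 * r]. *)
pose n := (Num.truncn (2 * r)).+1.
have rn : 2 * r <= n%:R by apply: ltW; rewrite truncnS_gt.
have n3 : n%:R <= 3 * r.
  rewrite /n -[X in X <= _]natr1; have : (Num.truncn (2 * r))%:R <= 2 * r.
    by rewrite truncn_le//; lra.
  lra.
apply: (@le_trans _ _ (\sum_(v \in nball r u) sval (m v v))).
  rewrite -lee_fin -!fsumEFin; [|exact: finite_nball|exact: finite_nball].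
  apply: lee_fsum; first exact: finite_nball.
  move=> z _; rewrite lee_fin /truncated_weight origin_weight_marked indicE.
  by rewrite ler_piMr//; [exact: (valP (m z z))|case: (_ \in _)].
apply: (@le_trans _ _ (ball_weight n%:R (marked v m))).
  rewrite ball_weight_marked; apply: fsumr_subset; first exact: finite_nball.
    by apply: nball_sub; case: uv => _; rewrite (dist_sym v u); lra.
  by move=> z; exact: (valP (m z z)).
apply: (le_trans (vA n isT)).
rewrite -mulrA -powRM//; last lra.
by rewrite ler_wpM2l// ge0_ler_powR// nnegrE; lra.
Qed.

Lemma mean_weight_ball (D : discrete_space) (u : D) (r : R) : 1 <= r ->
  \sum_(v \in nball r u) mean_weight (pointed_class v) <= M * 3 `^ a * r `^ a.
Proof.
move=> r1; rewrite -lee_fin -fsumEFin; last exact: finite_nball.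
under eq_fsbigr do rewrite mean_weight_pointed.
rewrite -ge0_integral_fsum//; first last.
- exact: finite_nball.
- by move=> v m _; rewrite lee_fin truncated_weight_ge0.
- by move=> v; apply: measurableT_comp mF _; exact: measurable_marked.
apply: (@le_trans _ _ (\int[w D]_m (cst (M * 3 `^ a * r `^ a)%:E) m)%E).
  apply: ge0_le_integral => //.
  - move=> m _; apply: fsume_ge0 => v _; rewrite lee_fin.
    exact: truncated_weight_ge0.
  - apply: emeasurable_fsum; first exact: finite_nball.
    by move=> v; apply: measurableT_comp mF _; exact: measurable_marked.
  - move=> m _; rewrite fsumEFin; last exact: finite_nball.
    by rewrite lee_fin truncated_weight_ball.
by rewrite integral_cst// [X in (_ * X)%E]probability_setT mule1.
Qed.

End MassDistribution.

Lemma ge0_integral_eq0_ae {R : realType} d (T : measurableType d)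
    (mu : {measure set T -> \bar R}) (f : T -> \bar R) :
  measurable_fun setT f -> (forall x, 0 <= f x)%E ->
  (\int[mu]_x f x = 0)%E <-> \forall x \ae mu, f x = 0%E.
Proof.
move=> mf f0; have := ae_eq_integral_abs mu measurableT mf.
rewrite (_ : (\int[mu]_(x in setT) `|f x| = \int[mu]_x f x)%E); last first.
  by apply: eq_integral => x _; rewrite gee0_abs.
move=> H; split=> [/H|fae]; first by apply: filterS => x; exact.
by apply/H; apply: filterS fae.
Qed.

Section MassDistributionPrinciple.
Context {R : realType} (mu : probability (@Dstar R) R).

Lemma ae_process_kernel (Xi : polishType R) (Z : @equivariant_process R Xi)
    (Q : marked_Dstar Xi -> Prop) :
  (\forall x \ae marked_law mu Z, Q x) ->
  \forall c \ae mu, \forall x \ae process_kernel Z c, Q x.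
Proof.
move=> [N [mN N0 NQ]].
have int0 : (\int[mu]_c process_kernel Z c N = 0)%E by exact: N0.
move: int0 => /ge0_integral_eq0_ae => /(_ (measurable_process_kernel Z mN))/(_ (fun c => measure_ge0 _ N)).
by apply: filterS => c cN; exists N.
Qed.

Lemma ae_process (Xi : polishType R) (Z : @equivariant_process R Xi) (c : Dstar)
    (Q : marked_Dstar Xi -> Prop) :
  (\forall x \ae process_kernel Z c, Q x) ->
  \forall m \ae Z (repr c), Q (marked (origin (repr c)) m).
Proof.
move=> [N [mN N0 NQ]]; exists (marked (origin (repr c)) @^-1` N); split=> //.
  by rewrite -[X in measurable X]setTI; exact: measurable_marked.
by move=> m /= mQ; apply: NQ.
Qed.

Lemma bigcup_points (D : @discrete_space R) (T : Type) (o : D) (E : D -> set T) :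
  \bigcup_v E v = \bigcup_n \big[setU/set0]_(v <- fset_set (oball (@unmarked R D o) n%:R)) E v.
Proof.
apply/seteqP; split=> x [v _ vx].
  exists (Num.truncn (dist o v)).+1 => //.
  rewrite bigsetU_fset_set; last exact: finite_oball.
  by exists v => //; rewrite /oball /= truncnS_gt.
move: vx; rewrite bigsetU_fset_set; last exact: finite_oball.
by move=> [u _ ux]; exists u.
Qed.

Lemma measurable_bigcup_points (D : @discrete_space R) d (T : measurableType d)
    (o : D) (E : D -> set T) :
  (forall v, measurable (E v)) -> measurable (\bigcup_v E v).
Proof.
move=> mE; rewrite (bigcup_points o); apply: bigcup_measurable => n _.
exact: bigsetU_measurable.
Qed.

(** Union bound over the points; the root [o] only provides the exhaustion of [D] by finite
    balls. *)
Lemma measure_union_points (D : @discrete_space R) d (T : measurableType d)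
    (P : {measure set T -> \bar R}) (o : D) (E : D -> set T) :
  (forall v, measurable (E v)) ->
  (P (\bigcup_v E v) <= \esum_(v in [set: D]) P (E v))%E.
Proof.
move=> mE; pose X := @unmarked R D o.
pose F (n : nat) : set T := \big[setU/set0]_(v <- fset_set (oball X n%:R)) E v.
have FE (n : nat) : F n = \bigcup_(v in oball X n%:R) E v.
  by rewrite /F bigsetU_fset_set//; exact: finite_oball.
have mF n : measurable (F n) by apply: bigsetU_measurable.
rewrite (bigcup_points o) -/F.
have cvgF : (P (F n) @[n --> \oo] --> P (\bigcup_n F n))%E.
  apply: nondecreasing_cvg_mu => //; first exact: bigcup_measurable.
  move=> m n mn; apply/subsetPset; rewrite !FE => x [v vm vx]; exists v => //.
  by move: vm; rewrite /oball /= => vm; apply: lt_le_trans vm _; rewrite ler_nat.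
rewrite -(cvg_lim _ cvgF)//; apply: lime_le; first exact/cvgP/cvgF.
apply: nearW => n.
apply: (@le_trans _ _ (\sum_(v <- fset_set (oball X n%:R)) P (E v))%E).
  rewrite /F; elim: (enum_fset _) => [|v s IH]; first by rewrite !big_nil measure0.
  rewrite !big_cons; apply: le_trans (leeD2l _ IH).
  by apply: measureU2 => //; exact: bigsetU_measurable.
by rewrite fsbig_oball_esum//; exact: le_esum_subset.
Qed.

Lemma mass_distribution_principle (mu_unimodular : unimodular mu)
    (w : equivariant_process (nonneg_reals R)) (a M : R)
    (Z : equivariant_process (radii R)) :
  0 <= a -> 0 <= M -> equivariant_covering mu Z ->
  (\int[marked_law mu w]_x (truncated_weight a M x)%:E <=
   (M * 3 `^ a)%:E *
   \int[marked_law mu Z]_x (radius_pow (origin_radius x) a)%:E)%E.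
Proof.
move=> a0 M0 covZ.
have mF : measurable_fun setT (EFin \o truncated_weight a M).
  by apply/measurable_EFinP; exact: measurable_truncated_weight.
pose f := mean_weight w a M.
have f0 c : 0 <= f c by exact: mean_weight_ge0.
have mf : measurable_fun setT f by exact: measurable_mean_weight.
(* The weight enters through the second point, the covering through the first. Each is averaged
   separately, which leaves a function of the unmarked class. *)
pose g (e : Dstarstar) := f (second_point e) * reach_prob Z e.
have g0 e : 0 <= g e by rewrite mulr_ge0// reach_prob_ge0.
have mg : measurable_fun setT g.
  apply: measurable_funM; last exact: measurable_reach_prob.
  exact: measurableT_comp mf (@measurable_second_point _ _).
have gE (D : @discrete_space R) (u v : D) : (g (class_of (bipointed u v)))%:E =
    ((f (pointed_class v))%:E * Z D [set m | nball (sval (m u u)) u v])%E.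
  by rewrite /g second_point_bipointed EFinM reach_probE.
have mr : measurable_fun setT (fun x : marked_Dstar (radii R) =>
    (radius_pow (origin_radius x) a)%:E).
  by apply/measurable_EFinP; exact: measurable_radius_pow.
rewrite integral_marked_law//; last by move=> x; rewrite lee_fin truncated_weight_ge0.
under eq_integral do rewrite -mean_weightE// -/f.
(* The sum is [f c] times the expected number of balls which contain [o], at least 1 because the
   balls cover almost surely. *)
apply: (@le_trans _ _ (\int[mu]_c \esum_(v in [set: repr c])
    (g (class_of (bipointed v (origin (repr c)))))%:E)%E).
  apply: ae_ge0_le_integral => //.
  - by move=> c _; rewrite lee_fin.
  - exact/measurable_EFinP.
  - by move=> c _; apply: esum_ge0 => v _; rewrite lee_fin.
  - exact: measurable_transport_in.
  move/ae_process_kernel : covZ; apply: filterS => c /ae_process[N [mN N0 NQ]] _.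
  set o := origin (repr c).
  under eq_esum do rewrite gE pointed_class_repr.
  pose E v : set (markings (radii R) (repr c)) :=
    [set m : markings (radii R) (repr c) | nball (sval (m v v)) v o].
  have mE v : measurable (E v) by exact: measurable_nball_event.
  (* The factor [f c] is put into the measure, so that the union bound yields the sum in the
     required form. *)
  pose P : {measure set _ -> \bar R} := mscale (NngNum (f0 c)) (Z (repr c)).
  have PE B : P B = ((f c)%:E * Z (repr c) B)%E by [].
  apply: le_trans (measure_union_points P o mE).
  rewrite -[leRHS]add0e -[X in (X + _)%E](_ : P N = 0%E); last first.
    by rewrite PE N0 mule0.
  have mU := measurable_bigcup_points o mE.
  apply: le_trans (measureU2 _ mN mU).
  rewrite (_ : N `|` _ = setT); last first.
    apply/seteqP; split=> // m _.
    have [/covers_marked/(_ o)[v vo]|mc] := pselect (covers (marked o m)).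
      by right; exists v.
    by left; apply: NQ.
  suff : ((f c)%:E <= (f c)%:E * Z (repr c) setT)%E by [].
  by rewrite probability_setT mule1.
(* After the exchange the sum runs over the points in the ball of the origin, whose total mean
   weight is bounded by [mean_weight_ball]. *)
rewrite -mu_unimodular//.
rewrite integral_marked_law//; last by move=> x; rewrite lee_fin radius_pow_ge0.
rewrite -ge0_integralZl//; first last.
- by rewrite lee_fin mulr_ge0// powR_ge0.
- by move=> c _; apply: integral_ge0 => x _; rewrite lee_fin radius_pow_ge0.
- by apply: measurable_integral_process_kernel => // x; rewrite lee_fin radius_pow_ge0.
apply: ge0_le_integral => //.
- by move=> c _; apply: esum_ge0 => v _; rewrite lee_fin.
- exact: measurable_transport_out.
- apply: emeasurable_funM => //.
  by apply: measurable_integral_process_kernel => // x; rewrite lee_fin radius_pow_ge0.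
move=> c _; set o := origin (repr c).
apply: ge_ereal_sup => _ /= [A [finA _] <-].
under eq_fsbigr do rewrite gE.
pose E v : set (markings (radii R) (repr c)) :=
  [set m : markings (radii R) (repr c) | nball (sval (m o o)) o v].
have mE v : measurable (E v) by exact: measurable_nball_event.
have -> : (\int[process_kernel Z c]_x (radius_pow (origin_radius x) a)%:E =
    \int[Z (repr c)]_m (radius_pow (origin_radius (marked o m)) a)%:E)%E.
  apply: (ge0_integral_distribution (marked o : {RV (Z (repr c)) >-> _}) mr) => x.
  by rewrite lee_fin radius_pow_ge0.
have mrm : measurable_fun setT (fun m : markings (radii R) (repr c) =>
    (radius_pow (origin_radius (marked o m)) a)%:E).
  exact: measurableT_comp mr (measurable_marked o).
have mfE v : measurable_fun setT (fun m : markings (radii R) (repr c) =>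
    (f (pointed_class v) * \1_(E v) m)%:E).
  by apply/measurable_EFinP/measurable_funM => //; exact: measurable_indic.
rewrite (eq_fsbigr (fun v => \int[Z (repr c)]_m (f (pointed_class v) * \1_(E v) m)%:E)%E); last first.
  move=> v _; under [RHS]eq_integral do rewrite EFinM.
  rewrite ge0_integralZl//; first by rewrite integral_indic// setIT.
  - by apply/measurable_EFinP; exact: measurable_indic.
  - by rewrite lee_fin.
rewrite -ge0_integral_fsum//; last by move=> v m _; rewrite lee_fin mulr_ge0.
rewrite -ge0_integralZl//; first last.
- by rewrite lee_fin mulr_ge0// powR_ge0.
- by move=> m _; rewrite lee_fin radius_pow_ge0.
apply: ge0_le_integral => //.
- by move=> m _; apply: fsume_ge0 => v _; rewrite lee_fin mulr_ge0.
- exact: emeasurable_fsum.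
- by apply: emeasurable_funM.
move=> m _; rewrite fsumEFin// -EFinM lee_fin origin_radius_marked.
set r := sval (m o o).
(* A radius below 1 has an empty ball, so the sum vanishes. *)
have [r1|r1] := leP 1 r; last first.
  rewrite fsbig1 ?mulr_ge0 ?powR_ge0 ?radius_pow_ge0// => v _.
  by rewrite indicE memNset ?mulr0// => -[]; rewrite -/r leNgt r1.
rewrite /radius_pow gt_eqF; last lra.
apply: le_trans (mean_weight_ball w a0 M0 o r1).
rewrite (_ : \sum_(v \in A) _ = \sum_(v \in A `&` nball r o) f (pointed_class v)).
  apply: fsumr_subset => //; first exact: finite_nball.
rewrite fsbig_mkcondr; apply: eq_fsbigr => v _.
rewrite indicE (_ : (m \in E v) = (v \in nball r o)); last first.
  by apply/idP/idP => /set_mem ?; exact/mem_set.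
by rewrite /patch; case: (v \in nball r o); rewrite ?mulr1 ?mulr0.
Qed.

End MassDistributionPrinciple.

(** * Growth rates and the upper bounds *)

Section Growth.
Context {R : realType}.
Implicit Types (f : R -> \bar R) (y : \bar R) (a b c r : R).

Lemma ereal_between (x y : \bar R) : (x < y)%E ->
  exists r, (x < r%:E)%E /\ (r%:E < y)%E.
Proof.
case: x y => [x| |] [y| |] //=; rewrite ?lte_fin => xy.
- by exists ((x + y) / 2); rewrite !lte_fin; split; lra.
- by exists (x + 1); rewrite lte_fin ltry ltrDl.
- by exists (y - 1); rewrite lte_fin ltNyr gtrBl.
- by exists 0; rewrite ltNyr ltry.
Qed.

(** Turns growth rates into power bounds, as [ln r] is positive; infinite logarithms, at [y <= 0]
    and [y = +oo], obey the same rule. *)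
Lemma growth_ratio_le r y b : 1 < r ->
  (lne y * ((ln r)^-1)%:E <= b%:E)%E = (y <= (r `^ b)%:E)%E.
Proof.
move=> r1; have lnr : 0 < ln r by rewrite ln_gt0.
have lnrV : 0 < (ln r)^-1 by rewrite invr_gt0.
have r0 : 0 < r by lra.
have rb : 0 < r `^ b by exact: powR_gt0.
case: y => [y| |].
- have [y0|y0] := leP y 0.
    rewrite le0_lneNy ?lee_fin// mulNyr gtr0_sg// mul1e leNye; apply/esym.
    exact: le_trans y0 (ltW rb).
  rewrite lne_EFin// -EFinM !lee_fin ler_pdivrMr// -ln_powR ler_ln//.
- rewrite (_ : lne +oo = +oo)%E// mulyr gtr0_sg// mul1e; apply/idP/idP => //.
- by rewrite le0_lneNy ?leNye// mulNyr gtr0_sg// mul1e leNye.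
Qed.

Lemma upper_growth_lt f b : (upper_growth f < b%:E)%E ->
  exists2 r0, 1 < r0 & forall r, r0 <= r -> (f r <= (r `^ b)%:E)%E.
Proof.
rewrite /upper_growth limf_esupE => /ereal_inf_lt[_ [V [V0 [_ VP]] <-]] Vb.
exists (Num.max 2 (V0 + 1)); first by rewrite lt_max ltr1n.
move=> r; rewrite ge_max => /andP[r2 rV].
rewrite -growth_ratio_le; last lra.
apply: ltW; apply: le_lt_trans Vb.
by apply: ereal_sup_ubound; exists r => //; apply: VP; lra.
Qed.

Lemma lower_growth_gt f b : (b%:E < lower_growth f)%E ->
  exists2 r0, 1 < r0 & forall r, r0 <= r -> ((r `^ b)%:E <= f r)%E.
Proof.
rewrite /lower_growth /limf_einf limf_esupE lteNr.
move=> /ereal_inf_lt[_ [V [V0 [_ VP]] <-]] Vb.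
exists (Num.max 2 (V0 + 1)); first by rewrite lt_max ltr1n.
move=> r; rewrite ge_max => /andP[r2 rV].
apply: ltW; rewrite ltNge -growth_ratio_le; last lra.
rewrite -ltNge -lteN2; apply: le_lt_trans Vb.
by apply: ereal_sup_ubound; exists r => //; apply: VP; lra.
Qed.

Lemma upper_growth_le f a c r0 : 0 < c ->
  (forall r, r0 <= r -> (f r <= (c * r `^ a)%:E)%E) -> (upper_growth f <= a%:E)%E.
Proof.
move=> c0 fc; apply/lee_addgt0Pr => e e0.
(* Beyond [expR (ln c / e)] the constant [c] is at most [r ^ e] and is absorbed in the exponent. *)
pose r1 := Num.max r0 (Num.max 2 (expR (ln c / e))).
apply: (@le_trans _ _ (ereal_sup ((fun r => lne (f r) * ((ln r)^-1)%:E)%E @` [set r | r1 < r]))).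
  rewrite /upper_growth limf_esupE; apply: ereal_inf_lbound; exists [set r | r1 < r] => //.
  by exists r1; split=> //; exact: num_real.
apply: ge_ereal_sup => _ [r + <-]; rewrite /r1 /= !gt_max => /and3P[r0r r2 rc].
rewrite -EFinD growth_ratio_le; last lra.
apply: (le_trans (fc _ (ltW r0r))); rewrite lee_fin.
rewrite powRD; last by rewrite (gt_eqF (_ : 0 < r)) ?implybT//; lra.
rewrite mulrC ler_wpM2l ?powR_ge0//.
rewrite -(lnK (_ : c \is Num.pos))// -ler_ln ?posrE ?expR_gt0 ?powR_gt0//; last lra.
rewrite expRK ln_powR mulrC -ler_pdivrMr//.
by rewrite -ler_expR lnK ?ltW// posrE; lra.
Qed.

Lemma upper_growth_ge0 f c r0 : 0 < c ->
  (forall r, r0 <= r -> (c%:E <= f r)%E) -> (0 <= upper_growth f)%E.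
Proof.
move=> c0 fc; rewrite leNgt; apply/negP => g0.
have [b gb b0] : exists2 b, (upper_growth f < b%:E)%E & b < 0.
  by have [b [gb]] := ereal_between g0; rewrite lte_fin; exists b.
have [r1 r11 fr] := upper_growth_lt gb.
(* At this radius [b * ln r <= ln c + b < ln c], because [b] is negative; hence [r ^ b < c]. *)
pose r := Num.max r0 (Num.max r1 (expR (ln c / b + 1))).
have rr0 : r0 <= r by rewrite le_max lexx.
have rr1 : r1 <= r by rewrite !le_max lexx orbT.
have := le_trans (fc _ rr0) (fr _ rr1); rewrite lee_fin.
rewrite -ler_ln ?posrE ?powR_gt0//; last lra.
rewrite ln_powR.
have lnr : ln c / b + 1 <= ln r.
  rewrite -ler_expR lnK ?posrE; last lra.
  by rewrite /r !le_max lexx !orbT.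
have : b * ln r <= b * (ln c / b + 1) by rewrite ler_wnM2l// ltW.
rewrite mulrDr mulrCA divff ?lt_eqF// mulr1; lra.
Qed.

End Growth.

Section PolynomialGrowth.
Context {R : realType}.
Local Notation marks := (nonneg_reals R).
Implicit Types (x : marked_Dstar marks) (a b M : R).

Definition some_poly_growth a : set (marked_Dstar marks) :=
  \bigcup_(M : nat) poly_growth a M%:R.

Lemma measurable_some_poly_growth a : measurable (some_poly_growth a).
Proof. by apply: bigcup_measurable => M _; exact: measurable_poly_growth. Qed.

(** By monotonicity a bound at one radius between [n] and [C * n] suffices, at the cost of a factor
    [C ^ a]. This serves for real radii, for a change of root and for dyadic radii alike. *)
Lemma sparse_poly_growth a (x : marked_Dstar marks) (K C : R) : 0 <= a -> 0 <= K -> 0 < C ->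
  (forall n : nat, (0 < n)%N -> exists r, [/\ n%:R <= r, r <= C * n%:R &
     ball_weight r x <= K * r `^ a]) -> some_poly_growth a x.
Proof.
move=> a0 K0 C0 xK.
exists (Num.truncn (K * C `^ a)).+1 => // n n0.
have [r [nr rC xr]] := xK n n0.
have n1 : 1 <= n%:R :> R by rewrite ler1n.
apply: (le_trans (le_ball_weight x nr)); apply: (le_trans xr).
apply: (@le_trans _ _ (K * (C `^ a * n%:R `^ a))).
  rewrite -powRM//; last exact: ltW.
  by rewrite ler_wpM2l// ge0_ler_powR// nnegrE ?mulr_ge0//; lra.
rewrite mulrA ler_wpM2r ?powR_ge0//.
by apply: ltW; rewrite truncnS_gt.
Qed.

Lemma some_poly_growth_le a x : 0 <= a -> some_poly_growth a x ->
  (upper_growth (fun r => (ball_weight r x)%:E) <= a%:E)%E.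
Proof.
move=> a0 [M _ xM].
apply: (@upper_growth_le _ _ _ (M%:R * 2 `^ a + 1) 1).
  by rewrite ltr_wpDl// mulr_ge0// powR_ge0.
move=> r r1; rewrite lee_fin.
pose n := (Num.truncn r).+1.
have rn : r <= n%:R by apply: ltW; rewrite truncnS_gt.
have nr : n%:R <= 2 * r.
  rewrite /n -[X in X <= _]natr1; have : (Num.truncn r)%:R <= r by rewrite truncn_le; lra.
  lra.
apply: (le_trans (le_ball_weight x rn)); apply: (le_trans (xM n isT)).
apply: (@le_trans _ _ (M%:R * (2 * r) `^ a)).
  by rewrite ler_wpM2l// ge0_ler_powR// nnegrE; lra.
rewrite powRM//; last lra.
by rewrite mulrA mulrDl lerDl mul1r powR_ge0.
Qed.

Lemma upper_growth_lt_poly a x : 0 <= a ->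
  (upper_growth (fun r => (ball_weight r x)%:E) < a%:E)%E -> some_poly_growth a x.
Proof.
move=> a0 /upper_growth_lt[r0 r01 xr].
apply: (@sparse_poly_growth a x 1 r0) => //; first lra.
move=> n n0; have n1 : 1 <= n%:R :> R by rewrite ler1n.
exists (r0 * n%:R); split; rewrite ?mul1r//; first nra.
by rewrite -lee_fin; apply: xr; nra.
Qed.

Lemma poly_growth_move a (D : @discrete_space R) (u v : D) (m : markings marks D) :
  0 <= a -> some_poly_growth a (marked u m) -> some_poly_growth a (marked v m).
Proof.
move=> a0 [M _ uM].
(* For [n >= 1], [C * n] exceeds [dist u v + n], so the ball of radius [n] around [v] lies in the
   ball of radius [k] around [u]; rounding up gives [k <= (C + 1) * n]. *)
pose C := dist u v + 2.
have C1 : 1 <= C by have := dist_ge0 u v; rewrite /C; lra.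
apply: (@sparse_poly_growth a _ (M%:R * (C + 1) `^ a) 1) => //; first by rewrite mulr_ge0// powR_ge0.
move=> n n0; have n1 : 1 <= n%:R :> R by rewrite ler1n.
exists n%:R; rewrite mul1r; split => //.
pose k := (Num.truncn (C * n%:R)).+1.
have Ck : C * n%:R <= k%:R by apply: ltW; rewrite truncnS_gt.
have kC : k%:R <= (C + 1) * n%:R.
  rewrite /k -[X in X <= _]natr1.
  have : (Num.truncn (C * n%:R))%:R <= C * n%:R by rewrite truncn_le; nra.
  nra.
rewrite ball_weight_marked.
apply: (@le_trans _ _ (\sum_(z \in nball k%:R u) sval (m z z))).
  apply: fsumr_subset; first exact: finite_nball.
    by apply: nball_sub; rewrite /C in Ck *; have := dist_ge0 u v; nra.
  by move=> z; exact: (valP (m z z)).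
rewrite -ball_weight_marked; apply: (le_trans (uM k isT)).
rewrite -mulrA -powRM//; last lra.
by rewrite ler_wpM2l// ge0_ler_powR// nnegrE; nra.
Qed.

End PolynomialGrowth.

Section UpperBounds.
Context {R : realType} (mu : probability (@Dstar R) R) (mu_unimodular : unimodular mu).
Variable w : equivariant_process (nonneg_reals R).
Local Notation P := (marked_law mu w).

Lemma hausdorff_content_gt0 (a M : R) : 0 <= a -> 0 <= M ->
  (0 < \int[P]_x (truncated_weight a M x)%:E)%E -> (0 < hausdorff_content a mu)%E.
Proof.
move=> a0 M0; set I := (X in (0 < X)%E) => I0.
have MI : (I <= M%:E)%E.
  apply: (@le_trans _ _ (\int[P]_x (cst M%:E) x)%E).
    apply: ge0_le_integral => //.
    - by move=> x _; rewrite lee_fin truncated_weight_ge0.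
    - by apply/measurable_EFinP; exact: measurable_truncated_weight.
    - by move=> x _; rewrite lee_fin truncated_weight_le.
  by rewrite integral_cst// [X in (_ * X)%E]probability_setT mule1.
have If : I \is a fin_num by rewrite ge0_fin_numE ?(le_lt_trans MI) ?ltry// ltW.
(* The summand 1 makes [C] positive without a separate discussion of [M]. *)
pose C := M * 3 `^ a + 1.
have C0 : 0 < C by rewrite ltr_wpDl// mulr_ge0// powR_ge0.
apply: (@lt_le_trans _ _ (C^-1 * fine I)%:E).
  by rewrite lte_fin mulr_gt0 ?invr_gt0// fine_gt0// I0 (le_lt_trans MI) ?ltry.
apply: le_ereal_inf_tmp => _ [Z covZ <-].
rewrite unlock EFinM fineK// muleC lee_pdivrMr//.
apply: (le_trans (mass_distribution_principle mu_unimodular w a0 M0 covZ)).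
rewrite muleC; apply: lee_wpmul2l.
  by apply: integral_ge0 => x _; rewrite lee_fin radius_pow_ge0.
by rewrite lee_fin lerDl.
Qed.

(** Radii are 0 or at least 1: [radius_pow] vanishes at 0 for every exponent, and powers of a number
    at least 1 increase with the exponent. One exponent of positive content therefore bounds the
    dimension. *)
Lemma le_hausdorff_content (a b : R) : a <= b ->
  (hausdorff_content a mu <= hausdorff_content b mu)%E.
Proof.
move=> ab; apply: le_ereal_inf_tmp => _ [Z covZ <-].
apply: (@le_trans _ _ ('E_(marked_law mu Z)[fun x => radius_pow (origin_radius x) a])%E).
  by apply: ereal_inf_lbound; exists Z.
rewrite unlock; apply: ge0_le_integral => //.
- by move=> x _; rewrite lee_fin radius_pow_ge0.
- by apply/measurable_EFinP; exact: measurable_radius_pow.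
- by apply/measurable_EFinP; exact: measurable_radius_pow.
move=> x _; rewrite lee_fin /radius_pow; case: ifPn => // x0.
have := valP (mark (origin (repr x)) (origin (repr x))).
rewrite -[\val _]/(origin_radius x) (negbTE x0) /= => x1.
exact: ler_powR.
Qed.

Lemma udim_H_le (a : R) : 0 <= a -> (0 < hausdorff_content a mu)%E ->
  (udim_H mu <= a%:E)%E.
Proof.
move=> a0 Ha; rewrite /udim_H ge_max lee_fin a0 /=.
apply: ge_ereal_sup => _ [b [b0 Hb] <-]; rewrite lee_fin leNgt; apply/negP => ab.
by have := le_hausdorff_content (ltW ab); rewrite Hb leNgt Ha.
Qed.

(** If the truncated weight had mean zero for every integer [M], countably many null sets would make
    the weight of the root vanish almost surely on [some_poly_growth a]. *)
Lemma udim_H_le_growth (a : R) : 0 <= a ->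
  ~ (\forall x \ae P, some_poly_growth a x -> origin_weight x = 0) ->
  (udim_H mu <= a%:E)%E.
Proof.
move=> a0 nae; apply: udim_H_le => //.
have mT M : measurable_fun setT (fun x => (truncated_weight a M x)%:E).
  by apply/measurable_EFinP; exact: measurable_truncated_weight.
have T0 M x : (0 <= (truncated_weight a M x)%:E :> \bar R)%E.
  by rewrite lee_fin truncated_weight_ge0.
have [[M MI]|all0] := pselect (exists M : nat, (0 < \int[P]_x (truncated_weight a M%:R x)%:E)%E).
  exact: hausdorff_content_gt0 MI.
exfalso; apply: nae.
have /ae_foralln : forall M : nat, \forall x \ae P, truncated_weight a M%:R x = 0.
  move=> M.
  have /(ge0_integral_eq0_ae P (mT _) (T0 _)) : (\int[P]_x (truncated_weight a M%:R x)%:E = 0)%E.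
    apply/eqP; rewrite eq_le integral_ge0 ?andbT//.
    by rewrite leNgt; apply/negP => h; apply: all0; exists M.
  by apply: filterS => x [].
apply: filterS => x xM [M _ xMg]; have := xM M.
by rewrite /truncated_weight indicE mem_set// mulr1.
Qed.

End UpperBounds.

(** * From the root to all points *)

Section Root.
Context {R : realType} (mu : probability (@Dstar R) R) (mu_unimodular : unimodular mu).
Variable w : equivariant_process (nonneg_reals R).
Local Notation P := (marked_law mu w).

Lemma nonzero_weight_ball (x : marked_Dstar (nonneg_reals R)) :
  nonzero_weight x <-> exists n : nat, 0 < ball_weight n%:R x.
Proof.
split=> [[v v0]|[n xn]].
  pose n := (Num.truncn (dist (origin (repr x)) v)).+1.
  exists n; apply: (lt_le_trans v0).
  rewrite (_ : point_mark v = \sum_(u \in [set v]) point_mark u); last by rewrite fsbig_set1.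
  apply: fsumr_subset; [exact: finite_nball| |exact: point_mark_ge0].
  move=> _ ->; split; first by rewrite ler1n.
  by apply: ltW; rewrite truncnS_gt.
apply: contrapT => nv; move: xn; rewrite /ball_weight fsbig1 ?ltxx// => v _.
apply/eqP; rewrite eq_le point_mark_ge0 andbT leNgt.
by apply/negP => v0; apply: nv; exists v.
Qed.

Lemma measurable_nonzero_weight :
  measurable [set x : marked_Dstar (nonneg_reals R) | nonzero_weight x].
Proof.
rewrite (_ : [set x | _] = \bigcup_(n : nat) [set x | 0 < ball_weight n%:R x]).
  apply: bigcup_measurable => n _.
  exact: (measurable_strict_superlevel (@measurable_ball_weight _ n%:R)).
by apply/seteqP; split=> x; [move=> /nonzero_weight_ball[n]; exists n|
  move=> [n _ xn]; apply/nonzero_weight_ball; exists n].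
Qed.

(* What almost surely does not happen at the root happens nowhere. *)
Lemma ae_no_poly_growth (a : R) : 0 <= a ->
  (\forall x \ae P, some_poly_growth a x -> origin_weight x = 0) ->
  \forall x \ae P, nonzero_weight x -> ~ some_poly_growth a x.
Proof.
move=> a0 aeB.
pose K := some_poly_growth a `&` [set x : marked_Dstar (nonneg_reals R) | 0 < origin_weight x].
have mK : measurable K.
  apply: measurableI; first exact: measurable_some_poly_growth.
  exact: (measurable_strict_superlevel (@measurable_origin_weight R)).
pose h c := fine (process_kernel w c K).
have hE c : (h c)%:E = process_kernel w c K by rewrite fineK// fin_num_measure.
have mh : measurable_fun setT h.
  by apply: measurableT_comp; [exact: fine_measurable|exact: measurable_process_kernel].
have h0 c : 0 <= h c by exact/fine_ge0/measure_ge0.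
(* As [g] depends on its second point only, the incoming sum repeats the value at the root, which is
   almost surely zero. Unimodularity then annihilates the outgoing sum, which runs over all points
   of the space. *)
pose g (e : @Dstarstar R) := h (second_point e).
have mg : measurable_fun setT g.
  exact: measurableT_comp mh (@measurable_second_point _ _).
have g0 e : 0 <= g e by exact: h0.
have PK : P K = 0%E.
  apply/negligibleP => //; apply: negligibleS aeB => x [xB x0] /= /(_ xB) x00.
  by move: x0; rewrite /= x00 ltxx.
have hae : \forall c \ae mu, (h c)%:E = 0%E.
  apply/ge0_integral_eq0_ae; [exact/measurable_EFinP| |].
    by move=> c; rewrite lee_fin.
  by rewrite -[RHS]PK; apply: eq_integral => c _; rewrite hE.
have /(ge0_integral_eq0_ae mu (measurable_transport_out mg g0)) esum0 :
    ((\int[mu]_c \esum_(v in [set: repr c])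
      (g (class_of (bipointed (origin (repr c)) v)))%:E) = 0)%E.
  rewrite mu_unimodular//.
  apply/(ge0_integral_eq0_ae mu (measurable_transport_in mg g0)).
    by move=> c; apply: esum_ge0 => v _; rewrite lee_fin.
  apply: filterS hae => c c0; apply: esum1 => v _.
  by rewrite /g second_point_bipointed pointed_class_repr.
have {}esum0 := esum0 (fun c => esum_ge0 (fun v _ => lee_tofin (g0 _))).
pose N := [set x : marked_Dstar (nonneg_reals R) | nonzero_weight x] `&` some_poly_growth a.
have mN : measurable N.
  by apply: measurableI; [exact: measurable_nonzero_weight|exact: measurable_some_poly_growth].
exists N; split => //; last first.
  by move=> x /= /not_implyP[xw /contrapT xB].
rewrite [P N](_ : _ = \int[mu]_c process_kernel w c N)%E//.
apply/(ge0_integral_eq0_ae mu (measurable_process_kernel w mN)) => //.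
apply: filterS esum0 => c; set o := origin (repr c) => c0.
pose E (v : repr c) := marked v @^-1` K.
have mE v : measurable (E v : set (markings _ (repr c))).
  by rewrite -[X in measurable X]setTI; exact: measurable_marked.
(* On [N] some point [v] has positive weight, and it inherits the polynomial growth of [o]; seen
   from [v] the marking lies in [K], so the union bound over [v] applies. *)
apply/eqP; rewrite eq_le measure_ge0 andbT -c0.
apply: (@le_trans _ _ (w (repr c) (\bigcup_v E v))).
  change (w (repr c) (marked o @^-1` N) <= w (repr c) (\bigcup_v E v))%E.
  apply: le_measure; rewrite ?inE.
  - by rewrite -[X in measurable X]setTI; exact: measurable_marked.
  - have := measurable_bigcup_points o mE; exact.
  move=> m [/= mw mB].
  have [v v0] : exists v : repr c, 0 < sval (m v v).
    move/nonzero_weight_ball : mw => [n]; rewrite ball_weight_marked => n0.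
    apply: contrapT => nv; move: n0; rewrite fsbig1 ?ltxx// => v _.
    apply/eqP; rewrite eq_le [X in _ && X](valP (m v v)) andbT leNgt.
    by apply/negP => v0; apply: nv; exists v.
  exists v => //; split; first exact: poly_growth_move mB.
  by rewrite /= origin_weight_marked.
apply: le_trans (measure_union_points _ o mE) _.
apply: le_esum => v _; rewrite /g second_point_bipointed hE.
by rewrite process_kernelE.
Qed.

End Root.

Section MeanGrowth.
Context {R : realType} (mu : probability (@Dstar R) R).
Variable w : equivariant_process (nonneg_reals R).
Local Notation P := (marked_law mu w).

Lemma powRX (x c : R) n : 0 <= x -> (x ^+ n) `^ c = (x `^ c) ^+ n.
Proof.
move=> x0; elim: n => [|n IH]; first by rewrite !expr0 powR1.
by rewrite !exprS powRM ?exprn_ge0// IH.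
Qed.

(* Borel-Cantelli along the radii [r0 * 2 ^ n]. *)
Lemma ae_poly_growth (a : R) : 0 <= a ->
  (upper_growth (fun r => 'E_P[ball_weight r])%E < a%:E)%E ->
  \forall x \ae P, some_poly_growth a x.
Proof.
move=> a0 /ereal_between[b [meanb]]; rewrite lte_fin => ba.
have [r0 r01 Er] := upper_growth_lt meanb.
pose s n : R := r0 * 2 ^+ n.
have s0 n : 0 < s n by rewrite mulr_gt0 ?exprn_gt0//; lra.
have r0s n : r0 <= s n by rewrite ler_peMr ?exprn_ege1//; lra.
pose q : R := 2 `^ (b - a).
have q0 : 0 < q by rewrite powR_gt0.
have q1 : q < 1.
  rewrite -(powRr0 2) /q /powR (negbTE (lt0r_neq0 _))// ltr_expR.
  by rewrite mul0r nmulr_rlt0 ?ln_gt0//; lra.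
(* Normalized ball weights; their means are dominated by a geometric series of ratio [q]. Their sum
   is almost surely finite and serves as the constant [K] for all of them. *)
pose u n (x : marked_Dstar (nonneg_reals R)) := (ball_weight (s n) x * s n `^ (- a))%:E.
have u0 n x : (0 <= u n x)%E by rewrite lee_fin mulr_ge0 ?powR_ge0// ball_weight_ge0.
have mu_ n : measurable_fun setT (u n).
  by apply/measurable_EFinP/measurable_funM => //; exact: measurable_ball_weight.
have int_u n : (\int[P]_x u n x <= (r0 `^ (b - a) * q ^+ n)%:E)%E.
  rewrite /u; under eq_integral do rewrite mulrC EFinM.
  rewrite ge0_integralZl//; first last.
  - by rewrite lee_fin powR_ge0.
  - by move=> x _; rewrite lee_fin ball_weight_ge0.
  - by apply/measurable_EFinP; exact: measurable_ball_weight.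
  have := Er _ (r0s n); rewrite unlock => Esn.
  apply: (@le_trans _ _ ((s n `^ (- a))%:E * (s n `^ b)%:E)%E).
    by apply: lee_wpmul2l Esn; rewrite lee_fin powR_ge0.
  rewrite -EFinM lee_fin -powRD; last by apply/implyP => _; rewrite gt_eqF.
  rewrite addrC powRM ?exprn_ge0//; last lra.
  rewrite (_ : (2 ^+ n) `^ (b - a) = q ^+ n)//.
  by rewrite powRX.
have int_sum : (\int[P]_x (\sum_(n <oo) u n x) < +oo)%E.
  rewrite integral_nneseries//.
  apply: (@le_lt_trans _ _ (r0 `^ (b - a) * (1 - q)^-1)%:E); last exact: ltry.
  apply: lime_le; first by apply: is_cvg_nneseries => n _ _; exact: integral_ge0.
  apply: nearW => n.
  apply: (@le_trans _ _ (\sum_(0 <= i < n) (r0 `^ (b - a) * q ^+ i)%:E)%E).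
    by apply: lee_sum => i _; exact: int_u.
  rewrite sumEFin lee_fin.
  apply: (@geometric_le_lim _ n (r0 `^ (b - a)) q) => //; first exact: powR_ge0.
  by rewrite gtr0_norm.
have msum : measurable_fun setT (fun x => \sum_(n <oo) u n x)%E.
  exact: ge0_emeasurable_sum.
have : P.-integrable setT (fun x => \sum_(n <oo) u n x)%E.
  apply/integrableP; split=> //; apply: le_lt_trans int_sum.
  by apply: ge0_le_integral => //; [exact: measurableT_comp|
    move=> x _; rewrite gee0_abs// nneseries_ge0].
move/(integrable_ae measurableT); apply: filterS => x /(_ I) xfin.
pose K := fine (\sum_(n <oo) u n x)%E.
have uK n : ball_weight (s n) x <= K * s n `^ a.
  have : (u n x <= K%:E)%E.
    rewrite /K fineK//; apply: le_trans (nneseries_lim_ge n.+1 _) => [|//].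
    by rewrite big_nat_recr//= leeDr// sume_ge0.
  rewrite lee_fin powRN ler_pdivrMr// powR_gt0//.
have K0 : 0 <= K by apply: fine_ge0; exact: nneseries_ge0.
apply: (@sparse_poly_growth _ a x K (2 * r0)) => //; first lra.
move=> n n0; have n1 : 1 <= n%:R :> R by rewrite ler1n.
(* With [2 ^ k <= n < 2 ^ k.+1], the radius [r0 * 2 ^ k.+1] lies between [n] and [2 * r0 * n]. *)
exists (s (trunc_log 2 n).+1); split=> //.
  rewrite /s; have : n%:R <= 2 ^+ (trunc_log 2 n).+1 :> R.
    by rewrite -natrX ler_nat ltnW// trunc_log_ltn.
  by move=> h; nra.
have tn : 2 ^+ trunc_log 2 n <= n%:R :> R by rewrite -natrX ler_nat trunc_logP.
rewrite /s exprS mulrCA mulrA; apply: ler_wpM2l => //; lra.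
Qed.

End MeanGrowth.

Section UpperClauses.
Context {R : realType} (mu : probability (@Dstar R) R) (mu_unimodular : unimodular mu).
Variable w : equivariant_process (nonneg_reals R).
Local Notation P := (marked_law mu w).
Hypothesis w_gt0 : (0 < 'E_P[origin_weight])%E.
Hypothesis w_lty : ('E_P[origin_weight] < +oo)%E.
Let upper := ess_inf P (fun x => upper_growth (fun r => (ball_weight r x)%:E)).
Let mean := upper_growth (fun r => 'E_P[ball_weight r])%E.

Let mean_ge0 : (0 <= mean)%E.
Proof.
have Efin : 'E_P[origin_weight]%E \is a fin_num by rewrite ge0_fin_numE ?ltW.
apply: (@upper_growth_ge0 _ _ (fine 'E_P[origin_weight]%E) 1).
  by rewrite fine_gt0// w_gt0 w_lty.
move=> r r1; rewrite fineK// unlock; apply: ge0_le_integral => //.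
- by move=> x _; rewrite lee_fin point_mark_ge0.
- by apply/measurable_EFinP; exact: measurable_origin_weight.
- by apply/measurable_EFinP; exact: measurable_ball_weight.
- by move=> x _; rewrite lee_fin origin_weight_le_ball.
Qed.

Lemma not_ae_weight0 : ~ (\forall x \ae P, origin_weight x = 0).
Proof.
move=> w0; move: w_gt0; rewrite unlock.
rewrite (_ : (\int[P]_x (origin_weight x)%:E)%E = 0%E) ?ltxx//.
apply/ge0_integral_eq0_ae; [|by move=> x; rewrite lee_fin point_mark_ge0|].
  by apply/measurable_EFinP; exact: measurable_origin_weight.
by apply: filterS w0 => x ->.
Qed.

(** This does not follow from a comparison with [upper], which is [-oo] when all weights vanish with
    positive probability. A mean growth below [a] gives polynomial growth almost surely, and the
    root has positive weight with positive probability. *)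
Lemma udim_H_le_mean : (udim_H mu <= mean)%E.
Proof.
rewrite leNgt; apply/negP => /ereal_between[a [ma]]; apply/negP; rewrite -leNgt.
have a0 : 0 <= a by rewrite -lee_fin (le_trans mean_ge0)// ltW.
apply: (udim_H_le_growth mu_unimodular a0 (w := w)) => Bw; apply: not_ae_weight0.
by apply: filterS2 Bw (ae_poly_growth a0 ma) => x; exact.
Qed.

Lemma upper_le_mean : (upper <= mean)%E.
Proof.
rewrite leNgt; apply/negP => /ereal_between[a [ma]]; apply/negP; rewrite -leNgt.
have a0 : 0 <= a by rewrite -lee_fin (le_trans mean_ge0)// ltW.
rewrite -(@ess_inf_cst _ _ _ P a%:E) ?[X in (_ < X)%E]probability_setT ?lte01//.
apply: le_ess_inf; apply: filterS (ae_poly_growth a0 ma) => x.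
exact: some_poly_growth_le.
Qed.

Lemma udim_H_le_upper : (\forall x \ae P, nonzero_weight x) -> (udim_H mu <= upper)%E.
Proof.
move=> wN0; rewrite leNgt; apply/negP => /ereal_between[a [ua]]; apply/negP; rewrite -leNgt.
(* A nonzero weight keeps the ball weights above a positive constant from some radius on. This makes
   the separating exponent [a] nonnegative. *)
have upper_ge0 : (0 <= upper)%E.
  apply/ess_infP; apply: filterS wN0 => x /nonzero_weight_ball[n xn].
  apply: (@upper_growth_ge0 _ _ (ball_weight n%:R x) n%:R) => // r nr.
  by rewrite lee_fin le_ball_weight.
have a0 : 0 <= a by rewrite -lee_fin (le_trans upper_ge0)// ltW.
apply: (udim_H_le_growth mu_unimodular a0 (w := w)) => Bw.
move: ua; rewrite ltNge => /negP; apply; apply/ess_infP.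
apply: filterS2 wN0 (ae_no_poly_growth mu_unimodular a0 Bw) => x xw /(_ xw) xB.
by rewrite leNgt; apply/negP => /(upper_growth_lt_poly a0).
Qed.

End UpperClauses.

(** * Independent coins *)

Section Digits.
Context {R : realType}.
Implicit Types (p : nat -> R) (a l u : R) (C : nat -> bool -> bool).

(* Bits of u relative to nested subdivisions of [a, a + l[: a subinterval of
   length l at depth n is cut into a left part of length l * p n, coded by true,
   and a right part, so that the bits of a uniform u are independent. *)
Fixpoint digit (n : nat) a l p u : bool :=
  if n is n'.+1 then
    if u < a + l * p 0 then digit n' a (l * p 0) (fun i => p i.+1) u
    else digit n' (a + l * p 0) (l * (1 - p 0)) (fun i => p i.+1) u
  else u < a + l * p 0.

(** [C n] is the set of values allowed for bit [n]; allowing both values leaves that bit free. *)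
Definition digit_event (N : nat) C a l p : set R :=
  [set u | a <= u < a + l /\ forall n, (n < N)%N -> C n (digit n a l p u)].

(** The probability that a Bernoulli variable of parameter [t] takes an allowed value. *)
Definition bernoulli_weight (t : R) (C : bool -> bool) : R :=
  (if C true then t else 0) + (if C false then 1 - t else 0).

(** Bit 0 decides between the two subintervals, and the remaining bits follow the same construction
    inside the chosen one. This is the induction step for independence. *)
Lemma digit_eventS N C a l p : 0 <= l -> (forall n, 0 <= p n <= 1) ->
  digit_event N.+1 C a l p =
  (if C 0 true then digit_event N (fun n => C n.+1) a (l * p 0) (fun i => p i.+1) else set0) `|`
  (if C 0 false then
     digit_event N (fun n => C n.+1) (a + l * p 0) (l * (1 - p 0)) (fun i => p i.+1) else set0).
Proof.
move=> l0 p01; have /andP[p0 p1] := p01 0%N.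
have lp : l * p 0 <= l by rewrite ler_piMr.
have lp0 : 0 <= l * p 0 by rewrite mulr_ge0.
have lE : a + l * p 0 + l * (1 - p 0) = a + l by rewrite -addrA -mulrDr subrKC mulr1.
apply/seteqP; split=> u.
  move=> [/andP[au ul] uC]; have := uC 0%N isT; rewrite /=.
  have [ua|ua] := ltP u (a + l * p 0) => C0; [left|right]; rewrite C0.
    by split; [rewrite au ua|move=> n nN; have := uC n.+1 nN; rewrite /= ua].
  split; first by rewrite ua lE ul.
  by move=> n nN; have := uC n.+1 nN; rewrite /= ltNge ua.
case; case: ifP => // C0 [/andP[au ul] uC].
  split; first by rewrite au (lt_le_trans ul)// lerD2l.
  by case=> [|n] nN /=; rewrite ul//; exact: uC.
split; first by rewrite (le_trans _ au) ?lerDl//= -lE ul.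
by case=> [|n] nN /=; rewrite ltNge au//=; exact: uC.
Qed.

Lemma digit_eventP N C a l p : 0 <= l -> (forall n, 0 <= p n <= 1) ->
  measurable (digit_event N C a l p) /\
  lebesgue_measure (digit_event N C a l p) =
  (l * \prod_(n < N) bernoulli_weight (p n) (C n))%:E.
Proof.
elim: N C a l p => [|N IH] C a l p l0 p01.
  have -> : digit_event 0 C a l p = `[a, a + l[%classic.
    by apply/seteqP; split=> u; rewrite /digit_event/= in_itv/=; first case.
  split; first exact: measurable_itv.
  rewrite big_ord0 mulr1 lebesgue_measure_itv/= lte_fin ltrDl.
  have [_|l0'] := ltP 0 l; first by rewrite -EFinB addrAC subrr add0r.
  by congr EFin; apply/eqP; rewrite eq_le l0 l0'.
have /andP[p0 p1] := p01 0%N.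
have lp0 : 0 <= l * p 0 by rewrite mulr_ge0.
have lp1 : 0 <= l * (1 - p 0) by rewrite mulr_ge0// subr_ge0.
have p01' n : 0 <= p n.+1 <= 1 by [].
have [mL EL] := IH (fun n => C n.+1) a _ _ lp0 p01'.
have [mR ER] := IH (fun n => C n.+1) (a + l * p 0) _ _ lp1 p01'.
rewrite digit_eventS//.
set L := (X in X `|` _); set S := (X in _ `|` X).
have mL' : measurable L by rewrite /L; case: ifP.
have mS' : measurable S by rewrite /S; case: ifP.
split; first exact: measurableU.
rewrite measureU//; last first.
  apply/seteqP; split=> // u []; rewrite /L /S; case: ifP => // _ [/andP[_ ul] _].
  by case: ifP => // _ [/andP[ua _] _]; move: ua; rewrite leNgt ul.
have -> : \prod_(n < N.+1) bernoulli_weight (p n) (C n) = bernoulli_weight (p 0) (C 0) *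
    \prod_(n < N) bernoulli_weight (p n.+1) (C n.+1) by rewrite big_ord_recl.
rewrite {1}/bernoulli_weight mulrDl mulrDr EFinD; congr (_ + _)%E.
  rewrite /L; case: ifP => _; last by rewrite measure0 mul0r mulr0.
  by rewrite mulrA; exact: EL.
rewrite /S; case: ifP => _; last by rewrite measure0 mul0r mulr0.
by rewrite mulrA; exact: ER.
Qed.

Lemma measurable_digit n a l p b : measurable [set u | digit n a l p u = b].
Proof.
have mlt c : measurable [set u : R | u < c].
  have -> : [set u : R | u < c] = `]-oo, c[%classic by apply/seteqP; split=> u; rewrite /= in_itv.
  exact: measurable_itv.
elim: n a l p => [|n IH] a l p /=.
  case: b; first exact: mlt.
  rewrite (_ : [set u | _] = ~` [set u : R | u < a + l * p 0]); first exact: measurableC.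
  by apply/seteqP; split=> u /=; [move=> /negbT/negP|move=> /negP/negbTE].
rewrite (_ : [set u | _] =
  ([set u : R | u < a + l * p 0] `&` [set u | digit n a (l * p 0) (fun i => p i.+1) u = b]) `|`
  (~` [set u : R | u < a + l * p 0] `&`
    [set u | digit n (a + l * p 0) (l * (1 - p 0)) (fun i => p i.+1) u = b])).
  by apply: measurableU; apply: measurableI => //; exact: measurableC.
apply/seteqP; split=> u /=; first by case: ifP => ua; [left|right; split=> //; rewrite ua].
by case=> -[ua]; [rewrite ua|move/negP : ua => /negbTE ->].
Qed.

End Digits.

Section Coins.
Context {R : realType}.

Definition unit_lebesgue :=
  mrestr (@lebesgue_measure R) (measurable_itv `[0, 1[).

HB.instance Definition _ := Measure.on unit_lebesgue.

Let unit_lebesgue_setT : unit_lebesgue setT = 1%E.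
Proof.
rewrite /unit_lebesgue /mrestr setTI lebesgue_measure_itv/= lte_fin ltr01.
by rewrite sube0.
Qed.

HB.instance Definition _ := Measure_isProbability.Build _ _ R unit_lebesgue
  unit_lebesgue_setT.

Section CoinSpace.
Variable D : @discrete_space R.

Definition coin_space := D -> bool.

HB.instance Definition _ := Pointed.on coin_space.

(** These sets are stable under intersection and generate the sigma-algebra, so they determine a law
    of coins. *)
Definition heads (vs : seq D) : set coin_space := [set s | forall v, v \in vs -> s v].

Definition coins := g_sigma_algebraType (range heads).

HB.instance Definition _ := Measurable.on coins.

Lemma headsI : setI_closed (range heads).
Proof.
move=> _ _ [vs _ <-] [vs' _ <-]; exists (vs ++ vs') => //.
apply/seteqP; split=> s.
  by move=> sv; split=> v vvs; apply: sv; rewrite mem_cat vvs ?orbT.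
by move=> [sv sv'] v; rewrite mem_cat => /orP[/sv|/sv'].
Qed.

Lemma measurable_heads vs : measurable (heads vs : set coins).
Proof. by apply: sub_sigma_algebra; exists vs. Qed.

Lemma measurable_coin v b : measurable ([set s | s v = b] : set coins).
Proof.
have mv : measurable ([set s | s v = true] : set coins).
  rewrite (_ : [set s | _] = heads [:: v]); first exact: measurable_heads.
  by apply/seteqP; split=> s; [move=> sv u; rewrite inE => /eqP->|apply; rewrite inE].
case: b => //; rewrite (_ : [set s | _] = ~` ([set s | s v = true] : set coins)).
  exact: measurableC.
by apply/seteqP; split=> s /= /negP/negP => [/negbTE ->//|]; case: (s v).
Qed.

Lemma exists_code : exists f : D -> nat, injective f.
Proof.
have [[v0]|noD] := pselect (inhabited D); last first.
  by exists (fun=> 0%N) => x; exfalso; apply: noD; exact: inhabits.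
have : countable [set: D].
  rewrite (_ : [set: D] = \bigcup_n (oball (@unmarked R D v0) n%:R)).
    apply: bigcup_countable; first exact: countableP.
    move=> n _; apply: finite_set_countable; exact: (finite_oball (unmarked v0)).
  apply/seteqP; split=> // v _; exists (Num.truncn (dist v0 v)).+1 => //.
  by rewrite /oball /= truncnS_gt.
by move=> /countable_injP[f fi]; exists f => x y; apply: fi; rewrite inE.
Qed.

Definition code : D -> nat := projT1 (cid exists_code).

Lemma code_inj : injective code.
Proof. exact: projT2 (cid exists_code). Qed.

Variables (p : D -> R) (p01 : forall v, 0 <= p v <= 1).

(* Arbitrary at the integers which are not codes. *)
Definition code_prob (n : nat) : R :=
  if pselect (exists v, code v = n) is left ex then p (projT1 (cid ex)) else 0.

Lemma code_probE v : code_prob (code v) = p v.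
Proof.
rewrite /code_prob; case: pselect => [ex|nex]; last by exfalso; apply: nex; exists v.
by congr p; apply: code_inj; exact: projT2 (cid ex).
Qed.

Lemma code_prob01 n : 0 <= code_prob n <= 1.
Proof. by rewrite /code_prob; case: pselect => // _; rewrite lexx ler01. Qed.

Definition coin_of (u : measurableTypeR R) : coins := fun v => digit (code v) 0 1 code_prob u.

Lemma measurable_coin_of : measurable_fun setT coin_of.
Proof.
have mG := @measurability _ _ (measurableTypeR R) coins setT coin_of (range heads).
apply: mG => [//|_ [_ [vs _ <-] <-]]; rewrite setTI.
rewrite (_ : _ @^-1` _ = \big[setI/setT]_(v <- vs) [set u | digit (code v) 0 1 code_prob u = true]).
  by apply: bigsetI_measurable => v _; exact: measurable_digit.
apply/seteqP; split=> u.
  by move=> uvs; rewrite -bigcap_seq => v /= /uvs.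
by rewrite -bigcap_seq => uvs v vvs; apply: uvs.
Qed.

HB.instance Definition _ := isMeasurableFun.Build _ _ _ _ coin_of measurable_coin_of.

Definition coin_law : probability coins R := distribution unit_lebesgue coin_of.

Lemma coin_law_pattern (vs : seq D) (x : coin_space) : uniq vs ->
  coin_law [set s | forall v, v \in vs -> s v = x v] =
  (\prod_(v <- vs) (if x v then p v else 1 - p v))%:E.
Proof.
move=> uvs; pose N := (\max_(v <- vs) code v).+1.
(* A bit at a code must agree with [x] there; any other bit is free and contributes a factor 1. *)
pose C n b := `[< forall v, v \in vs -> code v = n -> b = x v >].
rewrite /coin_law /distribution /pushforward /= /unit_lebesgue /mrestr /=.
rewrite (_ : _ `&` _ = digit_event N C 0 1 code_prob).
  have [_ ->] := digit_eventP N C 0 ler01 code_prob01.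
  congr EFin; rewrite mul1r.
  rewrite -(big_mkord xpredT (fun n => bernoulli_weight (code_prob n) (C n))).
  rewrite (bigID (fun n => n \in map code vs))/= [X in _ * X]big1 ?mulr1; last first.
    move=> n nvs; have Ct b : C n b.
      by apply/asboolP => v vvs vn; move: nvs; rewrite -vn map_f.
    by rewrite /bernoulli_weight !Ct subrKC.
  rewrite -big_filter (perm_big (map code vs)); last first.
    apply: uniq_perm; first exact/filter_uniq/iota_uniq.
      by rewrite map_inj_uniq//; exact: code_inj.
    move=> n; rewrite mem_filter mem_index_iota /=.
    case: (boolP (n \in _)) => //= /mapP[v vvs ->].
    by rewrite ltnS; exact: leq_bigmax_seq.
  rewrite big_map; apply: eq_big_seq => v vvs.
  rewrite code_probE.
  have CE b : C (code v) b = (b == x v).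
    apply/asboolP/eqP => [/(_ v vvs erefl)//|-> u _ /code_inj ->//].
  by rewrite /bernoulli_weight !CE; case: (x v); rewrite /= ?addr0 ?add0r.
apply/seteqP; split=> u.
  move=> [/= uvs']; rewrite in_itv/= => u01; split; first by rewrite add0r.
  by move=> n nN; apply/asboolP => v vvs <-; exact: uvs'.
move=> [u01 uC]; split; last by rewrite /= in_itv/= -[X in _ < X]add0r.
move=> v vvs; have vN : (code v < N)%N by rewrite ltnS; exact: leq_bigmax_seq.
by have /asboolP/(_ v vvs erefl) := uC _ vN.
Qed.

End CoinSpace.
End Coins.

Section Relabeling.
Context {R : realType} (D1 D2 : @discrete_space R).
Variables (f : D1 -> D2) (g : D2 -> D1) (gK : cancel g f).

Definition relabel (s : coins D1) : coins D2 := s \o g.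

Lemma measurable_relabel : measurable_fun setT relabel.
Proof.
have mG := @measurability _ _ (coins D1) (coins D2) setT relabel (range (@heads R D2)).
apply: mG => [//|_ [_ [vs _ <-] <-]]; rewrite setTI.
rewrite (_ : _ @^-1` _ = heads (map g vs)); first exact: measurable_heads.
apply/seteqP; split=> s /=; first by move=> sv _ /mapP[v /sv ? ->].
by move=> sv v vvs; apply: sv; exact: map_f.
Qed.

HB.instance Definition _ := isMeasurableFun.Build _ _ _ _ relabel measurable_relabel.

Variables (p1 : D1 -> R) (p2 : D2 -> R).
Hypotheses (p1_01 : forall v, 0 <= p1 v <= 1) (p2_01 : forall v, 0 <= p2 v <= 1)
  (p12 : forall v, p2 (f v) = p1 v).

Lemma coin_law_heads (D : @discrete_space R) (p : D -> R) vs :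
  (forall v, 0 <= p v <= 1) -> coin_law p (heads vs) = (\prod_(v <- undup vs) p v)%:E.
Proof.
move=> p01; rewrite -(coin_law_pattern p01 (fun=> true) (undup_uniq vs)).
congr (coin_law p _); apply/seteqP; split=> s sv v; [|move=> vvs];
  by [rewrite mem_undup => /sv | apply: sv; rewrite mem_undup].
Qed.

(** The codes of [D1] and [D2] are unrelated, hence so are the two constructions of coins. The laws
    agree nevertheless, since on the sets [heads] they depend on the probabilities only. *)
Lemma coin_law_relabel (A : set (coins D2)) : measurable A ->
  coin_law p1 (relabel @^-1` A) = coin_law p2 A.
Proof.
move=> mA.
pose m1 : probability (coins D2) R := distribution (coin_law p1) relabel.
suff : m1 A = coin_law p2 A by [].
apply: (@measure_unique _ _ (coins D2) (range (@heads R D2)) (fun=> setT)) => //.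
- exact: headsI.
- by move=> _; exists [::] => //; apply/seteqP; split.
- by apply/seteqP; split=> // s _; exists 0%N.
- move=> _ [vs _ <-].
  change (coin_law p1 (relabel @^-1` heads vs) = coin_law p2 (heads vs)).
  rewrite (_ : relabel @^-1` _ = heads (map g vs)); last first.
    apply/seteqP; split=> s /=; first by move=> sv _ /mapP[v /sv ? ->].
    by move=> sv v vvs; apply: sv; exact: map_f.
  rewrite !coin_law_heads// undup_map_inj; last exact: can_inj gK.
  by rewrite big_map; congr EFin; apply: eq_bigr => v _; rewrite -p12 gK.
- by move=> _; rewrite [X in (X < _)%E]probability_setT ltry.
Qed.

End Relabeling.

(** * The random covering *)

Section CoveringMarks.
Context {R : realType} (r : nat) (r2 : (1 < r)%N).

Let big_radiusP : (fun x : R => (x == 0) || (1 <= x)) r%:R.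
Proof. by rewrite /= ler1n (ltnW r2) orbT. Qed.

Let one_radiusP : (fun x : R => (x == 0) || (1 <= x)) 1.
Proof. by rewrite /= lexx orbT. Qed.

Definition big_radius : radii R := exist _ r%:R big_radiusP.
Definition one_radius : radii R := exist _ 1 one_radiusP.
Definition zero_radius : radii R := exist _ 0 (@radii0 R).

Section Space.
Variable D : @discrete_space R.

Definition covered (s : coin_space D) (v : D) := exists t, dist v t <= r%:R /\ s t.

(** A ball of radius 0 is empty, so a point which no head reaches receives the radius 1 and covers
    itself. *)
Definition cover_marks (s : coins D) : markings (radii R) D := fun x y =>
  if x == y then
    if s x then big_radius else if `[< covered s x >] then zero_radius else one_radius
  else zero_radius.

Lemma measurable_covered v : measurable ([set s | covered s v] : set (coins D)).
Proof.
pose E t : set (coins D) := if dist v t <= r%:R then [set s | s t = true] else set0.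
have mE t : measurable (E t) by rewrite /E; case: ifP => // _; exact: measurable_coin.
have mU := measurable_bigcup_points v mE.
rewrite (_ : [set s | _] = \bigcup_t E t)//.
apply/seteqP; split=> s.
  by move=> [t [vt st]]; exists t => //; rewrite /E vt.
by move=> [t _]; rewrite /E; case: ifP => // vt st; exists t.
Qed.

Lemma measurable_cover_marks : measurable_fun setT cover_marks.
Proof.
have mG := @measurability _ _ (coins D) (markings (radii R) D) setT cover_marks
  (@cylinders R (radii R) D).
apply: mG => [//|_ [_ [x [y [B [_ ->]]]] <-]]; rewrite setTI.
have mcst (b : Prop) : measurable ([set _ | b] : set (coins D)).
  have [bT|bF] := pselect b.
    by rewrite (_ : [set _ | _] = setT)//; apply/seteqP; split.
  by rewrite (_ : [set _ | _] = set0)//; apply/seteqP; split.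
have [<-|xy] := eqVneq x y; last first.
  rewrite (_ : _ @^-1` _ = [set _ | B zero_radius]); first exact: mcst.
  by apply/seteqP; split=> s; rewrite /= /cover_marks (negbTE xy).
rewrite (_ : _ @^-1` _ =
  ([set s | s x = true] `&` [set _ | B big_radius]) `|`
  ([set s | s x = false] `&` ([set s | covered s x] `&` [set _ | B zero_radius] `|`
    ~` [set s | covered s x] `&` [set _ | B one_radius]))).
  have mx b := @measurable_coin R D x b.
  have mc := measurable_covered x.
  apply: measurableU; apply: measurableI => //; apply: measurableU;
    apply: measurableI => //; exact: measurableC.
apply/seteqP; split=> s; rewrite /= /cover_marks eqxx.
  case: ifP => sx; first by left.
  by case: ifPn => /asboolP sc; right; split=> //; [left|right].
case=> -[->]; first by [].
by case=> -[sc]; [rewrite asboolT|rewrite asboolF].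
Qed.

HB.instance Definition _ := isMeasurableFun.Build _ _ _ _ cover_marks measurable_cover_marks.

Lemma covers_cover_marks o s : covers (marked o (cover_marks s)).
Proof.
apply/covers_marked => u; have r1 : 1 <= r%:R :> R by rewrite ler1n ltnW.
case su : (s u).
  by exists u; rewrite /nball/= /cover_marks eqxx su /= distxx.
have [sc|sc] := pselect (covered s u); last first.
  by exists u; rewrite /nball/= /cover_marks eqxx su asboolF//= distxx lexx ler01.
move: (sc) => [t [ut st]].
by exists t; rewrite /nball/= /cover_marks eqxx st /= dist_sym.
Qed.

End Space.

Lemma cover_marks_relabel (D1 D2 : @discrete_space R) (f : D1 -> D2) g :
  cancel f g -> cancel g f -> (forall x y, dist (f x) (f y) = dist x y) ->
  forall s, transport g (cover_marks s) = cover_marks (relabel g s).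
Proof.
move=> fK gK fd s; apply/funext => x; apply/funext => y.
rewrite /transport /cover_marks (inj_eq (can_inj gK)).
have -> : covered (relabel g s) x = covered s (g x).
  apply/propext; split=> -[t [xt st]].
    by exists (g t); split=> //; rewrite -fd !gK.
  by exists (f t); rewrite /relabel/= fK; split=> //; rewrite -[x]gK fd.
by [].
Qed.

End CoveringMarks.

(** * Products over balls and the probabilities of patterns *)

Section BallProduct.
Context {R : realType} (Xi : polishType R) (rho : R).
Variable (psi : space_of_classes Xi 1 -> R).
Hypotheses (mpsi : measurable_fun setT psi) (psi01 : forall e, 0 <= psi e <= 1).

Definition ball_prod (X : marked_space Xi 0) : R :=
  \prod_(v <- fset_set (oball X rho)) psi (class_of (add_point v)).

Lemma ball_prod_class_of X : ball_prod (repr (class_of X)) = ball_prod X.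
Proof.
have [f [[[g fK gK] fd] fo fm]] := repr_class_of X.
have isof : is_isometry f by split=> //; exists g.
rewrite /ball_prod (perm_big [seq f v | v <- fset_set (oball X rho)]) /=.
  rewrite big_map; apply: eq_bigr => v _; congr psi.
  by apply/esym/add_point_iso => //; exact: (fo ord0).
apply: uniq_perm; rewrite ?map_inj_uniq ?fset_uniq//; try exact: can_inj fK.
have ballE v : oball (repr (class_of X)) rho (f v) <-> oball X rho v.
  by rewrite /oball /= /origin -(fo ord0) fd.
move=> u; rewrite in_fset_set; last exact: finite_oball.
apply/idP/mapP => [/set_mem uB|[v + ->]].
  exists (g u); last by rewrite gK.
  rewrite in_fset_set; last exact: finite_oball.
  by apply/mem_set/ballE; rewrite gK.
rewrite in_fset_set; last exact: finite_oball.
by move=> /set_mem/ballE ?; exact/mem_set.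
Qed.

(** Logarithms turn the product into a sum of nonnegative terms, to which [measurable_oball_sum]
    applies. Vanishing factors, which the logarithm cannot see, are counted separately by [z]. *)
Lemma measurable_ball_prod :
  measurable_fun setT (fun c : space_of_classes Xi 0 => ball_prod (repr c)).
Proof.
pose z e : R := if psi e == 0 then 1 else 0.
pose l e : R := - ln (psi e).
pose Z (c : space_of_classes Xi 0) : \bar R :=
  (\sum_(v <- fset_set (oball (repr c) rho)) (z (class_of (add_point v)))%:E)%E.
pose L (c : space_of_classes Xi 0) : \bar R :=
  (\sum_(v <- fset_set (oball (repr c) rho)) (l (class_of (add_point v)))%:E)%E.
have mZ : measurable_fun setT Z.
  apply: (@measurable_oball_sum _ _ rho (EFin \o z)).
    apply/measurable_EFinP; apply: measurable_fun_ifT => //.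
    exact: measurable_fun_eqr.
  by move=> e; rewrite /= /z lee_fin; case: ifP.
have mL : measurable_fun setT L.
  apply: (@measurable_oball_sum _ _ rho (EFin \o l)).
    apply/measurable_EFinP; apply: measurableT_comp => //.
    exact: measurableT_comp (@measurable_ln R) mpsi.
  move=> e; rewrite /= lee_fin oppr_ge0.
  by apply: ln_le0; have /andP[] := psi01 e.
rewrite (_ : (fun c => _) = fun c => if fine (Z c) == 0 then expR (- fine (L c)) else 0).
  apply: measurable_fun_ifT => //.
    apply: measurable_fun_eqr => //.
    exact: measurableT_comp (fine_measurable measurableT) mZ.
  apply: measurableT_comp => //; apply: measurableT_comp => //.
  exact: measurableT_comp (fine_measurable measurableT) mL.
apply/funext => c; rewrite /ball_prod /Z /L !sumEFin /= /z /l.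
elim: (enum_fset _) => [|v s IH].
  by rewrite !big_nil eqxx oppr0 expR0.
rewrite !big_cons IH.
have [->|p0] := eqVneq (psi (class_of (add_point v))) 0.
  rewrite mul0r ifF//; apply/negbTE; rewrite gt_eqF//.
  by rewrite ltr_pwDl// sumr_ge0// => u _; case: ifP.
rewrite add0r; case: ifP => _; last by rewrite mulr0.
rewrite opprD opprK expRD lnK// posrE lt0r p0.
by have /andP[] := psi01 (class_of (add_point v)).
Qed.

End BallProduct.

Section CoverPattern.
Context {R : realType} (r : nat) (r2 : (1 < r)%N) (p : @Dstar R -> R).
Hypotheses (mp : measurable_fun setT p) (p01 : forall c, 0 <= p c <= 1).
Local Notation E := (marked_Dstar (radii R)).
Local Notation marks := (two_marks (big_radius r2) one_radius zero_radius).

Definition near_head (e : space_of_classes (radii R) 1) : R :=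
  if (points_dist e <= r%:R) && (origin_radius (second_point e) == r%:R) then 1 else 0.

Definition heads_near (x : E) : \bar R :=
  (\esum_(v in [set: repr x]) (near_head (class_of (add_point v)))%:E)%E.

Lemma measurable_heads_near : measurable_fun setT heads_near.
Proof.
apply: (measurable_esum_add_point (g := EFin \o near_head)); last first.
  by move=> e; rewrite /= /near_head lee_fin; case: ifP.
apply/measurable_EFinP; apply: measurable_fun_ifT => //.
apply: measurable_and.
  by apply: measurable_fun_ler => //; exact: measurable_points_dist.
apply: measurable_fun_eqr => //.
exact: measurableT_comp (@measurable_origin_radius R) (@measurable_second_point _ _).
Qed.

Lemma heads_near_marked (D : discrete_space) (v : D) (z : markings (radii R) D) :
  (heads_near (marked v z) == 0%E) = `[< forall t, dist v t <= r%:R -> sval (z t t) != r%:R >].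
Proof.
rewrite /heads_near (esum_add_point_class_of (fun e => (near_head e)%:E)).
have nhE (t : @MarkedSpace R (radii R) 0 D (fun=> v) z) : near_head (class_of (add_point t)) =
    if (dist v t <= r%:R) && (sval (z t t) == r%:R) then 1 else 0.
  by rewrite /near_head points_dist_class_of second_point_add /origin_radius origin_mark_class_of.
apply/eqP/asboolP => [h t vt|h].
  apply/negP => zt; suff : (1%:E <= 0%:E :> \bar R)%E by rewrite lee_fin ler10.
  rewrite -[leRHS]h; apply: esum_ge; exists [set t]; first by split.
  by rewrite fsbig_set1 nhE vt zt.
by apply: esum1 => t _; rewrite nhE; case: ifP => // /andP[/h/negbTE ->].
Qed.

(* The probability of the mark at the origin, given the heads, times the
   indicator that the mark follows the rule of cover_marks. *)
Definition mark_prob (x : E) : R :=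
  (if origin_radius x == r%:R then p (forget x) else 1 - p (forget x)) *
  (if (origin_radius x == 1) == ~~ (origin_radius x == r%:R) && (heads_near x == 0%E)
   then 1 else 0).

Lemma mark_prob01 x : 0 <= mark_prob x <= 1.
Proof.
have /andP[p0 p1] := p01 (forget x).
by rewrite /mark_prob; case: ifP => _; case: ifP => _; rewrite ?mulr1 ?mulr0 ?lexx ?ler01//;
  apply/andP; split; lra.
Qed.

Lemma measurable_mark_prob : measurable_fun setT mark_prob.
Proof.
have mpf : measurable_fun setT (fun x : E => p (forget x)).
  exact: measurableT_comp mp (@measurable_forget _ _).
have mrad := @measurable_origin_radius R.
have mr c : measurable_fun setT (fun x : E => origin_radius x == c).
  exact: measurable_fun_eqr.
have mh : measurable_fun setT (fun x : E => heads_near x == 0%E).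
  exact: measurable_fun_eqe measurable_heads_near (measurable_cst _).
apply: measurable_funM; apply: measurable_fun_ifT => //.
  exact: measurable_funB.
have mAnd : measurable_fun setT (fun x : E => ~~ (origin_radius x == r%:R) && (heads_near x == 0%E)).
  by apply: measurable_and => //; exact: measurable_neg.
rewrite (_ : (fun x => _ == _) = (fun x : E =>
  if origin_radius x == 1 then ~~ (origin_radius x == r%:R) && (heads_near x == 0%E)
  else ~~ (~~ (origin_radius x == r%:R) && (heads_near x == 0%E)))).
  by apply: measurable_fun_ifT => //; exact: measurable_neg.
by apply/funext => x; case: (origin_radius x == 1) => //; case: (~~ _ && _).
Qed.

Lemma mark_prob_marked (D : discrete_space) (v : D) (z : markings (radii R) D) :
  mark_prob (marked v z) =
  (if sval (z v v) == r%:R then p (pointed_class v) else 1 - p (pointed_class v)) *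
  (if (sval (z v v) == 1) == ~~ (sval (z v v) == r%:R) &&
     `[< forall t, dist v t <= r%:R -> sval (z t t) != r%:R >] then 1 else 0).
Proof.
by rewrite /mark_prob heads_near_marked origin_radius_marked forget_class_of.
Qed.

(** On a class marked by a pattern this is the probability of the pattern
    ([coin_law_pattern_event]); it is written as a function of the marked class so that its
    measurability makes sense. *)
Definition pattern_prob (rho : R) (x : E) : R :=
  ball_prod rho (fun e => mark_prob (second_point e)) (repr x).

Lemma measurable_pattern_prob rho : measurable_fun setT (pattern_prob rho).
Proof.
apply: measurable_ball_prod; last by move=> e; exact: mark_prob01.
exact: measurableT_comp measurable_mark_prob (@measurable_second_point _ _).
Qed.

Lemma pattern_prob_ge0 rho x : 0 <= pattern_prob rho x.
Proof.
by apply: prodr_ge0 => v _;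
  have /andP[] := mark_prob01 (second_point (class_of (add_point v))).
Qed.

Variable X : marked_space (no_mark R) 0.
Variable rho : R.
Local Notation o := (origin X).
Local Notation B := (fset_set (oball X rho)).
Let pX (v : X) := p (pointed_class v).
Let pX01 v : 0 <= pX v <= 1. Proof. exact: p01. Qed.

Definition consistent (TW : {fset X} * {fset X}) := forall v, v \in B ->
  (v \in TW.2) = (v \notin TW.1) && `[< forall t, dist v t <= r%:R -> t \notin TW.1 >].

Definition head_set (s : coins X) : {fset X} := [fset v in B | s v]%fset.

(** Only the heads inside the ball are seen: near the boundary a point may count as uncovered
    although a head outside reaches it. *)
Definition pattern (s : coins X) : {fset X} * {fset X} :=
  (head_set s, [fset v in B | (v \notin head_set s) &&
     `[< forall t, dist v t <= r%:R -> t \notin head_set s >]]%fset).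

Lemma pattern_disjoint s : disjoint_fsets X rho (pattern s).
Proof.
split=> v; rewrite /= !inE /=.
- by move=> /andP[+ _]; rewrite in_fset_set => [/set_mem//|]; exact: finite_oball.
- by move=> /andP[+ _]; rewrite in_fset_set => [/set_mem//|]; exact: finite_oball.
- by move=> /andP[-> ->].
Qed.

Lemma pattern_event TW : disjoint_fsets X rho TW ->
  [set s | pattern s = TW] =
  if `[< consistent TW >] then [set s : coins X | forall v, v \in (B : seq X) -> s v = (v \in TW.1)]
  else set0.
Proof.
case: TW => T W [/= Tr Wr TWd].
have Bin v : oball X rho v -> v \in B.
  by move=> vB; rewrite in_fset_set; [exact/mem_set|exact: finite_oball].
case: ifPn => /asboolP cTW; last first.
  apply/seteqP; split=> // s /= sTW; apply: cTW => v vB.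
  by rewrite -sTW /= !inE /= vB.
apply/seteqP; split=> s /=.
  by move=> [<- _] v vB; rewrite !inE /= vB.
move=> sT; have headE : head_set s = T.
  apply/fsetP => v; rewrite !inE /=.
  case vB : (v \in B); first by rewrite sT.
  by apply/esym/negbTE/negP => /Tr/Bin; rewrite vB.
rewrite /pattern headE; congr pair; apply/fsetP => v; rewrite !inE /=.
case vB : (v \in B); first by rewrite (cTW v vB).
by apply/esym/negbTE/negP => /Wr/Bin; rewrite vB.
Qed.

Lemma measurable_pattern_event TW : disjoint_fsets X rho TW ->
  measurable ([set s | pattern s = TW] : set (coins X)).
Proof.
move=> dTW; rewrite pattern_event//; case: ifP => // _.
rewrite (_ : [set s | _] = \big[setI/setT]_(v <- (B : seq X)) [set s | s v = (v \in TW.1)]).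
  by apply: bigsetI_measurable => v _; exact: measurable_coin.
by rewrite -bigcap_seq; apply/seteqP; split=> s sB v vB; apply: sB.
Qed.

(** A pattern that breaks the covering rule has an empty event, and its product contains a zero
    factor; for any other pattern the product is the probability of the heads and tails in the
    ball. *)
Lemma coin_law_pattern_event TW : disjoint_fsets X rho TW ->
  coin_law pX [set s | pattern s = TW] = (pattern_prob rho (marked o (marks TW)))%:E.
Proof.
move=> dTW; rewrite pattern_event//.
rewrite /pattern_prob ball_prod_class_of /ball_prod /=.
case: TW dTW => T W [/= Tr Wr TWd].
(* The three radii 0, 1 and [r] are distinct, so both sets can be read off from the marks. *)
have r_eq1 : (r%:R == 1 :> R) = false by rewrite pnatr_eq1; apply/negbTE; rewrite neq_ltn r2 orbT.
have r_eq0 : (r%:R == 0 :> R) = false by rewrite pnatr_eq0; apply/negbTE; rewrite -lt0n ltnW.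
have zr (v : X) : (sval (marks (T, W) v v) == r%:R) = (v \in T).
  rewrite /two_marks eqxx /=; case: ifP => _ /=; first by rewrite eqxx.
  by case: ifP => _ /=; rewrite eq_sym.
have z1 (v : X) : (sval (marks (T, W) v v) == 1) = (v \in W).
  rewrite /two_marks eqxx /=; case: ifPn => vT /=.
    by rewrite r_eq1; apply/esym/negbTE/TWd.
  by case: ifP => _ /=; rewrite ?eqxx// eq_sym oner_eq0.
pose ok v := (v \in W) == (v \notin T) && `[< forall t, dist v t <= r%:R -> t \notin T >].
have mE (v : X) : mark_prob (second_point (class_of (@add_point R (radii R)
    (@MarkedSpace R (radii R) 0 X (fun=> o) (marks (T, W))) v))) =
    (if v \in T then pX v else 1 - pX v) * (if ok v then 1 else 0).
  rewrite second_point_add; rewrite [LHS]mark_prob_marked zr z1 /ok.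
  rewrite (asbool_equiv_eq (Q := forall t : X, dist v t <= r%:R -> t \notin T))//.
  by split=> h t /h; rewrite zr.
rewrite (eq_bigr _ (fun v _ => mE v)).
case: ifPn => /asboolP cTW.
  rewrite [LHS](coin_law_pattern pX01 (fun v => v \in T) (fset_uniq _)); congr EFin.
  apply: eq_big_seq => v vB; rewrite /ok.
  by rewrite (cTW v vB) eqxx mulr1.
rewrite preimage_set0 measure0; congr EFin; apply/esym.
have [v [vB okv]] : exists v, v \in B /\ ~~ ok v.
  apply: contrapT => nv; apply: cTW => v vB; apply/eqP.
  by apply: contrapT => /negP okv; apply: nv; exists v.
apply/eqP; rewrite prodf_seq_eq0; apply/hasP; exists v => //=.
by rewrite (negbTE okv) mulr0.
Qed.

Let V := fset_set (disjoint_fsets X rho).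

Let inV TW : TW \in V <-> disjoint_fsets X rho TW.
Proof.
rewrite in_fset_set; last exact: finite_disjoint_fsets.
by split=> [/set_mem|/mem_set].
Qed.

Let Ev TW : set (coins X) := if TW \in V then [set s | pattern s = TW] else set0.

Let mEv TW : measurable (Ev TW).
Proof. by rewrite /Ev; case: ifP => // /inV; exact: measurable_pattern_event. Qed.

Let pattern_sumE (h : E -> R) s : (h (marked o (marks (pattern s))))%:E =
  (\sum_(TW <- V) (h (marked o (marks TW)) * \1_(Ev TW) s)%:E)%E.
Proof.
have sV : pattern s \in V by apply/inV/pattern_disjoint.
rewrite (big_fsetD1 (pattern s)) //=.
rewrite indicE /Ev sV mem_set//= mulr1 big1_fset ?adde0// => TW; rewrite !inE => /andP[TWs TWV] _.
by rewrite indicE TWV memNset ?mulr0//= => /esym/eqP; apply/negP.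
Qed.

Let measurable_pattern_term (h : E -> R) TW :
  measurable_fun setT (fun s => (h (marked o (marks TW)) * \1_(Ev TW) s)%:E).
Proof. by apply/measurable_EFinP/measurable_funM => //; exact: measurable_indic. Qed.

Lemma measurable_pattern_fun (h : E -> R) :
  measurable_fun setT (fun s => h (marked o (marks (pattern s)))).
Proof.
apply/measurable_EFinP; rewrite (_ : _ \o _ = fun s =>
  (\sum_(TW <- V) (h (marked o (marks TW)) * \1_(Ev TW) s)%:E)%E).
  exact: emeasurable_sum.
by apply/funext => s; exact: pattern_sumE.
Qed.

(** The pattern takes finitely many values, with explicit probabilities; the resulting sum is of the
    form treated by [measurable_two_marks_sum]. *)
Lemma integral_pattern (h : E -> R) : (forall x, 0 <= h x) ->
  (\int[coin_law pX]_s (h (marked o (marks (pattern s))))%:E =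
   \sum_(TW <- fset_set (disjoint_fsets X rho))
     (h (marked o (marks TW)) * pattern_prob rho (marked o (marks TW)))%:E)%E.
Proof.
move=> h0; under eq_integral do rewrite pattern_sumE.
rewrite ge0_integral_sum//; first last.
- by move=> TW s _; rewrite lee_fin mulr_ge0.
apply: eq_big_seq => TW TWV; rewrite /Ev TWV; have /inV dTW := TWV.
under eq_integral do rewrite EFinM.
rewrite ge0_integralZl//; first last.
- by rewrite lee_fin.
- by apply/measurable_EFinP/measurable_indic; exact: measurable_pattern_event.
rewrite integral_indic//; last exact: measurable_pattern_event.
rewrite setIT EFinM; congr (_ * _)%E; exact: coin_law_pattern_event.
Qed.

(** At distance [r] from the boundary, every head that could reach [v] is inside the ball, so the
    truncated pattern gives the true mark. *)
Lemma two_marks_pattern s v : oball X (rho - r%:R) v ->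
  marks (pattern s) v v = cover_marks r2 s v v.
Proof.
rewrite /oball/= => vrho.
have inB t : dist v t <= r%:R -> t \in B.
  move=> vt; rewrite in_fset_set; last exact: finite_oball.
  by apply/mem_set; have := dist_triangle v o t; rewrite /oball/= ; lra.
have vB : v \in B by apply: inB; rewrite distxx.
rewrite /two_marks /cover_marks eqxx /= !inE /= vB /=.
case sv: (s v) => //=; have [[t [vt st]]|sc] := pselect (covered r s v).
  rewrite asboolF; last by move=> /(_ t vt); rewrite !inE /= inB// st.
  by rewrite asboolT//; exists t.
rewrite asboolT; first by rewrite asboolF.
move=> t vt; rewrite !inE /= (inB _ vt) /=; apply/negP => st.
by apply: sc; exists t.
Qed.

End CoverPattern.

(** * Lipschitz approximation of open sets *)

Section OpenApproximation.
Context {R : realType} (Xi : polishType R) (k : nat) (U : set (iso_class Xi k)).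
Implicit Types x y : iso_class Xi k.

(** Distance to the complement of [U], capped at 1 so that it is also meaningful when [U] is
    everything. *)
Definition open_dist x : R := inf ([set 1] `|` [set kappa x y | y in ~` U]).

Let lb_open_dist x : lbound ([set 1] `|` [set kappa x y | y in ~` U]) 0.
Proof. by move=> _ [->//|[y _ <-]]; exact: kappa_ge0. Qed.

Lemma open_dist_ge0 x : 0 <= open_dist x.
Proof. by apply: lb_le_inf => //; exists 1; left. Qed.

Lemma open_dist_lip x y : open_dist x <= open_dist y + kappa x y.
Proof.
rewrite -lerBlDr; apply: lb_le_inf; first by exists 1; left.
move=> _ [->|[z Uz <-]]; rewrite lerBlDr.
  apply: (@le_trans _ _ 1); last by rewrite lerDl kappa_ge0.
  by apply: ge_inf; [exists 0|left].
rewrite addrC; apply: le_trans (kappa_triangle _ _ _).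
by apply: ge_inf; [exists 0|right; exists z].
Qed.

Lemma open_dist_gt0 x : kappa_open U -> U x -> 0 < open_dist x.
Proof.
move=> oU /oU[e e0 eU]; apply: (@lt_le_trans _ _ (Num.min 1 e)).
  by rewrite lt_min ltr01.
apply: lb_le_inf; first by exists 1; left.
move=> _ [->|[y Uy <-]]; first by rewrite ge_min lexx.
by rewrite ge_min; apply/orP; right; rewrite leNgt; apply/negP => /eU.
Qed.

Lemma open_dist_eq0 x : ~ U x -> open_dist x = 0.
Proof.
move=> Ux; apply/eqP; rewrite eq_le open_dist_ge0 andbT.
by apply: ge_inf; [exists 0|right; exists x => //; rewrite kappaxx].
Qed.

Lemma measurable_open_dist :
  measurable_fun setT (open_dist : space_of_classes Xi k -> R).
Proof.
rewrite (_ : open_dist = fun c => open_dist (class_of (repr c))); last first.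
  by apply/funext => c; rewrite class_ofK.
apply: (lsc_measurable_real (phi := fun X => open_dist (class_of X))) => X a aX.
have e0 : 0 < (open_dist (class_of X) - a) / 2 by lra.
exists ((open_dist (class_of X) - a) / 2) => // Y f rho erho fXY.
have := near_iso_kappa e0 erho fXY.
have := open_dist_lip (class_of X) (class_of Y); lra.
Qed.

(** For open [U] these functions, with Lipschitz constant [n.+1], converge to the indicator of [U],
    and they tolerate the replacement of a covering by its pattern in a large ball. *)
Definition open_approx (n : nat) x : R := Num.min 1 (n.+1%:R * open_dist x).

Lemma open_approx_ge0 n x : 0 <= open_approx n x.
Proof. by rewrite le_min ler01 mulr_ge0// open_dist_ge0. Qed.

Lemma open_approx_le1 n x : open_approx n x <= 1.
Proof. by rewrite ge_min lexx. Qed.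

Lemma open_approx_lip n x y :
  `|open_approx n x - open_approx n y| <= n.+1%:R * kappa x y.
Proof.
wlog le_yx : x y / open_approx n y <= open_approx n x => [wl|].
  have [/wl//|/ltW/wl] := leP (open_approx n y) (open_approx n x).
  by rewrite distrC kappaC.
rewrite ger0_norm ?subr_ge0// lerBlDr addrC.
have lip : n.+1%:R * open_dist x <= n.+1%:R * open_dist y + n.+1%:R * kappa x y.
  by rewrite -mulrDr ler_wpM2l// open_dist_lip.
have kap : 0 <= n.+1%:R * kappa x y by rewrite mulr_ge0// kappa_ge0.
rewrite [X in _ <= X + _]/open_approx; case: (leP 1 (n.+1%:R * open_dist y)) => h.
  by apply: le_trans (open_approx_le1 _ _) _; rewrite lerDl.
by apply: le_trans lip; rewrite /open_approx ge_min lexx orbT.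
Qed.

Lemma measurable_open_approx n :
  measurable_fun setT (open_approx n : space_of_classes Xi k -> R).
Proof.
apply: measurable_minr => //; apply: measurable_funM => //.
exact: measurable_open_dist.
Qed.

Lemma open_approx_cvg x : kappa_open U -> open_approx n x @[n --> \oo] --> (\1_U x : R).
Proof.
move=> oU; have [Ux|Ux] := pselect (U x); last first.
  rewrite indicE memNset//= /open_approx open_dist_eq0//.
  rewrite (_ : (fun n => _) = cst 0); first exact: cvg_cst.
  by apply/funext => n; rewrite mulr0 min_r.
rewrite indicE mem_set//=; apply: cvg_near_cst.
near=> n; rewrite /open_approx min_l//.
rewrite -ler_pdivrMr ?open_dist_gt0//.
apply: (@le_trans _ _ n%:R); last by rewrite ler_nat.
near: n; exact: nbhs_infty_ger.
Unshelve. all: by end_near.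
Qed.

End OpenApproximation.

Section CoveringProcess.
Context {R : realType} (r : nat) (r2 : (1 < r)%N) (p : @Dstar R -> R).
Hypotheses (mp : measurable_fun setT p) (p01 : forall c, 0 <= p c <= 1).
Local Notation E := (marked_Dstar (radii R)).
Local Notation marks := (two_marks (big_radius r2) one_radius zero_radius).

Definition head_prob (D : discrete_space) (v : D) : R := p (pointed_class v).

Let head_prob01 (D : discrete_space) (v : D) : 0 <= head_prob v <= 1.
Proof. exact: p01. Qed.

Definition covering_law (D : discrete_space) : probability (markings (radii R) D) R :=
  distribution (coin_law (@head_prob D)) (@cover_marks R r r2 D).

Lemma covering_law_isometry (D1 D2 : @discrete_space R) (rho : D1 -> D2) (rho' : D2 -> D1) :
  is_isometry rho -> cancel rho rho' -> cancel rho' rho ->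
  forall A : set (markings (radii R) D2), measurable A ->
  covering_law D1 (transport rho' @^-1` A) = covering_law D2 A.
Proof.
move=> rhoi rhoK rho'K A mA.
change (coin_law (@head_prob D1) (@cover_marks R r r2 _ @^-1` (transport rho' @^-1` A)) =
  coin_law (@head_prob D2) (@cover_marks R r r2 _ @^-1` A)).
rewrite -(coin_law_relabel rho'K (@head_prob01 D1) (@head_prob01 D2)).
- congr (coin_law _ _); apply/seteqP; split=> s /=.
    by rewrite (cover_marks_relabel r2 rhoK rho'K)//; case: rhoi.
  by rewrite (cover_marks_relabel r2 rhoK rho'K)//; case: rhoi.
- by move=> v; rewrite /head_prob pointed_class_iso.
- by rewrite -[X in measurable X]setTI; exact: measurable_cover_marks.
Qed.

Let cover_class (c : Dstar) (s : coins (repr c)) : E :=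
  marked (origin (repr c)) (cover_marks r2 s).

(** The square makes the pattern accurate to [(n.+1 ^ 2)^-1] for [kappa], so that after
    multiplication by the Lipschitz constant [n.+1] an error [1 / n.+1] remains. The summand 1
    passes from closed to open balls, and [r] is the margin of [two_marks_pattern]. *)
Let depth n : R := n.+1%:R ^+ 2 + 1 + r%:R.

Let pattern_class n (c : Dstar) (s : coins (repr c)) : E :=
  marked (origin (repr c)) (marks (@pattern R r (repr c) (depth n) s)).

Let kappa_pattern_class n c s :
  kappa (cover_class s) (pattern_class n (c := c) s) <= (n.+1%:R ^+ 2)^-1.
Proof.
apply: kappa_marked => [|x y]; first by rewrite invr_gt0 exprn_gt0.
rewrite invrK => xn _; suff -> : cover_marks r2 s x y =
    marks (@pattern R r (repr c) (depth n) s) x y.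
  by rewrite mdistxx invr_ge0 exprn_ge0.
have [<-|xy] := eqVneq x y; last by rewrite /cover_marks /two_marks (negbTE xy).
by rewrite two_marks_pattern// /oball /= /depth addrK; move: xn; rewrite /origin; lra.
Qed.

Let approx_pattern_close U n c s :
  `|open_approx U n (cover_class s) - open_approx U n (pattern_class n (c := c) s)|
  <= n.+1%:R^-1.
Proof.
apply: le_trans (open_approx_lip _ _ _ _) _.
apply: (@le_trans _ _ (n.+1%:R * (n.+1%:R ^+ 2)^-1)).
  by rewrite ler_wpM2l// kappa_pattern_class.
by rewrite expr2 invfM mulrA divff ?mul1r// pnatr_eq0.
Qed.

Let approx_pattern_cvg U c s : kappa_open U ->
  open_approx U n (pattern_class n (c := c) s) @[n --> \oo] --> (\1_U (cover_class s) : R).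
Proof.
move=> oU; rewrite -[X in _ --> X]subr0.
rewrite (_ : (fun n => _) = (fun n => open_approx U n (cover_class s) -
  (open_approx U n (cover_class s) - open_approx U n (pattern_class n s)))); last first.
  by apply/funext => n; rewrite opprB addrC subrK.
apply: cvgB; first exact: open_approx_cvg.
apply/cvgr0Pnorm_le => e e0; near=> n.
apply: le_trans (approx_pattern_close _ _ _) _; near: n.
have := @cvg_harmonic R.
move=> /cvgr0Pnorm_le/(_ e e0); apply: filterS => n /=.
by rewrite ger0_norm.
Unshelve. all: by end_near.
Qed.

Let cover_kernel (c : Dstar) : probability E R :=
  distribution (covering_law (repr c)) (marked (origin (repr c))).

(** Dominated convergence for the approximations of the indicator, evaluated on patterns. The finite
    sums are measurable in the class, hence so is their limit. *)
Let cover_kernel_cvg U c : kappa_open U ->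
  (\sum_(TW <- fset_set (disjoint_fsets (repr c) (depth n)))
    (open_approx U n (marked (origin (repr c)) (marks TW)) *
     pattern_prob r p (depth n) (marked (origin (repr c)) (marks TW)))%:E
  @[n --> \oo] --> cover_kernel c U)%E.
Proof.
move=> oU; pose P := coin_law (@head_prob (repr c)).
have mU : measurable (U : set E) by exact: measurable_kappa_open.
have -> : cover_kernel c U = (\int[P]_s (\1_U (cover_class s))%:E)%E.
  have mP : measurable ((@cover_class c) @^-1` U : set (coins (repr c))).
    rewrite -[X in measurable X]setTI.
    exact: (measurableT_comp (@measurable_marked _ _ _ (origin (repr c)))
      (@measurable_cover_marks _ _ r2 _)).
  rewrite (eq_integral (fun s => (\1_((@cover_class c) @^-1` U) s)%:E)).
    by rewrite integral_indic// setIT.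
  by move=> s _; rewrite !indicE; congr (_%:R%:E); apply/idP/idP => /set_mem ?; exact/mem_set.
rewrite (_ : (fun n => _) = (fun n => \int[P]_s (open_approx U n (pattern_class n s))%:E)%E).
  apply: (@dominated_cvg _ _ _ P setT measurableT _ _ (cst 1%E)).
  - move=> n; apply/measurable_EFinP; exact: measurable_pattern_fun.
  - by move=> s _; apply/fine_cvgP; split; [exact: nearW|exact: approx_pattern_cvg].
  - by [].
  - exact: finite_measure_integrable_cst.
  - by move=> n s _; rewrite gee0_abs lee_fin ?open_approx_ge0 ?open_approx_le1.
apply/funext => n; rewrite (integral_pattern r2 p01)// => x.
exact: open_approx_ge0.
Qed.

Lemma covering_law_measurable (A : set E) : measurable A ->
  measurable_fun setT (fun c : Dstar =>
    covering_law (repr c) (marked (origin (repr c)) @^-1` A) : \bar R).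
Proof.
move: A; apply: (measurable_measure_family (G := @kappa_open R (radii R) 0)
  (nu := cover_kernel)).
- by move=> A B; exact: kappa_openI.
- exact: kappa_openT.
- by move=> c A mA; exact: fin_num_measure.
move=> U oU; apply: (emeasurable_fun_cvg (fun n (c : Dstar) =>
  \sum_(TW <- fset_set (disjoint_fsets (repr c) (depth n)))
    (open_approx U n (marked (origin (repr c)) (marks TW)) *
     pattern_prob r p (depth n) (marked (origin (repr c)) (marks TW)))%:E)%E).
  move=> n; apply: (@measurable_two_marks_sum _ _ _ _ _ _ (fun x =>
    (open_approx U n x * pattern_prob r p (depth n) x)%:E)).
    apply/measurable_EFinP; apply: measurable_funM; first exact: measurable_open_approx.
    exact: measurable_pattern_prob.
  by move=> x; rewrite lee_fin mulr_ge0 ?open_approx_ge0 ?pattern_prob_ge0.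
by move=> c _; exact: cover_kernel_cvg.
Qed.

Definition covering_process : equivariant_process (radii R) :=
  EquivariantProcess covering_law_isometry covering_law_measurable.

End CoveringProcess.

(** * Measurability of the covering event *)

Section MeasurableCovers.
Context {R : realType}.
Local Notation E := (marked_Dstar (radii R)).

Definition reaching (e : space_of_classes (radii R) 1) : R :=
  if (1 <= origin_radius (second_point e)) &&
     (points_dist e <= origin_radius (second_point e)) then 1 else 0.

Definition reached (x : E) : \bar R :=
  (\esum_(v in [set: repr x]) (reaching (class_of (add_point v)))%:E)%E.

Definition uncovered (e : space_of_classes (radii R) 1) : R :=
  if reached (second_point e) == 0%E then 1 else 0.

Definition uncovered_count (x : E) : \bar R :=
  (\esum_(v in [set: repr x]) (uncovered (class_of (add_point v)))%:E)%E.

(** Covering says that for every point there is a ball. Each quantifier is expressed by the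
    vanishing of a sum over points: [reached] for the balls, [uncovered_count] for the points. *)
Lemma measurable_uncovered_count : measurable_fun setT uncovered_count.
Proof.
have mreached : measurable_fun setT reached.
  apply: (measurable_esum_add_point (g := EFin \o reaching)); last first.
    by move=> e; rewrite /= /reaching lee_fin; case: ifP.
  have mo := measurableT_comp (@measurable_origin_radius R) (@measurable_second_point _ (radii R)).
  apply/measurable_EFinP; apply: measurable_fun_ifT => //.
  apply: measurable_and; apply: measurable_fun_ler => //.
  exact: measurable_points_dist.
apply: (measurable_esum_add_point (g := EFin \o uncovered)); last first.
  by move=> e; rewrite /= /uncovered lee_fin; case: ifP.
apply/measurable_EFinP; apply: measurable_fun_ifT => //.
apply: measurable_fun_eqe => //.
exact: measurableT_comp mreached (@measurable_second_point _ _).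
Qed.

Lemma reached_eq0 (X : marked_space (radii R) 0) :
  (reached (class_of X) == 0%E) = `[< forall v, ~ nball (point_mark v) v (origin X) >].
Proof.
rewrite /reached (esum_add_point_class_of (fun e => (reaching e)%:E)).
have rE (v : X) : reaching (class_of (add_point v)) =
    if `[< nball (point_mark v) v (origin X) >] then 1 else 0.
  rewrite /reaching points_dist_class_of second_point_add /origin_radius origin_mark_class_of /=.
  congr (if _ then _ else _); apply/andP/asboolP; rewrite /nball/= /point_mark/= (dist_sym v).
    by move=> [].
  by move=> [].
apply/eqP/asboolP => [h v vo|h].
  suff : (1%:E <= 0%:E :> \bar R)%E by rewrite lee_fin ler10.
  rewrite -[leRHS]h; apply: esum_ge; exists [set v]; first by split.
  by rewrite fsbig_set1 rE asboolT.
by apply: esum1 => v _; rewrite rE asboolF//; exact: h.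
Qed.

Lemma uncovered_count_eq0 (x : E) : uncovered_count x = 0%E <-> covers x.
Proof.
have uE (v : repr x) : uncovered (class_of (add_point v)) =
    if `[< forall u : repr x, ~ nball (point_mark u) u v >] then 1 else 0.
  by rewrite /uncovered second_point_add reached_eq0.
rewrite /uncovered_count; split=> [h|cov].
  apply/seteqP; split=> // u _; apply: contrapT => nu.
  suff : (1%:E <= 0%:E :> \bar R)%E by rewrite lee_fin ler10.
  rewrite -[leRHS]h; apply: esum_ge; exists [set u]; first by split.
  by rewrite fsbig_set1 uE asboolT// => v vu; apply: nu; exists v.
apply: esum1 => u _; rewrite uE asboolF// => nu.
have : [set: repr x] u by [].
by rewrite -cov => -[v _]; exact: nu.
Qed.

Lemma measurable_covers : measurable [set x : E | covers x].
Proof.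
have m0 : measurable_fun setT (fun x : E => uncovered_count x == 0%E).
  by apply: measurable_fun_eqe => //; exact: measurable_uncovered_count.
have := m0 measurableT [set true] I; rewrite setTI; congr (measurable _).
by apply/seteqP; split=> x /=; [move/eqP/uncovered_count_eq0|move/uncovered_count_eq0/eqP].
Qed.

End MeasurableCovers.

(** By induction, since [(1 - p) * (1 + p + S) = 1 + S - p * (p + S)]: a further factor never
    increases the product of the two sides. *)
Lemma prod_complement_le (R : realType) (T : Type) (s : seq T) (p : T -> R) :
  (forall v, 0 <= p v <= 1) ->
  \prod_(v <- s) (1 - p v) <= (1 + \sum_(v <- s) p v)^-1.
Proof.
move=> p01; have S0 : 0 <= \sum_(v <- s) p v.
  by apply: sumr_ge0 => v _; have /andP[] := p01 v.
rewrite -[leRHS]mul1r ler_pdivlMr; last by rewrite ltr_pwDl.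
elim: s {S0} => [|v s IH]; first by rewrite !big_nil addr0 mulr1.
rewrite !big_cons.
have P0 : 0 <= \prod_(v <- s) (1 - p v).
  by apply: prodr_ge0 => u _; rewrite subr_ge0; have /andP[] := p01 u.
have S0 : 0 <= \sum_(v <- s) p v.
  by apply: sumr_ge0 => u _; have /andP[] := p01 u.
have /andP[v0 v1] := p01 v.
move: (\prod_(u <- s) (1 - p u)) (\sum_(u <- s) p u) P0 S0 IH => P S P0 S0 IH.
have : P * (p v * S + p v ^+ 2) >= 0.
  by rewrite mulr_ge0// addr_ge0 ?mulr_ge0// exprn_ge0.
nra.
Qed.

Section CoveringEstimate.
Context {R : realType} (mu : probability (@Dstar R) R) (r : nat) (r2 : (1 < r)%N).
Variables (p : @Dstar R -> R).
Hypotheses (mp : measurable_fun setT p) (p01 : forall c, 0 <= p c <= 1).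
Local Notation Z := (covering_process r2 mp p01).

Lemma covering_process_covers : equivariant_covering mu Z.
Proof.
exists (~` [set x | covers x]); split=> //.
  by apply: measurableC; exact: measurable_covers.
change ((\int[mu]_c Z (repr c) (marked (origin (repr c)) @^-1` (~` [set x | covers x])) = 0)%E).
apply: integral0_eq => c _.
rewrite -[RHS](measure0 (coin_law (head_prob p (D := repr c)))).
congr (coin_law _ _); apply/seteqP; split=> // s /= nc; apply: nc.
exact: covers_cover_marks.
Qed.

(** The radius of the root is [r] if it is a head, 1 if its ball of radius [r] contains no head, and
    0 otherwise; the value 1 contributes [1 ^ a = 1]. *)
Lemma mean_radius_pow (a : R) (c : @Dstar R) :
  (\int[process_kernel Z c]_x (radius_pow (origin_radius x) a)%:E =
   (r%:R `^ a * p c +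
     \prod_(v <- fset_set (nball r%:R (origin (repr c)))) (1 - p (pointed_class v)))%:E)%E.
Proof.
set o := origin (repr c).
have mF : measurable_fun setT (fun x : marked_Dstar (radii R) => (radius_pow (origin_radius x) a)%:E).
  by apply/measurable_EFinP; exact: measurable_radius_pow.
have F0 (x : marked_Dstar (radii R)) : (0 <= (radius_pow (origin_radius x) a)%:E)%E.
  by rewrite lee_fin radius_pow_ge0.
rewrite -[in LHS](pointed_class_repr c) integral_process_kernel//.
have mFm : measurable_fun setT (fun m : markings (radii R) (repr c) =>
    (radius_pow (origin_radius (marked o m)) a)%:E).
  exact: measurableT_comp mF (@measurable_marked _ _ _ o).
rewrite [LHS](ge0_integral_distribution (@cover_marks R r r2 _ : {mfun _ >-> _}) mFm)//.
pose P := coin_law (head_prob p (D := repr c)).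
have P01 (v : repr c) : 0 <= head_prob p v <= 1 by exact: p01.
rewrite (eq_integral (fun s : coins (repr c) =>
  (r%:R `^ a)%:E * (\1_[set s : coins (repr c) | s o = true] s)%:E +
  (\1_(~` [set s : coins (repr c) | covered r s o]) s)%:E)%E); last first.
  move=> s _; rewrite /= origin_radius_marked /cover_marks eqxx -EFinM -EFinD !indicE.
  have r0 : (r%:R == 0 :> R) = false by rewrite pnatr_eq0; apply/negbTE; rewrite -lt0n ltnW.
  case so: (s o).
    rewrite /radius_pow /= r0 mem_set// memNset ?mulr1 ?addr0//=; apply.
    by exists o; rewrite distxx.
  rewrite memNset ?mulr0 ?add0r//=; last by rewrite so.
  have [sc|sc] := pselect (covered r s o).
    by rewrite asboolT// memNset//= /radius_pow eqxx.
  by rewrite asboolF// mem_set//= /radius_pow oner_eq0 powR1.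
have mh : measurable ([set s | s o = true] : set (coins (repr c))) by exact: measurable_coin.
have mc : measurable (~` [set s | covered r s o] : set (coins (repr c))).
  by apply: measurableC; exact: measurable_covered.
rewrite ge0_integralD//; first last.
- by apply/measurable_EFinP; exact: measurable_indic.
- by apply/measurable_EFinP/measurable_funM => //; exact: measurable_indic.
rewrite ge0_integralZl//; first last.
- by apply/measurable_EFinP; exact: measurable_indic.
rewrite !integral_indic// !setIT EFinD EFinM; congr (_ * _ + _)%E.
  have -> : [set s : coins (repr c) | s o = true] = [set s | forall v, v \in [:: o] -> s v = true].
    by apply/seteqP; split=> s /= h; [move=> v; rewrite inE => /eqP->|apply: h; rewrite inE].
  rewrite [LHS](coin_law_pattern P01 (fun=> true))//.
  by rewrite big_seq1 /head_prob pointed_class_repr.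
rewrite (_ : ~` _ = [set s : coins (repr c) |
    forall v, v \in (fset_set (nball r%:R o) : seq _) -> s v = false]).
  exact: (coin_law_pattern P01 (fun=> false) (fset_uniq _)).
have r1 : 1 <= r%:R :> R by rewrite ler1n ltnW.
apply/seteqP; split=> s /= h.
  move=> v; rewrite in_fset_set; last exact: finite_nball.
  move=> /set_mem[_ vr]; apply/negP => sv; apply: h; exists v; split=> //.
move=> [t [tr st]]; have := h t; rewrite st in_fset_set; last exact: finite_nball.
by move=> /(_ (mem_set _)) -/(_ (conj r1 tr)).
Qed.

End CoveringEstimate.

(** * The lower bound *)

Section LowerBound.
Context {R : realType} (mu : probability (@Dstar R) R).
Variable w : equivariant_process (nonneg_reals R).
Local Notation P := (marked_law mu w).

Definition mean_origin (c : @Dstar R) : \bar R :=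
  (\int[process_kernel w c]_x (origin_weight x)%:E)%E.

Let mow : measurable_fun setT (fun x : marked_Dstar (nonneg_reals R) => (origin_weight x)%:E).
Proof. by apply/measurable_EFinP; exact: measurable_origin_weight. Qed.

Let ow0 (x : marked_Dstar (nonneg_reals R)) : (0 <= (origin_weight x)%:E)%E.
Proof. by rewrite lee_fin point_mark_ge0. Qed.

Lemma measurable_mean_origin : measurable_fun setT mean_origin.
Proof. exact: measurable_integral_process_kernel. Qed.

Lemma mean_origin_ge0 c : (0 <= mean_origin c)%E.
Proof. exact: integral_ge0. Qed.

Lemma integral_mean_origin : (\int[mu]_c mean_origin c = 'E_P[origin_weight])%E.
Proof. by rewrite unlock integral_marked_law. Qed.

(** Linearity of the mean, all roots seeing the same marking. It relates the head rates in a ball to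
    the weight of that ball. *)
Lemma sum_mean_origin (D : @discrete_space R) (o : D) (r : R) :
  (\sum_(v <- fset_set (nball r o)) mean_origin (pointed_class v) =
   \int[process_kernel w (pointed_class o)]_x (ball_weight r x)%:E)%E.
Proof.
have mbw : measurable_fun setT (fun x : marked_Dstar (nonneg_reals R) => (ball_weight r x)%:E).
  by apply/measurable_EFinP; exact: measurable_ball_weight.
rewrite integral_process_kernel//; last by move=> x; rewrite lee_fin ball_weight_ge0.
rewrite (eq_integral (fun m : markings (nonneg_reals R) D =>
    \sum_(v <- fset_set (nball r o)) (origin_weight (marked v m))%:E)%E); last first.
  move=> m _; rewrite ball_weight_marked fsbig_finite; last exact: finite_nball.
  by rewrite sumEFin; congr EFin; apply: eq_bigr => v _; rewrite origin_weight_marked.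
rewrite ge0_integral_sum//; last first.
  by move=> v; exact: measurableT_comp mow (@measurable_marked _ _ _ v).
by apply: eq_bigr => v _; rewrite /mean_origin integral_process_kernel.
Qed.

Section Scale.
Variables (b : R) (n r : nat) (r2 : (1 < r)%N).
Let K : R := n%:R * r%:R `^ (- b).
Let K0 : 0 <= K. Proof. by rewrite mulr_ge0// powR_ge0. Qed.

Definition big_ball : set (marked_Dstar (nonneg_reals R)) :=
  [set x | r%:R `^ b <= ball_weight r%:R x].

Lemma measurable_big_ball : measurable big_ball.
Proof. exact: (measurable_superlevel (@measurable_ball_weight _ r%:R)). Qed.

(** The minimum is taken in the extended reals, because the conditional mean may be infinite at some
    classes; the result is finite, so [fine] is harmless. *)
Definition head_rate (c : @Dstar R) : R := fine (mine 1 (K%:E * mean_origin c))%E.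

Lemma head_rateE c : (head_rate c)%:E = mine 1%E (K%:E * mean_origin c)%E.
Proof.
rewrite /head_rate fineK// ge0_fin_numE; last first.
  by rewrite le_min lee01 mule_ge0// ?lee_fin// mean_origin_ge0.
by apply: (@le_lt_trans _ _ 1%E); rewrite ?ltry// ge_min lexx.
Qed.

Lemma head_rate01 c : 0 <= head_rate c <= 1.
Proof.
rewrite -!lee_fin head_rateE ge_min lexx andbT.
by rewrite le_min lee01 mule_ge0// ?lee_fin// mean_origin_ge0.
Qed.

Lemma measurable_head_rate : measurable_fun setT head_rate.
Proof.
apply: measurableT_comp; first exact: fine_measurable.
apply: measurable_mine => //; apply: measurable_funeM.
exact: measurable_mean_origin.
Qed.

(** Markov's inequality, conditionally on the unmarked space. *)
Lemma big_ball_mean (c : Dstar) :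
  ((r%:R `^ b)%:E * process_kernel w c big_ball <=
   \int[process_kernel w c]_x (ball_weight r%:R x)%:E)%E.
Proof.
have mB := measurable_big_ball.
rewrite -[in leLHS](setIT big_ball) -integral_indic// -ge0_integralZl//; first last.
- by apply/measurable_EFinP; exact: measurable_indic.
apply: ge0_le_integral => //.
- by apply/measurable_EFinP/measurable_funM => //; exact: measurable_indic.
- by apply/measurable_EFinP; exact: measurable_ball_weight.
move=> x _; rewrite -EFinM lee_fin indicE.
by case: (boolP (x \in _)) => [/set_mem|_]; rewrite ?mulr1// mulr0 ball_weight_ge0.
Qed.

(** If some rate in the ball is 1, the product vanishes. Otherwise no minimum is active, the rates
    sum to at least [n * q] by [big_ball_mean], and it remains to see that
    [1 / (1 + n * q) <= 1 - q + 1 / n.+1]. *)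
Lemma uncovered_le (c : Dstar) :
  \prod_(v <- fset_set (nball r%:R (origin (repr c)))) (1 - head_rate (pointed_class v)) <=
  (1 - fine (process_kernel w c big_ball)) + n.+1%:R^-1.
Proof.
set o := origin (repr c); set B := fset_set _; set q := fine _.
have qE : q%:E = process_kernel w c big_ball.
  by rewrite /q fineK// fin_num_measure//; exact: measurable_big_ball.
have q0 : 0 <= q by exact/fine_ge0/measure_ge0.
have q1 : q <= 1 by rewrite -lee_fin qE; apply: probability_le1; exact: measurable_big_ball.
have [[v [vB v1]]|v1] := pselect (exists v, v \in B /\ (1 <= K%:E * mean_origin (pointed_class v))%E).
  rewrite (_ : \prod_(_ <- _) _ = 0); first by rewrite addr_ge0// subr_ge0.
  apply/eqP; rewrite prodf_seq_eq0; apply/hasP; exists v => //=.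
  have := head_rateE (pointed_class v); rewrite min_l// => -[->].
  by rewrite subrr.
apply: le_trans (prod_complement_le B (fun v => head_rate01 (pointed_class v))) _.
have nq : n%:R * q <= \sum_(v <- B) head_rate (pointed_class v).
  rewrite -lee_fin -sumEFin (eq_big_seq (fun v => K%:E * mean_origin (pointed_class v))%E); last first.
    move=> v vB; rewrite head_rateE min_r// leNgt; apply/negP => h.
    by apply: v1; exists v; split=> //; exact: ltW.
  rewrite -ge0_sume_distrr; last by move=> v _; exact: mean_origin_ge0.
  rewrite sum_mean_origin pointed_class_repr.
  apply: (@le_trans _ _ (K%:E * ((r%:R `^ b)%:E * q%:E))%E).
    rewrite -!EFinM lee_fin /K mulrA -(mulrA n%:R) -powRD ?addNr ?powRr0 ?mulr1//.
    by rewrite pnatr_eq0 -lt0n (ltnW r2) implybT.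
  by apply: lee_wpmul2l; [rewrite lee_fin|rewrite qE; exact: big_ball_mean].
have n0 : 0 <= n%:R :> R by [].
have nq0 : 0 <= n%:R * q by rewrite mulr_ge0.
apply: (@le_trans _ _ (1 + n%:R * q)^-1).
  by rewrite lef_pV2 ?posrE; lra.
rewrite -[X in X^-1]mulr1 -[leLHS]mul1r ler_pdivrMr; last lra.
have nE : n.+1%:R = n%:R + 1 :> R by rewrite natr1.
have I0 : 0 < n.+1%:R^-1 :> R by rewrite invr_gt0.
have I1 : n.+1%:R^-1 * (n%:R + 1) = 1 :> R by rewrite -nE mulVf// pnatr_eq0.
move: (n.+1%:R^-1) I0 I1 => i I0 I1; move: n0 nq0; move: (n%:R) I1 => N I1 N0 Nq0.
(* After clearing the denominator [1 + N * q], the difference of the two sides is exactly this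
   quantity. *)
have : 0 <= i * (1 - q) + N * q * (1 - q) by rewrite addr_ge0 ?mulr_ge0//; lra.
nra.
Qed.

Lemma hausdorff_content_le (a : R) :
  (hausdorff_content a mu <= (n%:R * r%:R `^ (a - b))%:E * 'E_P[origin_weight] +
     P (~` big_ball) + (n.+1%:R^-1)%:E)%E.
Proof.
pose Z := covering_process r2 measurable_head_rate head_rate01.
apply: (@le_trans _ _ ('E_(marked_law mu Z)[fun x => radius_pow (origin_radius x) a])%E).
  by apply: ereal_inf_lbound; exists Z => //; exact: covering_process_covers.
have mk : measurable_fun setT (fun c => process_kernel w c (~` big_ball)).
  by apply: measurable_process_kernel; apply: measurableC; exact: measurable_big_ball.
have mm := measurable_mean_origin.
have ra0 : 0 <= n%:R * r%:R `^ (a - b) by rewrite mulr_ge0// powR_ge0.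
have i0 : 0 <= n.+1%:R^-1 :> R by rewrite invr_ge0.
have mR : measurable_fun setT (fun x : marked_Dstar (radii R) => (radius_pow (origin_radius x) a)%:E).
  by apply/measurable_EFinP; exact: measurable_radius_pow.
have R0 (x : marked_Dstar (radii R)) : (0 <= (radius_pow (origin_radius x) a)%:E)%E.
  by rewrite lee_fin radius_pow_ge0.
rewrite unlock integral_marked_law//.
pose f c : \bar R := ((n%:R * r%:R `^ (a - b))%:E * mean_origin c)%E.
have f0 c : (0 <= f c)%E by rewrite mule_ge0// ?lee_fin// mean_origin_ge0.
have mf : measurable_fun setT f by exact: measurable_funeM.
(* Dropping the minimum bounds [r ^ a] times the head rate by [f c]. *)
apply: (@le_trans _ _ (\int[mu]_c (f c + process_kernel w c (~` big_ball) + (n.+1%:R^-1)%:E))%E).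
  apply: ge0_le_integral => //.
  - by move=> c _; exact: integral_ge0.
  - exact: measurable_integral_process_kernel.
  - by apply: emeasurable_funD => //; exact: emeasurable_funD.
  move=> c _; rewrite mean_radius_pow EFinD -addeA; apply: leeD.
    rewrite EFinM head_rateE; apply: (@le_trans _ _ ((r%:R `^ a)%:E * (K%:E * mean_origin c))%E).
      by apply: lee_wpmul2l; [rewrite lee_fin powR_ge0|rewrite ge_min lexx orbT].
    rewrite /f muleA -EFinM /K mulrCA -powRD//.
    by rewrite pnatr_eq0 -lt0n (ltnW r2) implybT.
  rewrite probability_setC; last exact: measurable_big_ball.
  rewrite -[process_kernel w c big_ball]fineK; last first.
    by rewrite fin_num_measure//; exact: measurable_big_ball.
  by rewrite -EFinB -EFinD lee_fin uncovered_le.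
rewrite ge0_integralD//; first last.
- by apply: emeasurable_funD.
- by move=> c _; rewrite adde_ge0.
rewrite ge0_integralD// integral_cst// [X in (_ * X)%E]probability_setT mule1.
rewrite ge0_integralZl ?lee_fin//; last by move=> c _; exact: mean_origin_ge0.
by rewrite integral_mean_origin unlock.
Qed.

End Scale.

Hypothesis w_lty : ('E_P[origin_weight] < +oo)%E.

(** The tail events that some radius beyond [k] fails decrease to a null set, because a lower growth
    above [b] makes all large radii succeed; continuity from above then applies. *)
Lemma big_ball_cvg (b : R) :
  (\forall x \ae P, (b%:E < lower_growth (fun r => (ball_weight r x)%:E))%E) ->
  (P (~` big_ball b r) @[r --> \oo] --> 0)%E.
Proof.
move=> growth.
pose S k := \bigcup_(r in [set r | (k <= r)%N]) ~` big_ball b r.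
have mS k : measurable (S k).
  by apply: bigcup_measurable => r _; apply: measurableC; exact: measurable_big_ball.
have S0 : P (\bigcap_k S k) = 0%E.
  apply/negligibleP; first by apply: bigcapT_measurable.
  apply: negligibleS growth => x Sx /= /lower_growth_gt[r0 _ r0x].
  have [r /= r0r nb] := Sx (Num.truncn r0).+1 I; apply: nb.
  rewrite /big_ball/= -lee_fin; apply: r0x.
  by apply: le_trans (ltW (truncnS_gt r0)) _; rewrite ler_nat.
have : (P (S k) @[k --> \oo] --> 0)%E.
  rewrite -S0; apply: nonincreasing_cvg_mu => //.
  - by apply: (@le_lt_trans _ _ 1%E); [exact: probability_le1|exact: ltry].
  - exact: bigcapT_measurable.
  - by move=> k l kl; apply/subsetPset => x [r /= lr]; exists r => //=; exact: leq_trans lr.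
apply: squeeze_cvge; last exact: cvg_cst.
apply: nearW => k; rewrite measure_ge0 /=; apply: le_measure; rewrite ?inE//.
  by apply: measurableC; exact: measurable_big_ball.
by move=> x xk; exists k => /=.
Qed.

Lemma lower_le_udim_H :
  (ess_inf P (fun x => lower_growth (fun r => (ball_weight r x)%:E)) <= udim_H mu)%E.
Proof.
(* Two exponents are separated: the content vanishes at [a] since [r ^ (a - b)] tends to 0, and then
   [udim_H mu] is at least [a], a contradiction. *)
rewrite leNgt; apply/negP => /ereal_between[a [ua /ereal_between[b [+ bl]]]].
rewrite lte_fin => ab.
have a0 : 0 <= a.
  by rewrite -lee_fin; apply: le_trans (ltW ua); rewrite /udim_H le_max lexx.
move: ua; rewrite ltNge => /negP; apply.
rewrite /udim_H le_max; apply/orP; right; apply: ereal_sup_ubound; exists a => //=.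
split=> //; apply/eqP; rewrite eq_le; apply/andP; split; last first.
  apply: le_ereal_inf_tmp => _ [Z _ <-]; rewrite unlock; apply: integral_ge0 => x _.
  by rewrite lee_fin radius_pow_ge0.
apply/lee_addgt0Pr => e e0; rewrite add0e.
have growth : \forall x \ae P, (b%:E < lower_growth (fun r => (ball_weight r x)%:E))%E.
  by apply: filterS (ess_inf_le _ _) => x; exact: lt_le_trans.
have [W W0 WE] : exists2 W : R, 0 <= W & W%:E = 'E_P[origin_weight]%E.
  exists (fine 'E_P[origin_weight]%E); first by rewrite fine_ge0// unlock; exact: integral_ge0.
  by rewrite fineK// ge0_fin_numE// unlock; exact: integral_ge0.
have e3 : 0 < e / 3 by rewrite divr_gt0.
have [n ne] : exists n : nat, n.+1%:R^-1 <= e / 3.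
  by have /ltr_add_invr[n] := e3; rewrite add0r => /ltW; exists n.
(* With [n] already fixed, [r ^ (b - a) >= C] brings the first term of the estimate below [e / 3];
   the summand 1 keeps [C] positive. *)
pose C := n%:R * W / (e / 3) + 1.
have C1 : 1 <= C by rewrite lerDr divr_ge0 ?mulr_ge0// ltW.
have : \forall r \near \oo, [/\ (1 < r)%N, C `^ (b - a)^-1 <= r%:R &
    (P (~` big_ball b r) <= (e / 3)%:E)%E].
  near=> r; split; near: r.
  - by exists 2%N.
  - exact: nbhs_infty_ger.
  - have := big_ball_cvg growth.
    move/fine_cvgP => [fin /cvgr0Pnorm_le/(_ _ e3)].
    apply: filterS2 fin => r fin; rewrite /= ger0_norm ?fine_ge0// => h.
    by rewrite -[leLHS]fineK// lee_fin.
move=> [r _ /(_ r (leqnn r))[r2 Cr re]].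
apply: le_trans (hausdorff_content_le b n r2 a) _.
rewrite (_ : e = e / 3 + e / 3 + e / 3); last lra.
rewrite 2!EFinD; apply: leeD; last by rewrite lee_fin.
apply: leeD => //; rewrite -WE -EFinM lee_fin.
have r0 : 0 < r%:R :> R by rewrite ltr0n ltnW.
have Cb : C <= r%:R `^ (b - a).
  have CE : C = (C `^ (b - a)^-1) `^ (b - a).
    by rewrite -powRrM mulVf ?powRr1 ?subr_eq0 ?gt_eqF//; lra.
  rewrite CE; apply: ge0_ler_powR; rewrite ?nnegrE ?powR_ge0//; lra.
rewrite -(opprB b a) powRN mulrAC ler_pdivrMr ?powR_gt0// -ler_pdivrMl// mulrC.
by apply: le_trans Cb; rewrite /C lerDl.
Unshelve. all: by end_near.
Qed.

End LowerBound.

Local Open Scope ereal_scope.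

Theorem theorem5p6 (R : realType) (mu : probability (@Dstar R) R)
    (mu_unimodular : unimodular mu)
    (w : equivariant_process (nonneg_reals R))
    (w_gt0 : 0 < 'E_(marked_law mu w)[origin_weight])
    (w_lty : 'E_(marked_law mu w)[origin_weight] < +oo) :
  let P := marked_law mu w in
  let lower := ess_inf P (fun x => lower_growth (fun r => (ball_weight r x)%:E)) in
  let upper := ess_inf P (fun x => upper_growth (fun r => (ball_weight r x)%:E)) in
  let mean := upper_growth (fun r => 'E_P[ball_weight r]) in
  [/\ lower <= udim_H mu,
      (\forall x \ae P, nonzero_weight x) ->
        udim_H mu <= upper,
      upper <= mean &
      udim_H mu <= mean].
Proof.
split.
- exact: lower_le_udim_H.
- exact: udim_H_le_upper.
- exact: upper_le_mean.
- exact: udim_H_le_mean.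
Qed.
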